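(* Let $\{a(j)\}_{j\ge0}$ be complex numbers with $\sum_{j=0}^\infty|a(j)|<\infty$ and $\sum_{j=0}^\infty(j+1)|a(j)|^2<\infty$, let $P>0$, and $A\xi=\sum_{j=0}^\infty a(j)\xi(j)$. Let $\Xi$ be the class of wide sense stationary sequences $\xi=\{\xi(j),j\in\mathbb Z\}$ with $E\xi(j)=0$, $E|\xi(j)|^2\le P$, let $\Lambda$ be the class of linear estimates $\hat A$ of $A\xi$ based on $\xi(j)$, $j=-1,-2,\dots$, and let $\Delta(\xi,\hat A)=E|A\xi-\hat A\xi|^2$. Then $\Delta$ has a saddle point on $\Xi\times\Lambda$ and $$\min_{\hat A\in\Lambda}\max_{\xi\in\Xi}\Delta(\xi,\hat A)=\max_{\xi\in\Xi}\min_{\hat A\in\Lambda}\Delta(\xi,\hat A)=P\nu^2,$$ where $\nu^2$ is the greatest eigenvalue of the selfadjoint compact operator in $\ell_2$ given by the matrix $Q=\{Q(p,q)\}_{p,q=0}^\infty$, $Q(p,q)=\sum_{u=0}^\infty a(p+u)\overline{a(q+u)}$. The least favourable sequence in $\Xi$ for the optimal linear estimation of $A\xi$ (a sequence in $\Xi$ at which the max-min is attained) is the moving average sequence $$\xi(j)=\sum_{u=-\infty}^{j}\varphi(j-u)\varepsilon(u),$$ where $\varepsilon(u)$ is a zero mean sequence with $E\varepsilon(i)\overline{\varepsilon(j)}=\delta_{ij}$ and $\{\varphi(u)\}_{u\ge0}\in\ell_2$ is an eigenvector corresponding to $\nu^2$, i.e. $\sum_{p=0}^\infty\varphi(p)Q(p,q)=\nu^2\varphi(q)$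 for all $q\ge0$, normalized by $\sum_{u=0}^\infty|\varphi(u)|^2=P$.
   Context: A wide sense stationary sequence $\xi$ with zero mean has a spectral measure $F_\xi$ on $[-\pi,\pi)$ with $E\xi(n)\overline{\xi(0)}=\int_{-\pi}^{\pi}e^{in\lambda}F_\xi(d\lambda)$, and a spectral representation $\xi(n)=\int_{-\pi}^{\pi} e^{in\lambda}Z_\xi(d\lambda)$ with an orthogonal stochastic measure $Z_\xi$, $E|Z_\xi(B)|^2=F_\xi(B)$. A linear estimate is given by a Borel function $h$ on $[-\pi,\pi)$ (its spectral characteristic), the same for all sequences: $\hat A\xi=\int h\,dZ_\xi$. It is admissible for $\xi$ if $h$ lies in the closed linear span $L_2^-(F_\xi)$ of $\{e^{ij\lambda}: j\le -1\}$ in $L_2(F_\xi)$; then $\Delta(\xi,\hat A)=\int_{-\pi}^{\pi}\left|\sum_{j=0}^\infty a(j)e^{ij\lambda}-h(\lambda)\right|^2F_\xi(d\lambda)$, and $\Delta(\xi,\hat A)=+\infty$ if $h$ is not admissible for $\xi$. $\Lambda$ is the set of all such estimates. For a fixed estimate the maximum over $\xi\in\Xi$ is understood as a supremum. A saddle point is a pair $(\xi^0,\hat A^0)\in\Xi\times\Lambda$ with $\Delta(\xi,\hat A^0)\le\Delta(\xi^0,\hat A^0)\le\Delta(\xi^0,\hat A)$ for all $\xi\in\Xi$, $\hat A\in\Lambda$. *)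

(* Defs.v *)
From HB Require Import structures.
From mathcomp Require Export all_boot all_order all_algebra.
From mathcomp Require Export all_classical all_reals all_analysis.
From mathcomp.real_closed Require Export complex.
Export Order.TTheory GRing.Theory Num.Theory.
Export numFieldNormedType.Exports.

Set Implicit Arguments.
Unset Strict Implicit.
Unset Printing Implicit Defensive.

Local Open Scope classical_set_scope.
Local Open Scope ring_scope.
Local Open Scope complex_scope.

Definition sqmod {R : realType} (z : R[i]) : R := (ComplexField.Normc.normc z) ^+ 2.

Definition cmeasurable {R : realType} {d : measure_display}
    {T : measurableType d} (D : set T) (f : T -> R[i]) : Prop :=
  measurable_fun D (fun x => complex.Re (f x)) /\
  measurable_fun D (fun x => complex.Im (f x)).

Definition cintegral {R : realType} {d : measure_display}
    {T : measurableType d} (mu : {measure set T -> \bar R}) (D : set T)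
    (f : T -> R[i]) : R[i] :=
  Rintegral mu D (fun x => complex.Re (f x)) +i*
  Rintegral mu D (fun x => complex.Im (f x)).

Definition csummable {R : realType} (u : nat -> R[i]) : Prop :=
  cvgn (series (fun n => complex.Re (u n))) /\
  cvgn (series (fun n => complex.Im (u n))).

(* Meaningful only when [csummable u]. *)
Definition csum {R : realType} (u : nat -> R[i]) : R[i] :=
  limn (series (fun n => complex.Re (u n))) +i*
  limn (series (fun n => complex.Im (u n))).

Definition cexpi {R : realType} (n : int) (x : R) : R[i] :=
  cos (n%:~R * x) +i* sin (n%:~R * x).

Definition torus (R : realType) : set (measurableTypeR R) := `[- pi, pi[.
Arguments torus : clear implicits.

(* A complex random sequence indexed by the integers, together with the
   probability space on which it lives; the space is part of the data, so that
   a class of sequences ranges over all probability spaces. *)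
Record process (R : realType) := Process {
  pr_disp : measure_display;
  pr_space : measurableType pr_disp;
  pr_prob : probability pr_space R;
  pr_val :> int -> pr_space -> R[i] }.

Definition expect {R : realType} {d : measure_display} {T : measurableType d}
    (Pr : probability T R) (X : T -> R[i]) : R[i] := cintegral Pr setT X.

Definition second_moment {R : realType} {d : measure_display}
    {T : measurableType d} (Pr : probability T R) (X : T -> R[i]) : \bar R :=
  (\int[Pr]_w (sqmod (X w))%:E)%E.

Definition square_integrable_rv {R : realType} {d : measure_display}
    {T : measurableType d} (Pr : probability T R) (X : T -> R[i]) : Prop :=
  cmeasurable setT X /\ (second_moment Pr X < +oo)%E.

Definition wide_sense_stationary {R : realType} (xi : process R) : Prop :=
  [/\ forall n, square_integrable_rv (pr_prob xi) (xi n),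
      forall n, expect (pr_prob xi) (xi n) = expect (pr_prob xi) (xi 0) &
      forall n k : int,
        expect (pr_prob xi) (fun w => xi (n + k) w * (xi k w)^*) =
        expect (pr_prob xi) (fun w => xi n w * (xi 0 w)^*)].

(* A predicate rather than a [set]: the type of processes is too large to be
   the carrier of a [set]. *)
Definition Xi {R : realType} (P : R) (xi : process R) : Prop :=
  [/\ wide_sense_stationary xi,
      forall j, expect (pr_prob xi) (xi j) = 0 &
      forall j, (second_moment (pr_prob xi) (xi j) <= P%:E)%E].

(* The set of values taken on Xi by a function of the process. *)
Definition values_on_Xi {R : realType} (P : R) (f : process R -> \bar R) :
    set (\bar R) :=
  [set y | exists2 xi : process R, Xi P xi & f xi = y].

Definition is_spectral_measure {R : realType} (xi : process R)
    (F : {measure set (measurableTypeR R) -> \bar R}) : Prop :=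
  [/\ (F setT < +oo)%E,
      F (~` torus R) = 0%E &
      forall n : int,
        expect (pr_prob xi) (fun w => xi n w * (xi 0 w)^*) =
        cintegral F (torus R) (cexpi n)].

(* For a wide sense stationary sequence with zero mean the spectral measure
   exists (Herglotz) and is unique, so the default value [mzero] is never
   taken there and the choice is immaterial. *)
Definition spectral_measure {R : realType} (xi : process R) :
    {measure set (measurableTypeR R) -> \bar R} :=
  match pselect (exists F, is_spectral_measure xi F) with
  | left ex => sval (cid ex)
  | right _ => mzero
  end.

Definition L2sq {R : realType}
    (F : {measure set (measurableTypeR R) -> \bar R})
    (f : measurableTypeR R -> R[i]) : \bar R :=
  (\int[F]_(x in torus R) (sqmod (f x))%:E)%E.

(* A linear estimate is represented by its spectral characteristic; values
   outside [-pi, pi) are irrelevant. *)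
Definition Lambda (R : realType) : set (measurableTypeR R -> R[i]) :=
  [set h | cmeasurable (torus R) h].
Arguments Lambda : clear implicits.

(* h belongs to the closed linear span of e^{i j x}, j <= -1, in L_2(F). *)
Definition in_L2_past {R : realType}
    (F : {measure set (measurableTypeR R) -> \bar R})
    (h : measurableTypeR R -> R[i]) : Prop :=
  [/\ cmeasurable (torus R) h,
      (L2sq F h < +oo)%E &
      forall e : R, 0 < e -> exists (N : nat) (c : nat -> R[i]),
        (L2sq F (fun x =>
           (h x - \sum_(k < N) c k * cexpi (- (k.+1)%:Z) x)%R) < e%:E)%E].

Definition A_spectral {R : realType} (a : nat -> R[i]) (x : R) : R[i] :=
  csum (fun j => a j * cexpi j%:Z x).

(* E|A xi - \int h dZ_xi|^2, computed in L_2(F_xi) through the isometry that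
   sends e^{i n x} to xi(n); +oo when h is not admissible for xi. *)
Definition Delta {R : realType} (a : nat -> R[i]) (xi : process R)
    (h : measurableTypeR R -> R[i]) : \bar R :=
  if `[< in_L2_past (spectral_measure xi) h >]
  then L2sq (spectral_measure xi) (fun x => A_spectral a x - h x)
  else +oo%E.

Definition is_minimum {R : realType} (S : set (\bar R)) (m : \bar R) : Prop :=
  S m /\ lbound S m.

Definition is_maximum {R : realType} (S : set (\bar R)) (m : \bar R) : Prop :=
  S m /\ ubound S m.

Definition max_error {R : realType} (a : nat -> R[i]) (P : R)
    (h : measurableTypeR R -> R[i]) : \bar R :=
  ereal_sup (values_on_Xi P (fun xi => Delta a xi h)).

Definition min_error {R : realType} (a : nat -> R[i]) (xi : process R) :
    \bar R :=
  ereal_inf [set Delta a xi h | h in Lambda R].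

Definition saddle_point {R : realType} (a : nat -> R[i]) (P : R)
    (xi0 : process R) (h0 : measurableTypeR R -> R[i]) : Prop :=
  [/\ Xi P xi0, Lambda R h0,
      forall xi, Xi P xi -> (Delta a xi h0 <= Delta a xi0 h0)%E &
      forall h, Lambda R h -> (Delta a xi0 h0 <= Delta a xi0 h)%E].

Definition least_favourable {R : realType} (a : nat -> R[i]) (P : R)
    (xi : process R) : Prop :=
  Xi P xi /\ is_maximum (values_on_Xi P (min_error a)) (min_error a xi).

Definition l2 {R : realType} (x : nat -> R[i]) : Prop :=
  cvgn (series (fun n => sqmod (x n))).

Definition l2_sqnorm {R : realType} (x : nat -> R[i]) : R :=
  limn (series (fun n => sqmod (x n))).

Definition l2_inner {R : realType} (x y : nat -> R[i]) : R[i] :=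
  csum (fun n => x n * (y n)^*).

Definition Qmx {R : realType} (a : nat -> R[i]) (p q : nat) : R[i] :=
  csum (fun u => a (p + u)%N * (a (q + u)%N)^*).

(* The matrix acts on row vectors. *)
Definition matrix_op {R : realType} (M : nat -> nat -> R[i])
    (x : nat -> R[i]) : nat -> R[i] :=
  fun q => csum (fun p => x p * M p q).

Definition matrix_op_on_l2 {R : realType} (M : nat -> nat -> R[i]) : Prop :=
  forall x, l2 x ->
    (forall q, csummable (fun p => x p * M p q)) /\ l2 (matrix_op M x).

Definition selfadjoint_op {R : realType}
    (T : (nat -> R[i]) -> (nat -> R[i])) : Prop :=
  forall x y, l2 x -> l2 y -> l2_inner (T x) y = l2_inner x (T y).

Definition compact_op {R : realType}
    (T : (nat -> R[i]) -> (nat -> R[i])) : Prop :=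
  forall (x : nat -> nat -> R[i]) (M : R),
    (forall n, l2 (x n) /\ l2_sqnorm (x n) <= M) ->
    exists (s : nat -> nat) (y : nat -> R[i]),
      [/\ {homo s : m n / (m < n)%N >-> (m < n)%N},
          l2 y &
          (fun n => l2_sqnorm (fun q => T (x (s n)) q - y q)) @ \oo --> (0 : R)].

Definition is_eigenvector {R : realType}
    (T : (nat -> R[i]) -> (nat -> R[i])) (mu : R[i]) (x : nat -> R[i]) : Prop :=
  [/\ l2 x, exists n, x n <> 0 & forall q, T x q = mu * x q].

Definition is_eigenvalue {R : realType}
    (T : (nat -> R[i]) -> (nat -> R[i])) (mu : R[i]) : Prop :=
  exists x, is_eigenvector T mu x.

(* In the partial order of R[i], mu <= r%:C means that mu is real and at most
   r. *)
Definition greatest_eigenvalue {R : realType}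
    (T : (nat -> R[i]) -> (nat -> R[i])) (r : R) : Prop :=
  is_eigenvalue T r%:C /\ forall mu : R[i], is_eigenvalue T mu -> mu <= r%:C.

Definition white_noise {R : realType} {d : measure_display}
    {T : measurableType d} (Pr : probability T R)
    (eps : int -> T -> R[i]) : Prop :=
  [/\ forall u, square_integrable_rv Pr (eps u),
      forall u, expect Pr (eps u) = 0 &
      forall i j, expect Pr (fun w => eps i w * (eps j w)^*) = (i == j)%:R].

(* xi(j) = \sum_{u <= j} phi(j - u) eps(u), the series converging in mean
   square; the summation index is k = j - u. *)
Definition moving_average {R : realType} (phi : nat -> R[i]) (xi : process R)
    (eps : int -> pr_space xi -> R[i]) : Prop :=
  forall j : int, cmeasurable setT (xi j) /\
    (fun N : nat => second_moment (pr_prob xi)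
       (fun w => xi j w - \sum_(k < N) phi k * eps (j - k%:Z) w)) @ \oo
    --> 0%E.

(* Main.v *)
(** The operator [Q] is the Hankel operator [x |-> hankel a x] followed by its
    adjoint, so [nu] is the norm of the Hankel operator. For the upper bound,
    Nehari's theorem gives a function [h0] with past spectrum such that
    [|A - h0| <= nu] on the whole circle: [a] is extended step by step to negative
    indices without increasing the Hankel norm, Fejer means of the extensions give
    past polynomials [p] with [|A - p| <= nu + o(1)], and a suitable sequence of
    such polynomials converges to [h0] off a Lebesgue null set [N]. A spectral
    measure may charge [N], but [h0] is admissible for all of them, because the
    functions [1_N e^{i m x}] are limits of past polynomials in [L_2] of every
    finite measure (peak functions of compact null sets). As a spectral measure
    has mass at most [P], the error of [h0] is at most [P nu^2].

    For the lower bound, let [xi] be the moving average with an eigenvector [phi].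
    By Bessel's inequality with respect to the innovations [eps u], [u >= 0], the
    error of any linear estimate is at least [|hankel a phi|^2 = P nu^2]. *)
Require Import Defs.
From HB Require Import structures.
From mathcomp Require Import measurable_realfun.
From mathcomp Require Import ring lra zify.

Set Implicit Arguments.
Unset Strict Implicit.
Unset Printing Implicit Defensive.

Local Open Scope classical_set_scope.
Local Open Scope ring_scope.
Local Open Scope complex_scope.

Local Notation Re := complex.Re.
Local Notation Im := complex.Im.
Local Notation normc := ComplexField.Normc.normc.
Local Notation "x ^*" := (Num.conj x) : complex_scope.

(** One function has to serve all spectral measures, so a best approximation known only Lebesgue
    almost everywhere does not suffice. For this reason the convergence set in [riesz_fischer] is
    explicit, and the approximants are made to converge in norm, as least-norm elements of convex
    sets, and not just weakly. The weight j + 1 in the second hypothesis counts the entries on an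
    antidiagonal: the sum is the squared Hilbert-Schmidt norm of the Hankel matrix, which underlies
    the compactness of [Q] and the existence of a vector where the norm nu is attained. An
    eigenvector satisfies |hankel a phi|^2 = nu^2 |phi|^2, so the normalization |phi|^2 = P makes
    the two bounds meet. The noise of the moving average need not be the prediction innovation of
    [xi]; Bessel's inequality bounds the error from below only, and equality comes from [h0]. The
    lower bound also needs a genuine spectral measure, as the default [mzero] would give error zero.
    It is built on the circle with density |Phi|^2, where Phi is the Fourier series of phi in the
    past exponentials. *)

Section ComplexNumbers.
Context {R : realType}.
Implicit Types (x y z : R[i]) (r : R).

Lemma complex_eqP x y : Re x = Re y -> Im x = Im y -> x = y.
Proof. by case: x => a b; case: y => c d /= -> ->. Qed.
Lemma ReD x y : Re (x + y) = Re x + Re y. Proof. by case: x; case: y. Qed.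
Lemma ImD x y : Im (x + y) = Im x + Im y. Proof. by case: x; case: y. Qed.
Lemma ReN x : Re (- x) = - Re x. Proof. by case: x. Qed.
Lemma ImN x : Im (- x) = - Im x. Proof. by case: x. Qed.
Lemma ReM x y : Re (x * y) = Re x * Re y - Im x * Im y.
Proof. by case: x; case: y. Qed.
Lemma ImM x y : Im (x * y) = Re x * Im y + Im x * Re y.
Proof. by case: x => a b; case: y => c d /=. Qed.
Lemma ReJ x : Re x^* = Re x. Proof. by case: x. Qed.
Lemma ImJ x : Im x^* = - Im x. Proof. by case: x. Qed.
Lemma conjCr (r : R) : (r%:C)^* = r%:C :> R[i].
Proof. by apply: complex_eqP; rewrite /= ?oppr0. Qed.
Lemma Re_sum I (s : seq I) (Q : pred I) (f : I -> R[i]) :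
  Re (\sum_(i <- s | Q i) f i) = \sum_(i <- s | Q i) Re (f i).
Proof. by elim/big_rec2 : _ => // i x y _ <-; rewrite ReD. Qed.
Lemma Im_sum I (s : seq I) (Q : pred I) (f : I -> R[i]) :
  Im (\sum_(i <- s | Q i) f i) = \sum_(i <- s | Q i) Im (f i).
Proof. by elim/big_rec2 : _ => // i x y _ <-; rewrite ImD. Qed.

Definition ReImE := (ReD, ImD, ReN, ImN, ReM, ImM, ReJ, ImJ).


Lemma sqmodE x : sqmod x = Re x ^+ 2 + Im x ^+ 2.
Proof.
case: x => a b; rewrite /sqmod /= sqr_sqrtr //.
by rewrite addr_ge0 // sqr_ge0.
Qed.

Lemma normc_ge0 x : 0 <= normc x.
Proof. by case: x => a b; exact: sqrtr_ge0. Qed.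

Lemma normcE x : normc x = Num.sqrt (Re x ^+ 2 + Im x ^+ 2).
Proof. by case: x. Qed.

Lemma sqmod_ge0 x : 0 <= sqmod x.
Proof. exact: sqr_ge0. Qed.
Lemma sqmod0 : sqmod (0 : R[i]) = 0.
Proof. by rewrite sqmodE /= expr0n addr0. Qed.
Lemma sqmod_eq0 x : sqmod x = 0 -> x = 0.
Proof.
by move/eqP; rewrite sqrf_eq0 => /eqP /ComplexField.Normc.eq0_normc.
Qed.
Lemma sqmodM x y : sqmod (x * y) = sqmod x * sqmod y.
Proof. by rewrite !sqmodE !ReImE; ring. Qed.
Lemma sqmodN x : sqmod (- x) = sqmod x.
Proof. by rewrite !sqmodE !ReImE; ring. Qed.
Lemma sqmodJ x : sqmod x^* = sqmod x.
Proof. by rewrite !sqmodE !ReImE; ring. Qed.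
Lemma sqmodBC x y : sqmod (x - y) = sqmod (y - x).
Proof. by rewrite -sqmodN opprB. Qed.
Lemma sqmodr r : sqmod r%:C = r ^+ 2.
Proof. by rewrite sqmodE /=; ring. Qed.
Lemma mulcJ x : x * x^* = (sqmod x)%:C.
Proof. by apply: complex_eqP; rewrite ?sqmodE !ReImE /=; ring. Qed.
Lemma sqmodD_le x y : sqmod (x + y) <= 2 * sqmod x + 2 * sqmod y.
Proof.
rewrite -subr_ge0; have -> : 2 * sqmod x + 2 * sqmod y - sqmod (x + y) = sqmod (x - y).
  by rewrite !sqmodE !ReImE; ring.
exact: sqmod_ge0.
Qed.
Lemma Re_sqr_le x : Re x ^+ 2 <= sqmod x.
Proof. by rewrite sqmodE lerDl sqr_ge0. Qed.
Lemma Im_sqr_le x : Im x ^+ 2 <= sqmod x.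
Proof. by rewrite sqmodE lerDr sqr_ge0. Qed.
Lemma normr_Re_le x : `|Re x| <= normc x.
Proof.
rewrite -(@ler_pXn2r _ 2) ?nnegrE ?normc_ge0 // real_normK ?num_real //.
exact: Re_sqr_le.
Qed.
Lemma normr_Im_le x : `|Im x| <= normc x.
Proof.
rewrite -(@ler_pXn2r _ 2) ?nnegrE ?normc_ge0 // real_normK ?num_real //.
exact: Im_sqr_le.
Qed.
Lemma normcr r : normc r%:C = `|r|.
Proof. by rewrite normcE /= expr0n addr0 sqrtr_sqr. Qed.
Lemma normc0' : normc (0 : R[i]) = 0.
Proof. exact: ComplexField.Normc.normc0. Qed.
Lemma normcM' x y : normc (x * y) = normc x * normc y.
Proof. exact: ComplexField.Normc.normcM. Qed.
Lemma normc_sum I (s : seq I) (Q : pred I) (f : I -> R[i]) :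
  normc (\sum_(i <- s | Q i) f i) <= \sum_(i <- s | Q i) normc (f i).
Proof.
elim/big_ind2 : _ => [|x u y v h1 h2|//]; first by rewrite normc0'.
exact: le_trans (le_normcD _ _) (lerD _ _).
Qed.
Lemma normc_le_sqmod x r : 0 <= r -> sqmod x <= r ^+ 2 -> normc x <= r.
Proof. by move=> r0; rewrite ler_pXn2r ?nnegrE ?normc_ge0. Qed.
Lemma sqmod_le_normc x r : normc x <= r -> sqmod x <= r ^+ 2.
Proof.
move=> xr; rewrite ler_pXn2r ?nnegrE ?normc_ge0 //.
exact: le_trans (normc_ge0 x) xr.
Qed.

Lemma sqmod_real_sum (n : nat) (f : 'I_n -> R) :
  (\sum_(i < n) f i)%:C = \sum_(i < n) (f i)%:C :> R[i].
Proof. by rewrite (raddf_sum (real_complex R)). Qed.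

End ComplexNumbers.

(** * Limits of complex sequences *)

Section ComplexLimits.
Context {R : realType}.
Implicit Types (u v : nat -> R[i]) (l m : R[i]).

(** Convergence is taken by components to match [csummable] and [csum]. *)
Definition cvgC u l : Prop :=
  (fun n => Re (u n)) @ \oo --> Re l /\ (fun n => Im (u n)) @ \oo --> Im l.

Lemma cvgC_unique u l m : cvgC u l -> cvgC u m -> l = m.
Proof.
move=> [h1 h2] [h3 h4].
by apply: complex_eqP; [exact: (cvg_unique _ h1 h3)|exact: (cvg_unique _ h2 h4)].
Qed.

Lemma cvgC_cst l : cvgC (fun=> l) l.
Proof. by split; exact: cvg_cst. Qed.

Lemma cvgCD u v l m : cvgC u l -> cvgC v m -> cvgC (fun n => u n + v n) (l + m).
Proof.
move=> [h1 h2] [h3 h4]; split; rewrite ReImE.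
  by under eq_fun do rewrite ReD; exact: cvgD.
by under eq_fun do rewrite ImD; exact: cvgD.
Qed.

Lemma cvgCN u l : cvgC u l -> cvgC (fun n => - u n) (- l).
Proof.
move=> [h1 h2]; split; rewrite ReImE.
  by under eq_fun do rewrite ReN; exact: cvgN.
by under eq_fun do rewrite ImN; exact: cvgN.
Qed.

Lemma cvgCB u v l m : cvgC u l -> cvgC v m -> cvgC (fun n => u n - v n) (l - m).
Proof. by move=> h1 h2; apply: cvgCD => //; exact: cvgCN. Qed.

Lemma cvgCJ u l : cvgC u l -> cvgC (fun n => (u n)^*) l^*.
Proof.
move=> [h1 h2]; split; rewrite ReImE.
  by under eq_fun do rewrite ReJ.
by under eq_fun do rewrite ImJ; exact: cvgN.
Qed.

Lemma cvgCM u v l m : cvgC u l -> cvgC v m -> cvgC (fun n => u n * v n) (l * m).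
Proof.
move=> [h1 h2] [h3 h4]; split; rewrite ReImE.
  by under eq_fun do rewrite ReM; apply: cvgB; exact: cvgM.
by under eq_fun do rewrite ImM; apply: cvgD; exact: cvgM.
Qed.

Lemma cvgC_sum (I : Type) (s : seq I) (u : I -> nat -> R[i]) (l : I -> R[i]) :
  (forall i, cvgC (u i) (l i)) ->
  cvgC (fun n => \sum_(i <- s) u i n) (\sum_(i <- s) l i).
Proof.
move=> h; elim: s => [|i s ih].
  by rewrite big_nil; under eq_fun do rewrite big_nil; exact: cvgC_cst.
by rewrite big_cons; under eq_fun do rewrite big_cons; exact: cvgCD.
Qed.

Lemma cvg_sqmod u l : cvgC u l -> (fun n => sqmod (u n)) @ \oo --> sqmod l.
Proof.
move=> [h1 h2]; rewrite sqmodE; under eq_fun do rewrite sqmodE.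
by under eq_fun do rewrite !expr2; rewrite !expr2; apply: cvgD; exact: cvgM.
Qed.

Lemma cvg_normc u l : cvgC u l -> (fun n => normc (u n)) @ \oo --> normc l.
Proof.
move=> h.
have e z : normc z = Num.sqrt (sqmod z) :> R.
  by rewrite sqrtr_sqr ger0_norm ?normc_ge0.
rewrite e; under eq_fun do rewrite e.
by apply: continuous_cvg; [exact: sqrt_continuous|exact: cvg_sqmod].
Qed.

Lemma cvgC_normc u l : (fun n => normc (u n - l)) @ \oo --> 0 -> cvgC u l.
Proof.
move=> h; split; apply/subr_cvg0; apply/norm_cvg0P;
  apply: (squeeze_cvgr _ (cvg_cst 0) h); near=> n; rewrite normr_ge0 /=.
- by rewrite -ReN -ReD; exact: normr_Re_le.
- by rewrite -ImN -ImD; exact: normr_Im_le.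
Unshelve. all: by end_near. Qed.

Lemma cvgC_sqmod u l : (fun n => sqmod (u n - l)) @ \oo --> 0 -> cvgC u l.
Proof.
move=> h; apply: cvgC_normc.
have e z : normc z = Num.sqrt (sqmod z) :> R.
  by rewrite sqrtr_sqr ger0_norm ?normc_ge0.
under eq_fun do rewrite e; rewrite -(@sqrtr0 R).
by apply: continuous_cvg; [exact: sqrt_continuous|].
Qed.

Lemma cvgC_eventually u v l : (\forall n \near \oo, u n = v n) ->
  cvgC u l -> cvgC v l.
Proof.
move=> uv [h1 h2]; split.
  apply: cvg_trans h1; apply: near_eq_cvg; near=> n.
  by congr Re; near: n.
apply: cvg_trans h2; apply: near_eq_cvg; near=> n.
by congr Im; near: n.
Unshelve. all: by end_near. Qed.

Lemma subseq_geq (s : nat -> nat) :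
  {homo s : m n / (m < n)%N >-> (m < n)%N} -> forall n, (n <= s n)%N.
Proof.
by move=> hs; elim=> // n ih; exact: leq_ltn_trans ih (hs _ _ (ltnSn n)).
Qed.

End ComplexLimits.

(** * Series: tails, dominated convergence, exchange of sums, Cauchy-Schwarz *)

Section Series.
Context {R : realType}.
Implicit Types (x y : nat -> R) (u v : nat -> R[i]).

Lemma series_ge0_le x (M : R) : (forall n, 0 <= x n) ->
  (forall n, \sum_(k < n) x k <= M) ->
  cvgn (series x) /\ limn (series x) <= M.
Proof.
move=> x0 xM.
have c : cvgn (series x).
  apply: nondecreasing_is_cvgn.
    by apply/nondecreasing_seqP => n; rewrite /series /= big_nat_recr //= lerDl.
  by exists M => _ [n _ <-]; rewrite /series /= big_mkord.
split=> //; apply: limr_le => //; near=> n.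
by rewrite /series /= big_mkord.
Unshelve. all: by end_near. Qed.

Lemma series_ge0_partial x n : (forall n, 0 <= x n) -> cvgn (series x) ->
  \sum_(k < n) x k <= limn (series x).
Proof.
move=> x0 c; rewrite -(big_mkord predT x).
apply: (nondecreasing_cvgn_le _ c).
by apply/nondecreasing_seqP => m; rewrite /series /= big_nat_recr //= lerDl.
Qed.

Lemma series_ge0_tail x m n : (forall n, 0 <= x n) -> cvgn (series x) ->
  \sum_(m <= k < n) x k <= limn (series x) - series x m.
Proof.
move=> x0 c; have [nm|mn] := leqP n m.
  rewrite big_geq // subr_ge0 /series /= big_mkord.
  exact: series_ge0_partial.
rewrite lerBrDl /series /= -big_cat_nat //= ?(ltnW mn) //.
by rewrite big_mkord; exact: series_ge0_partial.
Qed.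

Lemma series_ge0_small x (e : R) : 0 < e -> (forall n, 0 <= x n) ->
  cvgn (series x) ->
  exists m, forall n, \sum_(m <= k < n) x k <= e.
Proof.
move=> e0 x0 c.
have /cvgrPdist_le/(_ e e0)[m _ hm] : series x @ \oo --> limn (series x) by [].
exists m => n; apply: le_trans (series_ge0_tail m n x0 c) _.
by apply: le_trans (hm m (leqnn m)); exact: ler_norm.
Qed.

Lemma cvg_series_ord x : cvgn (series x) ->
  (fun n => \sum_(k < n) x k) @ \oo --> limn (series x).
Proof.
by move=> c; under eq_fun do rewrite -(big_mkord predT x).
Qed.

Lemma lim_series_ge0 x : (forall n, 0 <= x n) -> cvgn (series x) ->
  0 <= limn (series x).
Proof.
move=> x0 c; have := series_ge0_partial 0 x0 c; by rewrite big_ord0.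
Qed.

Lemma csumP u l : cvgC (fun n => \sum_(k < n) u k) l -> csummable u /\ csum u = l.
Proof.
move=> [h1 h2].
have h1' : series (fun n => Re (u n)) @ \oo --> Re l.
  by move: h1; under eq_fun do rewrite -(big_mkord predT u) Re_sum.
have h2' : series (fun n => Im (u n)) @ \oo --> Im l.
  by move: h2; under eq_fun do rewrite -(big_mkord predT u) Im_sum.
split; first by split; [exact: (cvgP _ h1')|exact: (cvgP _ h2')].
by apply: complex_eqP => /=; exact: cvg_lim.
Qed.

Lemma csummable_cvg u : csummable u -> cvgC (fun n => \sum_(k < n) u k) (csum u).
Proof.
move=> [h1 h2]; split => /=.
  by under eq_fun do rewrite -(big_mkord predT u) Re_sum.
by under eq_fun do rewrite -(big_mkord predT u) Im_sum.
Qed.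

Lemma csummable_normc u : cvgn (series (fun n => normc (u n))) -> csummable u.
Proof.
move=> h; split; apply: normed_cvg; apply: (series_le_cvg _ _ _ h) => n;
  by [exact: normr_ge0|exact: normc_ge0|exact: normr_Re_le|exact: normr_Im_le].
Qed.

Lemma csum_tail u m : cvgn (series (fun n => normc (u n))) ->
  normc (csum u - \sum_(k < m) u k) <=
  limn (series (fun n => normc (u n))) - series (fun n => normc (u n)) m.
Proof.
move=> h; have s := csummable_normc h.
have c := csummable_cvg s.
have c2 : cvgC (fun n => \sum_(k < n) u k - \sum_(k < m) u k)
               (csum u - \sum_(k < m) u k).
  by apply: cvgCB => //; exact: cvgC_cst.
have c3 := cvg_normc c2.
rewrite -(cvg_lim _ c3) //; apply: limr_le; first exact: (cvgP _ c3).
near=> n; have mn : (m <= n)%N by near: n; exact: nbhs_infty_ge.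
rewrite -!(big_mkord predT u) (@big_cat_nat _ _ _ m 0 n) //=.
rewrite addrAC subrr add0r.
apply: le_trans (normc_sum _ _ _) _.
by apply: series_ge0_tail => // k; exact: normc_ge0.
Unshelve. all: by end_near. Qed.

Lemma csum_normc_le u : cvgn (series (fun n => normc (u n))) ->
  normc (csum u) <= limn (series (fun n => normc (u n))).
Proof.
by move=> /(@csum_tail u 0); rewrite big_ord0 /series /= big_geq // !subr0.
Qed.

Lemma csum_ext u v : (forall n, u n = v n) -> csum u = csum v.
Proof. by move=> /funext ->. Qed.

End Series.

Section DominatedSeries.
Context {R : realType}.

Lemma cvg_seriesM (c : R) (f : nat -> R) :
  cvgn (series f) -> cvgn (series (fun n => c * f n)).
Proof. exact: is_cvg_seriesZ. Qed.

Lemma cvg_sumr (I : Type) (s : seq I) (u : I -> nat -> R) (l : I -> R) :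
  (forall i, u i @ \oo --> l i) ->
  (fun n => \sum_(i <- s) u i n) @ \oo --> \sum_(i <- s) l i.
Proof.
move=> h; elim: s => [|i s ih].
  by rewrite big_nil; under eq_fun do rewrite big_nil; exact: cvg_cst.
by rewrite big_cons; under eq_fun do rewrite big_cons; exact: cvgD.
Qed.

(** Dominated convergence for series: beyond a common index all tails are small uniformly in [m],
    because [b] bounds them, and the finite head converges term by term. *)
Lemma tannery (c : nat -> nat -> R) (l b : nat -> R) :
  cvgn (series b) -> (forall m p, `|c m p| <= b p) ->
  (forall p, (fun m => c m p) @ \oo --> l p) ->
  [/\ forall m, cvgn (series (c m)), cvgn (series l) &
      (fun m => limn (series (c m))) @ \oo --> limn (series l)].
Proof.
move=> cb cM cl.
have b0 p : 0 <= b p by exact: le_trans (normr_ge0 _) (cM 0%N p).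
have lb p : `|l p| <= b p.
  have h : (fun m => `|c m p|) @ \oo --> `|l p| by exact: cvg_norm.
  rewrite -(cvg_lim _ h) //; apply: limr_le; first exact: (cvgP _ h).
  by near=> m; exact: cM.
have ab (x : nat -> R) : (forall p, `|x p| <= b p) -> cvgn (series x).
  move=> xb; apply: normed_cvg; apply: (series_le_cvg _ b0 _ cb) => // n.
  exact: normr_ge0.
have tl (x : nat -> R) n : (forall p, `|x p| <= b p) ->
    `|limn (series x) - series x n| <= limn (series b) - series b n.
  move=> xb; have cx := ab x xb.
  have h : (fun m => `|series x m - series x n|) @ \oo -->
           `|limn (series x) - series x n|.
    by apply: cvg_norm; apply: cvgB => //; exact: cvg_cst.
  rewrite -(cvg_lim _ h) //; apply: limr_le; first exact: (cvgP _ h).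
  near=> m; have nm : (n <= m)%N by near: m; exact: nbhs_infty_ge.
  rewrite sub_series_geq //; apply: le_trans (ler_norm_sum _ _ _) _.
  apply: le_trans (ler_sum _ (fun i _ => xb i)) _.
  exact: series_ge0_tail.
split; [by move=> m; exact: ab|exact: ab|].
apply/cvgrPdist_le => e e0.
have e3 : 0 < e / 3 by rewrite divr_gt0.
have /cvgrPdist_le/(_ _ e3)[n0 _ hn] : series b @ \oo --> limn (series b) by [].
have tn0 : limn (series b) - series b n0 <= e / 3.
  by apply: le_trans (ler_norm _) (hn _ _) => /=.
have h : (fun m => series (c m) n0) @ \oo --> series l n0.
  elim: n0 {hn tn0} => [|k ih].
    rewrite /series /= big_geq //; under eq_fun do rewrite big_geq //.
    exact: cvg_cst.
  rewrite seriesSr; under eq_fun do rewrite seriesSr.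
  by apply: cvgD => //; exact: cl.
near=> m.
have h1 : `|series l n0 - series (c m) n0| <= e / 3.
  by near: m; move/cvgrPdist_le : h; exact.
have h2 := tl _ n0 lb.
have h3 := tl _ n0 (cM m).
have -> : limn (series l) - limn (series (c m)) =
  (limn (series l) - series l n0) + (series l n0 - series (c m) n0) -
  (limn (series (c m)) - series (c m) n0) by ring.
apply: le_trans (ler_normB _ _) _.
apply: le_trans (lerD (ler_normD _ _) (lexx _)) _.
lra.
Unshelve. all: by end_near. Qed.

Lemma ctannery (c : nat -> nat -> R[i]) (l : nat -> R[i]) (b : nat -> R) :
  cvgn (series b) -> (forall m p, normc (c m p) <= b p) ->
  (forall p, cvgC (fun m => c m p) (l p)) ->
  csummable l /\ cvgC (fun m => csum (c m)) (csum l).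
Proof.
move=> cb cM cl.
have [h1 h2 h3] := @tannery (fun m p => Re (c m p)) (fun p => Re (l p)) b cb
  (fun m p => le_trans (normr_Re_le _) (cM m p)) (fun p => (cl p).1).
have [h4 h5 h6] := @tannery (fun m p => Im (c m p)) (fun p => Im (l p)) b cb
  (fun m p => le_trans (normr_Im_le _) (cM m p)) (fun p => (cl p).2).
by split; split.
Qed.

Lemma cvgn_normc_le (u : nat -> R[i]) (b : nat -> R) :
  cvgn (series b) -> (forall n, normc (u n) <= b n) ->
  cvgn (series (fun n => normc (u n))).
Proof.
move=> cb h; apply: (series_le_cvg _ _ h cb) => n; first exact: normc_ge0.
exact: le_trans (normc_ge0 _) (h n).
Qed.

Lemma csummable_le (u : nat -> R[i]) (b : nat -> R) :
  cvgn (series b) -> (forall n, normc (u n) <= b n) -> csummable u.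
Proof. by move=> cb h; exact: csummable_normc (cvgn_normc_le cb h). Qed.

Lemma csum_le (u : nat -> R[i]) (b : nat -> R) :
  cvgn (series b) -> (forall n, normc (u n) <= b n) ->
  normc (csum u) <= limn (series b).
Proof.
move=> cb h; have c := cvgn_normc_le cb h.
apply: le_trans (csum_normc_le c) _.
apply: ler_lim => //; near=> n; apply: ler_sum => i _; exact: h.
Unshelve. all: by end_near. Qed.

Lemma csumZ (u : nat -> R[i]) z : csummable u ->
  csummable (fun n => z * u n) /\ csum (fun n => z * u n) = z * csum u.
Proof.
move=> /csummable_cvg h; apply: csumP.
by under eq_fun do rewrite -mulr_sumr; apply: cvgCM => //; exact: cvgC_cst.
Qed.

Lemma csumZr (u : nat -> R[i]) z : csummable u ->
  csummable (fun n => u n * z) /\ csum (fun n => u n * z) = csum u * z.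
Proof.
move=> /csumZ -/(_ z); rewrite mulrC.
by have -> : (fun n => u n * z) = (fun n => z * u n)
  by apply/funext => n; rewrite mulrC.
Qed.

Lemma csumJ (u : nat -> R[i]) : csummable u ->
  csummable (fun n => (u n)^*) /\ csum (fun n => (u n)^*) = (csum u)^*.
Proof.
move=> /csummable_cvg h; apply: csumP.
have -> : (fun n => \sum_(k < n) (u k)^*) = (fun n => (\sum_(k < n) u k)^*).
  by apply/funext => n; rewrite rmorph_sum.
exact: cvgCJ.
Qed.

Lemma csumD (u v : nat -> R[i]) : csummable u -> csummable v ->
  csummable (fun n => u n + v n) /\
  csum (fun n => u n + v n) = csum u + csum v.
Proof.
move=> /csummable_cvg h /csummable_cvg k; apply: csumP.
by under eq_fun do rewrite big_split; exact: cvgCD.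
Qed.

Lemma csum_bigsum (n : nat) (u : nat -> nat -> R[i]) :
  (forall k, csummable (u k)) ->
  csummable (fun p => \sum_(k < n) u k p) /\
  csum (fun p => \sum_(k < n) u k p) = \sum_(k < n) csum (u k).
Proof.
move=> h; apply: csumP.
under eq_fun do rewrite exchange_big.
by apply: cvgC_sum => i; exact: csummable_cvg.
Qed.

(** The partial sums in [u] are dominated by [b] as functions of [p], so [ctannery] lets their
    number of terms go to infinity under the sum over [p]. *)
Lemma csum_exchange (f : nat -> nat -> R[i]) (b : nat -> R) :
  cvgn (series b) -> (forall p n, \sum_(u < n) normc (f p u) <= b p) ->
  [/\ csummable (fun p => csum (f p)),
      csummable (fun u => csum (f^~ u)) &
      csum (fun p => csum (f p)) = csum (fun u => csum (f^~ u))].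
Proof.
move=> cb fb.
have fs p : cvgn (series (fun u => normc (f p u))).
  by apply: (@series_ge0_le _ _ (b p) _ _).1 => // n; exact: normc_ge0.
have cs p := csummable_normc (fs p).
have fb1 p u : normc (f p u) <= b p.
  apply: le_trans (fb p u.+1); rewrite big_ord_recr /= lerDr.
  by apply: sumr_ge0 => i _; exact: normc_ge0.
have [s1 c1] := @ctannery (fun m p => \sum_(u < m) f p u)
  (fun p => csum (f p)) b cb
  (fun m p => le_trans (normc_sum _ _ _) (fb p m))
  (fun p => csummable_cvg (cs p)).
have cs' u : csummable (f^~ u) by exact: csummable_le cb (fun p => fb1 p u).
have [s2 e2] : csummable (fun u => csum (f^~ u)) /\
    csum (fun u => csum (f^~ u)) = csum (fun p => csum (f p)).
  apply: csumP.
  suff -> : (fun n => \sum_(k < n) csum (f^~ k)) =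
    (fun m => csum (fun p => \sum_(u < m) f p u)) by [].
  apply/funext => m.
  by have [_ ->] := csum_bigsum m (u := fun u p => f p u) cs'.
by split.
Qed.

Lemma CS_sum I (s : seq I) (f g : I -> R) :
  (\sum_(i <- s) f i * g i) ^+ 2 <=
  (\sum_(i <- s) f i ^+ 2) * (\sum_(i <- s) g i ^+ 2).
Proof.
elim: s => [|i s]; first by rewrite !big_nil expr0n mul0r.
rewrite !big_cons.
set S := \sum_(j <- s) f j * g j; set A := \sum_(j <- s) f j ^+ 2.
set B := \sum_(j <- s) g j ^+ 2 => SAB.
have A0 : 0 <= A by apply: sumr_ge0 => j _; exact: sqr_ge0.
have B0 : 0 <= B by apply: sumr_ge0 => j _; exact: sqr_ge0.
move: (f i) (g i) => x y.
(* The cross term of the expanded product. It is bounded by squaring: S^2 <= AB, and (A y^2 + B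
   x^2)^2 exceeds 4 A B x^2 y^2 by a square. *)
suff h : 2 * (S * (x * y)) <= A * y ^+ 2 + B * x ^+ 2 by nra.
have p0 : 0 <= A * y ^+ 2 + B * x ^+ 2.
  by rewrite addr_ge0 // mulr_ge0 // sqr_ge0.
apply: le_trans (ler_norm _) _.
rewrite -(@ler_pXn2r _ 2) ?nnegrE // real_normK ?num_real //.
have h1 : 0 <= (A * B - S ^+ 2) * (x ^+ 2 * y ^+ 2).
  by rewrite mulr_ge0 ?subr_ge0 // mulr_ge0 // sqr_ge0.
have h2 := sqr_ge0 (A * y ^+ 2 - B * x ^+ 2).
nra.
Qed.

Lemma CS_sqmod I (s : seq I) (x y : I -> R[i]) :
  sqmod (\sum_(i <- s) x i * y i) <=
  (\sum_(i <- s) sqmod (x i)) * (\sum_(i <- s) sqmod (y i)).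
Proof.
apply: le_trans (CS_sum s (fun i => normc (x i)) (fun i => normc (y i))).
apply: sqmod_le_normc; apply: le_trans (normc_sum _ _ _) _.
by apply: ler_sum => i _; rewrite normcM'.
Qed.

End DominatedSeries.

(** * Square summable sequences and coordinatewise compactness *)

Section L2Sequences.
Context {R : realType}.
Implicit Types x y : nat -> R[i].

Lemma l2_le x (b : nat -> R) : cvgn (series b) ->
  (forall n, sqmod (x n) <= b n) -> l2 x.
Proof.
move=> cb h; apply: (series_le_cvg _ _ h cb) => n; first exact: sqmod_ge0.
exact: le_trans (sqmod_ge0 _) (h n).
Qed.

Lemma l2_bounded x (M : R) : (forall n, \sum_(k < n) sqmod (x k) <= M) ->
  l2 x /\ l2_sqnorm x <= M.
Proof. by move=> h; apply: series_ge0_le => // n; exact: sqmod_ge0. Qed.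

Lemma l2_sqnorm_ge0 x : l2 x -> 0 <= l2_sqnorm x.
Proof. by move=> h; apply: lim_series_ge0 => // n; exact: sqmod_ge0. Qed.

Lemma l2_partial x n : l2 x -> \sum_(k < n) sqmod (x k) <= l2_sqnorm x.
Proof. by move=> h; apply: series_ge0_partial => // k; exact: sqmod_ge0. Qed.

Lemma l2_coord x n : l2 x -> sqmod (x n) <= l2_sqnorm x.
Proof.
move=> h; apply: le_trans (l2_partial n.+1 h).
rewrite big_ord_recr /= lerDr; apply: sumr_ge0 => i _; exact: sqmod_ge0.
Qed.

Lemma l2_CS_abs x y : l2 x -> l2 y ->
  (forall n, \sum_(k < n) normc (x k) * normc (y k) <=
     Num.sqrt (l2_sqnorm x) * Num.sqrt (l2_sqnorm y)) /\
  cvgn (series (fun n => normc (x n) * normc (y n))).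
Proof.
move=> hx hy.
have h n : \sum_(k < n) normc (x k) * normc (y k) <=
    Num.sqrt (l2_sqnorm x) * Num.sqrt (l2_sqnorm y).
  rewrite -(@ler_pXn2r _ 2) // ?nnegrE; last 2 first.
  - by apply: sumr_ge0 => i _; rewrite mulr_ge0 // normc_ge0.
  - by rewrite mulr_ge0 // sqrtr_ge0.
  rewrite exprMn !sqr_sqrtr ?l2_sqnorm_ge0 //.
  apply: le_trans (CS_sum _ _ _) _.
  apply: ler_pM; [| |exact: l2_partial|exact: l2_partial];
    by apply: sumr_ge0 => i _; exact: sqr_ge0.
split => //; apply: (series_ge0_le _ h).1 => n.
by rewrite mulr_ge0 // normc_ge0.
Qed.

Lemma l2_CS x y : l2 x -> l2 y ->
  csummable (fun n => x n * y n) /\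
  sqmod (csum (fun n => x n * y n)) <= l2_sqnorm x * l2_sqnorm y.
Proof.
move=> hx hy; have [h1 h2] := l2_CS_abs hx hy.
have h n : normc (x n * y n) <= normc (x n) * normc (y n) by rewrite normcM'.
split; first exact: csummable_le h2 h.
rewrite -(sqr_sqrtr (l2_sqnorm_ge0 hx)) -(sqr_sqrtr (l2_sqnorm_ge0 hy)) -exprMn.
apply: sqmod_le_normc; apply: le_trans (csum_le h2 h) _.
apply: (series_ge0_le _ h1).2 => n.
by rewrite mulr_ge0 // normc_ge0.
Qed.

Lemma l2J x : l2 x -> l2 (fun n => (x n)^*).
Proof. by rewrite /l2; under [X in _ -> cvgn (series X)]eq_fun do rewrite sqmodJ. Qed.

Lemma l2_sqnormJ x : l2_sqnorm (fun n => (x n)^*) = l2_sqnorm x.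
Proof. by rewrite /l2_sqnorm; under eq_fun do rewrite sqmodJ. Qed.

Lemma l2D x y : l2 x -> l2 y -> l2 (fun n => x n + y n).
Proof.
move=> hx hy; apply: (@l2_le _ (fun n => 2 * sqmod (x n) + 2 * sqmod (y n))).
  apply: (@is_cvg_seriesD _ (fun n => 2 * sqmod (x n)) (fun n => 2 * sqmod (y n)));
  exact: is_cvg_seriesZ.
by move=> n; exact: sqmodD_le.
Qed.

Lemma l2Z x (z : R[i]) : l2 x ->
  l2 (fun n => z * x n) /\ l2_sqnorm (fun n => z * x n) = sqmod z * l2_sqnorm x.
Proof.
move=> hx; rewrite /l2 /l2_sqnorm.
have -> : (fun n => sqmod (z * x n)) = sqmod z *: (fun n => sqmod (x n)).
  by apply/funext => n; rewrite sqmodM.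
by split; [exact: is_cvg_seriesZ|rewrite lim_seriesZ].
Qed.

Lemma l2B x y : l2 x -> l2 y -> l2 (fun n => x n - y n).
Proof.
move=> hx hy; apply: l2D => //.
by rewrite /l2; under eq_fun do rewrite sqmodN.
Qed.

Lemma l2_inner_self x : l2 x -> l2_inner x x = (l2_sqnorm x)%:C.
Proof.
move=> hx; rewrite /l2_inner.
have [_ ->] : csummable (fun n => x n * (x n)^*) /\
    csum (fun n => x n * (x n)^*) = (l2_sqnorm x)%:C => //.
apply: csumP; under eq_fun do under eq_bigr do rewrite mulcJ.
under eq_fun do rewrite -sqmod_real_sum.
split => /=; last exact: cvg_cst.
exact: cvg_series_ord.
Qed.

(** By Tychonoff the sequence has a cluster point [l] in the product of the segments. A
    neighbourhood of [l] in the product topology constrains finitely many coordinates, so the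
    indices can be chosen one after the other, the [k]-th term being close to [l] in its first [k]
    coordinates. *)
Lemma diagonal_subsequence (z : nat -> nat -> R) (w : nat -> R) :
  (forall n q, `|z n q| <= w q) ->
  exists (s : nat -> nat) (l : nat -> R),
    {homo s : m n / (m < n)%N >-> (m < n)%N} /\
    forall q, (fun n => z (s n) q) @ \oo --> l q.
Proof.
move=> zw.
pose T := fun _ : nat => (R : topologicalType).
pose K := [set f : prod_topology T | forall i, [set` `[- w i, w i]] (f i)].
have cK : compact K.
  by apply: (@tychonoff _ T (fun i => [set` `[- w i, w i]])) => i;
    exact: segment_compact.
have [l [_ cl]] : K `&` cluster ((z : nat -> prod_topology T) @ \oo) !=set0.
  apply: cK; exists 0%N => // n _ i /=.
  by rewrite in_itv /= -ler_norml.
have next k m : exists n, (m < n)%N /\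
    forall q, (q < k)%N -> `|z n q - l q| < k.+1%:R^-1.
  pose B := [set f : prod_topology T | forall q, (q < k)%N ->
    `|f q - l q| < k.+1%:R^-1].
  have nB : nbhs l B.
    have nq q : nbhs l [set f : prod_topology T | `|f q - l q| < k.+1%:R^-1].
      have := @proj_continuous _ T q l.
      move=> /(_ [set x : R | `|x - l q| < k.+1%:R^-1]); apply.
      exists k.+1%:R^-1 => /=; first by rewrite invr_gt0.
      by move=> x /=; rewrite distrC.
    suff h j : nbhs l [set f : prod_topology T | forall q, (q < j)%N ->
        `|f q - l q| < k.+1%:R^-1] by exact: h.
    elim: j => [|j ih]; first by apply: filterS filterT.
    apply: filterS (filterI ih (nq j)) => f [/= h1 h2] q.
    by rewrite ltnS leq_eqVlt => /orP[/eqP ->|]; [exact: h2|exact: h1].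
  have [_ [[n /= mn <-] hB]] :
      (z : nat -> prod_topology T) @` [set n | (m < n)%N] `&` B !=set0.
    apply: cl nB; exists m.+1 => // n /= mn; by exists n.
  by exists n.
pose g k := projT1 (choice (next k)).
have hg k := projT2 (choice (next k)).
pose s := fix s n := if n is n'.+1 then g n (s n') else g 0%N 0%N.
have sS n : (s n < s n.+1)%N by exact: (hg n.+1 (s n)).1.
exists s, l; split.
  by apply: homo_ltn => //; exact: ltn_trans.
have hz q m : (q < m)%N -> `|z (s m) q - l q| < m.+1%:R^-1.
  by case: m => // m qm; exact: (hg m.+1 (s m)).2.
move=> q; apply/cvgrPdist_lt => e e0.
near=> n.
have qn : (q < n)%N by near: n; exact: nbhs_infty_gt.
have hn : n.+1%:R^-1 < e.
  by near: n; exact: near_infty_natSinv_lt (PosNum e0).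
apply: lt_trans hn; rewrite distrC.
exact: hz.
Unshelve. all: by end_near. Qed.

Lemma cdiagonal_subsequence (z : nat -> nat -> R[i]) (w : nat -> R) :
  (forall n q, normc (z n q) <= w q) ->
  exists (s : nat -> nat) (l : nat -> R[i]),
    {homo s : m n / (m < n)%N >-> (m < n)%N} /\
    forall q, cvgC (fun n => z (s n) q) (l q).
Proof.
move=> zw.
(* Real and imaginary parts are interleaved at even and odd indices, so that one subsequence serves
   both. *)
pose y n k := if odd k then Im (z n k./2) else Re (z n k./2).
have [|s [l [hs hl]]] := @diagonal_subsequence y (fun k => w k./2).
  move=> n q; rewrite /y; apply: le_trans (zw n q./2).
  by case: ifP => _; [exact: normr_Im_le|exact: normr_Re_le].
exists s, (fun q => l q.*2 +i* l q.*2.+1); split=> // q; split => /=.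
  by have := hl q.*2; rewrite /y; under eq_fun do rewrite odd_double doubleK.
have := hl q.*2.+1.
by rewrite /y; under eq_fun do rewrite /= odd_double /= uphalf_double.
Qed.

End L2Sequences.

(** * The Hankel operator and the operator with matrix Q *)

Section Hankel.
Context {R : realType}.
Implicit Types (a x y : nat -> R[i]).

(** If xi is the moving average with coefficients [x], this is the correlation of A xi with the
    noise variable eps(u). *)
Definition hankel a x (u : nat) : R[i] := csum (fun p => x p * a (p + u)%N).

Definition tail_sq a (p : nat) : R := l2_sqnorm (fun u => a (p + u)%N).

(** At most j + 1 pairs (p, u) have p + u = j. *)
Lemma double_sum_le (f : nat -> R) n m : (forall j, 0 <= f j) ->
  \sum_(p < n) \sum_(u < m) f (p + u)%N <= \sum_(j < n + m) j.+1%:R * f j.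
Proof.
move=> f0.
(* The count is also at most [n]; this sharper form is what the induction on [n] carries. *)
suff h : \sum_(p < n) \sum_(u < m) f (p + u)%N <=
    \sum_(j < n + m) (minn j.+1 n)%:R * f j.
  apply: le_trans h _; apply: ler_sum => j _; apply: ler_wpM2r => //.
  by rewrite ler_nat geq_minl.
elim: n => [|n ih]; first by rewrite big_ord0 sumr_ge0 // => j _; rewrite mulr_ge0.
rewrite big_ord_recr /=.
have -> : \sum_(u < m) f (n + u)%N = \sum_(j < n + m) (n <= j)%:R * f j.
  rewrite big_split_ord /= [X in _ = X + _]big1 ?add0r; last first.
    by move=> i _; rewrite leqNgt ltn_ord mul0r.
  by apply: eq_bigr => i _; rewrite leq_addr mul1r.
apply: le_trans (lerD ih (lexx _)) _.
rewrite -big_split /= addSn big_ord_recr /=.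
apply: le_trans (ler_wpDr _ (lexx _)); last by rewrite mulr_ge0.
apply: ler_sum => j _; rewrite -mulrDl; apply: ler_wpM2r => //.
rewrite -natrD ler_nat; lia.
Qed.

Section Operator.
Variable a : nat -> R[i].
Hypothesis ha : cvgn (series (fun j => j.+1%:R * normc (a j) ^+ 2)).

Let ha' : cvgn (series (fun j => j.+1%:R * sqmod (a j))). Proof. exact: ha. Qed.

Lemma l2_shift p : l2 (fun u => a (p + u)%N).
Proof.
apply: (@l2_bounded R _ (limn (series (fun j => j.+1%:R * sqmod (a j)))) _).1 => n.
have pos j : 0 <= j.+1%:R * sqmod (a j) by rewrite mulr_ge0 // sqmod_ge0.
apply: le_trans (series_ge0_partial (p + n) pos ha').
rewrite big_split_ord /=; apply: le_trans (ler_wpDl _ (lexx _)); last first.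
  by apply: sumr_ge0.
apply: ler_sum => i _; rewrite ler_peMl ?sqmod_ge0 // ler1n //.
Qed.

Arguments l2_shift : clear implicits.

Lemma tail_sq_ge0 p : 0 <= tail_sq a p.
Proof. exact: l2_sqnorm_ge0 (l2_shift p). Qed.

(** The Hankel matrix is Hilbert-Schmidt: its squared entries, summed along antidiagonals, give the
    weighted series of the hypothesis. *)
Lemma tail_sq_summable : cvgn (series (tail_sq a)).
Proof.
have pos j : 0 <= j.+1%:R * sqmod (a j) by rewrite mulr_ge0 // sqmod_ge0.
apply: (@series_ge0_le R _ (limn (series (fun j => j.+1%:R * sqmod (a j)))) _ _).1.
  exact: tail_sq_ge0.
move=> n.
have h : (fun m => \sum_(p < n) \sum_(u < m) sqmod (a (p + u)%N)) @ \oo -->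
    \sum_(p < n) tail_sq a p.
  by apply: cvg_sumr => p; exact: cvg_series_ord (l2_shift p).
rewrite -(cvg_lim _ h) //; apply: limr_le; first exact: (cvgP _ h).
near=> m; apply: le_trans (@double_sum_le (fun j => sqmod (a j)) n m _) _.
  by move=> j; exact: sqmod_ge0.
exact: series_ge0_partial.
Unshelve. all: by end_near. Qed.

Definition row_norm (p : nat) : R := Num.sqrt (tail_sq a p).

Lemma row_norm_ge0 p : 0 <= row_norm p. Proof. exact: sqrtr_ge0. Qed.
Lemma row_norm_sqr p : row_norm p ^+ 2 = tail_sq a p.
Proof. by rewrite sqr_sqrtr // tail_sq_ge0. Qed.

Lemma l2_row_norm : l2 (fun p => (row_norm p)%:C).
Proof.
rewrite /l2; under [X in cvgn (series X)]eq_fun do rewrite sqmodr row_norm_sqr.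
exact: tail_sq_summable.
Qed.

Lemma normc_row_norm p : normc (row_norm p)%:C = row_norm p.
Proof. by rewrite normcr ger0_norm // row_norm_ge0. Qed.

Lemma hankel_bound x u : l2 x ->
  csummable (fun p => x p * a (p + u)%N) /\
  sqmod (hankel a x u) <= l2_sqnorm x * tail_sq a u.
Proof.
move=> hx; have [h1 h2] := l2_CS hx (l2_shift u).
by move: h1 h2; rewrite /hankel /tail_sq;
  under eq_fun do rewrite addnC.
Qed.

Lemma hankel_l2 x : l2 x -> l2 (hankel a x).
Proof.
move=> hx; apply: (@l2_le _ _ (fun u => l2_sqnorm x * tail_sq a u)).
  by apply: (@cvg_seriesM R (l2_sqnorm x)); exact: tail_sq_summable.
by move=> u; exact: (hankel_bound u hx).2.
Qed.

(** Q(p, q) is the inner product of two rows of the Hankel matrix. The product bound, with square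
    summable factors, makes all later rearrangements absolutely convergent. *)
Lemma Qmx_bound p q :
  csummable (fun u => a (p + u)%N * (a (q + u)%N)^*) /\
  normc (Qmx a p q) <= row_norm p * row_norm q.
Proof.
have [h1 h2] := l2_CS (l2_shift p) (l2J (l2_shift q)).
split => //; apply: normc_le_sqmod; first by rewrite mulr_ge0 // row_norm_ge0.
by rewrite exprMn !row_norm_sqr; rewrite l2_sqnormJ in h2.
Qed.

Lemma row_pairing x : l2 x ->
  (forall n, \sum_(p < n) normc (x p) * row_norm p <=
    Num.sqrt (l2_sqnorm x) * Num.sqrt (l2_sqnorm (fun p => (row_norm p)%:C))) /\
  cvgn (series (fun p => normc (x p) * row_norm p)).
Proof.
move=> hx; have [h1 h2] := l2_CS_abs hx l2_row_norm; split => [n|].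
  by have := h1 n; under eq_bigr do rewrite normc_row_norm.
by move: h2; under eq_fun do rewrite normc_row_norm.
Qed.

Lemma Q_bound x q : l2 x ->
  csummable (fun p => x p * Qmx a p q) /\
  normc (matrix_op (Qmx a) x q) <=
    Num.sqrt (l2_sqnorm x) * Num.sqrt (l2_sqnorm (fun p => (row_norm p)%:C))
      * row_norm q.
Proof.
move=> hx; have [h1 h2] := row_pairing hx.
have hb p : normc (x p * Qmx a p q) <= row_norm q * (normc (x p) * row_norm p).
  rewrite normcM' mulrCA; apply: ler_wpM2l; first exact: normc_ge0.
  by rewrite mulrC; exact: (Qmx_bound p q).2.
have hc : cvgn (series (fun p => row_norm q * (normc (x p) * row_norm p))).
  exact: (@cvg_seriesM R (row_norm q)).
split; first exact: csummable_le hc hb.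
apply: le_trans (csum_le hc hb) _.
rewrite mulrC.
apply: (series_ge0_le _ _).2 => [n|n].
  by rewrite !mulr_ge0 ?row_norm_ge0 ?normc_ge0.
by rewrite -mulr_sumr; apply: ler_wpM2l (h1 n); exact: row_norm_ge0.
Qed.

Lemma Q_on_l2 : matrix_op_on_l2 (Qmx a).
Proof.
move=> x hx; split; first by move=> q; exact: (Q_bound q hx).1.
set C := Num.sqrt (l2_sqnorm x) * Num.sqrt (l2_sqnorm (fun p => (row_norm p)%:C)).
apply: (@l2_le _ _ (fun q => C ^+ 2 * tail_sq a q)).
  by apply: (@cvg_seriesM R (C ^+ 2)); exact: tail_sq_summable.
move=> q; rewrite -row_norm_sqr -exprMn.
exact: sqmod_le_normc (Q_bound q hx).2.
Qed.

(** This is the factorization of [Q] as the Hankel operator followed by its adjoint. It takes three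
    exchanges of summation, each justified by [Qmx_bound] or by Cauchy-Schwarz on the rows. *)
Lemma Q_inner x y : l2 x -> l2 y ->
  l2_inner (matrix_op (Qmx a) x) y = l2_inner (hankel a x) (hankel a y).
Proof.
move=> hx hy.
have hJy := l2J hy.
have [X1 X2] := row_pairing hx.
have [Y1 Y2] := row_pairing hJy.
have hHy := hankel_l2 hy.
have hJHy := l2J hHy.
set CY := Num.sqrt (l2_sqnorm (fun n => (y n)^*)) *
  Num.sqrt (l2_sqnorm (fun p => (row_norm p)%:C)) in Y1.
rewrite /l2_inner.
have -> : (fun q => matrix_op (Qmx a) x q * (y q)^*) =
    (fun q => csum (fun p => x p * Qmx a p q * (y q)^*)).
  by apply/funext => q; have [_ ->] := csumZr (y q)^* (Q_bound q hx).1.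
(* First exchange: the sum over [p] goes outside the sum over [q]. *)
pose f0 p q := x p * Qmx a p q * (y q)^*.
have E0 p n : \sum_(q < n) normc (f0 p q) <= CY * (normc (x p) * row_norm p).
  apply: (@le_trans _ _ (\sum_(q < n) (normc (x p) * row_norm p) *
    (normc (y q)^* * row_norm q))).
    apply: ler_sum => q _; rewrite !normcM'.
    have := (Qmx_bound p q).2; have := normc_ge0 (x p).
    have := normc_ge0 (y q)^* => h1 h2 h3.
    apply: le_trans (ler_wpM2r h1 (ler_wpM2l h2 h3)) _.
    by rewrite le_eqVlt; apply/orP; left; apply/eqP; ring.
  rewrite -mulr_sumr mulrC; apply: ler_wpM2r (Y1 n).
  by rewrite mulr_ge0 ?normc_ge0 ?row_norm_ge0.
have [_ _ <-] := csum_exchange (f := f0) (@cvg_seriesM R CY _ X2) E0.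
(* Second exchange, at fixed [p]: with Q expanded as a sum over [u], the inner sum over [q] becomes
   the conjugate of [hankel a y u]. *)
have step p : csum (fun q => x p * Qmx a p q * (y q)^*) =
    csum (fun u => x p * a (p + u)%N * (hankel a y u)^*).
  have -> : (fun q => x p * Qmx a p q * (y q)^*) =
    (fun q => csum (fun u => x p * a (p + u)%N * ((a (q + u)%N)^* * (y q)^*))).
    apply/funext => q.
    have [s1 e1] := csumZ (x p) (Qmx_bound p q).1.
    have [_ e2] := csumZr (y q)^* s1.
    rewrite -e1 -e2; apply: csum_ext => u; ring.
  pose f1 q u := x p * a (p + u)%N * ((a (q + u)%N)^* * (y q)^*).
  have E1 q n : \sum_(u < n) normc (f1 q u) <=
      normc (x p) * row_norm p * (normc (y q)^* * row_norm q).
    have [h1 _] := l2_CS_abs (l2_shift p) (l2J (l2_shift q)).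
    rewrite l2_sqnormJ in h1.
    have -> : \sum_(u < n) normc (x p * a (p + u)%N * ((a (q + u)%N)^* * (y q)^*))
      = normc (x p) * normc (y q)^* *
        \sum_(k < n) normc (a (p + k)%N) * normc (a (q + k)%N)^*.
      by rewrite mulr_sumr; apply: eq_bigr => u _; rewrite !normcM'; ring.
    have -> : normc (x p) * row_norm p * (normc (y q)^* * row_norm q) =
      normc (x p) * normc (y q)^* * (row_norm p * row_norm q) by ring.
    by apply: ler_wpM2l (h1 n); rewrite mulr_ge0 // normc_ge0.
  have [_ _ ->] := csum_exchange (f := f1)
    (@cvg_seriesM R (normc (x p) * row_norm p) _ Y2) E1.
  apply: csum_ext => u.
  have [s1 e1] := csumJ (hankel_bound u hy).1.
  rewrite /hankel -e1.
  have [_ <-] := csumZ (x p * a (p + u)%N) s1.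
  by apply: csum_ext => q; rewrite rmorphM /= /f1 addnC; ring.
have -> : (fun p => csum (fun q => x p * Qmx a p q * (y q)^*)) =
  (fun p => csum (fun u => x p * a (p + u)%N * (hankel a y u)^*)).
  by apply/funext => p; exact: step.
set CH := Num.sqrt (l2_sqnorm (fun n => (hankel a y n)^*)).
(* Third exchange: the sum over [p] goes inside and produces [hankel a x u]. *)
pose f2 p u := x p * a (p + u)%N * (hankel a y u)^*.
have E2 p n : \sum_(u < n) normc (f2 p u) <= CH * (normc (x p) * row_norm p).
  have [h1 _] := l2_CS_abs (l2_shift p) hJHy.
  have -> : \sum_(u < n) normc (x p * a (p + u)%N * (hankel a y u)^*) =
    normc (x p) * \sum_(k < n) normc (a (p + k)%N) * normc (hankel a y k)^*.
    by rewrite mulr_sumr; apply: eq_bigr => u _; rewrite !normcM' mulrA.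
  rewrite mulrCA; apply: ler_wpM2l; first exact: normc_ge0.
  by rewrite mulrC; exact: h1.
have [_ _ ->] := csum_exchange (f := f2) (@cvg_seriesM R CH _ X2) E2.
apply: csum_ext => u.
by have [_ ->] := csumZr (hankel a y u)^* (hankel_bound u hx).1.
Qed.

Lemma l2_innerJ x y : l2 x -> l2 y -> l2_inner y x = (l2_inner x y)^*.
Proof.
move=> hx hy; rewrite /l2_inner.
have [_ <-] := csumJ (l2_CS hx (l2J hy)).1.
by apply: csum_ext => n; rewrite rmorphM /= conjCK mulrC.
Qed.

Lemma Q_selfadjoint : selfadjoint_op (matrix_op (Qmx a)).
Proof.
move=> x y hx hy.
have hQy := (Q_on_l2 hy).2.
rewrite (l2_innerJ hQy hx) !Q_inner //.
exact: l2_innerJ (hankel_l2 hy) (hankel_l2 hx).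
Qed.

(** The images of a bounded set are dominated in each coordinate by a fixed square summable
    sequence, so a subsequence that converges coordinatewise converges in norm, by [tannery]. *)
Lemma Q_compact : compact_op (matrix_op (Qmx a)).
Proof.
move=> x M hM.
have M0 : 0 <= M by apply: le_trans (l2_sqnorm_ge0 (hM 0%N).1) (hM 0%N).2.
set C := Num.sqrt M * Num.sqrt (l2_sqnorm (fun p => (row_norm p)%:C)).
have hb n q : normc (matrix_op (Qmx a) (x n) q) <= C * row_norm q.
  apply: le_trans (Q_bound q (hM n).1).2 _.
  apply: ler_wpM2r; first exact: row_norm_ge0.
  apply: ler_wpM2r; first exact: sqrtr_ge0.
  by apply: ler_wsqrtr; exact: (hM n).2.
have [s [y [hs hy]]] := cdiagonal_subsequence hb.
exists s, y.
have yb q : normc (y q) <= C * row_norm q.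
  have h := cvg_normc (hy q).
  by rewrite -(cvg_lim _ h) //; apply: limr_le; [exact: (cvgP _ h)|near=> n; exact: hb].
have cC : cvgn (series (fun q => C ^+ 2 * tail_sq a q)).
  by apply: (@cvg_seriesM R (C ^+ 2)); exact: tail_sq_summable.
split => //.
  apply: l2_le cC _ => q; rewrite -row_norm_sqr -exprMn.
  exact: sqmod_le_normc (yb q).
(* The factor 2 appears because both the image and the limit [y] are bounded by [C * row_norm q]. *)
have c4 : cvgn (series (fun q => (2 * C) ^+ 2 * tail_sq a q)).
  by apply: cvg_seriesM; exact: tail_sq_summable.
have b4 n q : `|sqmod (matrix_op (Qmx a) (x (s n)) q - y q)| <=
    (2 * C) ^+ 2 * tail_sq a q.
  rewrite ger0_norm ?sqmod_ge0 // -row_norm_sqr -exprMn.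
  apply: sqmod_le_normc; apply: le_trans (le_normcD _ _) _.
  by rewrite normcN -mulrA mulr2n mulrDl mul1r; apply: lerD.
have l4 q : (fun n => sqmod (matrix_op (Qmx a) (x (s n)) q - y q)) @ \oo --> 0.
  have /cvg_sqmod := cvgCB (hy q) (cvgC_cst (y q)).
  by rewrite subrr sqmod0.
have [_ _] := tannery c4 b4 l4.
suff -> : limn (series (fun=> 0 : R)) = 0 by [].
apply: cvg_lim => //; rewrite (_ : series _ = fun=> 0); first exact: cvg_cst.
by apply/funext => n; rewrite /series /= big1.
Unshelve. all: by end_near. Qed.

End Operator.
End Hankel.

(** * The norm of the Hankel operator is attained and gives the greatest eigenvalue *)

Section SingularVector.
Context {R : realType}.
Implicit Types (x y : nat -> R[i]).

Lemma csum_finite (u : nat -> R[i]) (m : nat) :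
  (forall n, (m <= n)%N -> u n = 0) ->
  csummable u /\ csum u = \sum_(k < m) u k.
Proof.
move=> h; apply: csumP.
apply: (@cvgC_eventually _ (fun=> \sum_(k < m) u k)); last exact: cvgC_cst.
near=> n; have mn : (m <= n)%N by near: n; exact: nbhs_infty_ge.
rewrite -!(big_mkord predT u) (@big_cat_nat _ _ _ m 0 n) //=.
rewrite [X in _ + X]big1_seq ?addr0 // => i; rewrite mem_index_iota => /andP[_ /andP[mi _]].
exact: h.
Unshelve. all: by end_near. Qed.

Definition delta_seq (q : nat) (z : R[i]) : nat -> R[i] :=
  fun n => if n == q then z else 0.

Lemma delta_out q z n : (q.+1 <= n)%N -> delta_seq q z n = 0.
Proof. by rewrite /delta_seq; case: eqP => // ->; rewrite ltnn. Qed.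

Lemma l2_finite x m : (forall n, (m <= n)%N -> x n = 0) ->
  l2 x /\ l2_sqnorm x = \sum_(k < m) sqmod (x k).
Proof.
move=> h.
have c : series (fun n => sqmod (x n)) @ \oo --> \sum_(k < m) sqmod (x k).
  apply: cvg_near_cst; near=> n.
  have mn : (m <= n)%N by near: n; exact: nbhs_infty_ge.
  rewrite -(big_mkord predT (fun k => sqmod (x k))) /series /=.
  rewrite (@big_cat_nat _ _ _ m 0 n) //=.
  rewrite [X in _ + X]big1_seq ?addr0 // => i.
  rewrite mem_index_iota => /andP[_ /andP[mi _]].
  by rewrite h // sqmod0.
by split; [exact: (cvgP _ c)|exact: cvg_lim].
Unshelve. all: by end_near. Qed.

Lemma sum_delta q z (F : nat -> R[i]) :
  \sum_(k < q.+1) F k * (delta_seq q z k)^* = F q * z^*.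
Proof.
rewrite big_ord_recr /= /delta_seq eqxx big1 ?add0r // => i _.
by rewrite ltn_eqF // rmorph0 mulr0.
Qed.

Lemma l2_delta q z : l2 (delta_seq q z).
Proof. exact: (l2_finite (@delta_out q z)).1. Qed.

Lemma l2_inner_delta x q z : l2_inner x (delta_seq q z) = x q * z^*.
Proof.
rewrite /l2_inner.
have [|_ ->] := @csum_finite (fun n => x n * (delta_seq q z n)^*) q.+1.
  by move=> n qn; rewrite delta_out // rmorph0 mulr0.
exact: sum_delta.
Qed.

Lemma l2_sqnormD x y : l2 x -> l2 y ->
  l2_sqnorm (fun n => x n + y n) =
  l2_sqnorm x + 2 * Re (l2_inner x y) + l2_sqnorm y.
Proof.
move=> hx hy; apply: cvg_lim => //.
have [c _] := csummable_cvg (l2_CS hx (l2J hy)).1.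
have cx := cvg_series_ord hx; have cy := cvg_series_ord hy.
rewrite (_ : series _ = fun n => \sum_(k < n) sqmod (x k) +
   2 * Re (\sum_(k < n) x k * (y k)^*) + \sum_(k < n) sqmod (y k)).
  apply: cvgD => //; apply: cvgD => //.
  by apply: cvgM => //; exact: cvg_cst.
apply/funext => n; rewrite /series /= big_mkord Re_sum mulr_sumr -!big_split /=.
by apply: eq_bigr => k _; rewrite !sqmodE !ReImE; ring.
Qed.

Lemma l2_sqnorm0 x : l2 x -> l2_sqnorm x = 0 -> forall n, x n = 0.
Proof.
move=> hx x0 n; apply: sqmod_eq0; apply/eqP; rewrite eq_le sqmod_ge0 andbT.
by rewrite -x0; exact: l2_coord.
Qed.

Arguments l2_delta : clear implicits.

Variable a : nat -> R[i].
Hypothesis ha1 : cvgn (series (fun j => normc (a j))).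
Hypothesis ha : cvgn (series (fun j => j.+1%:R * normc (a j) ^+ 2)).

Lemma summable_shift u : cvgn (series (fun p => normc (a (p + u)%N))).
Proof.
apply: (@series_ge0_le _ _ (limn (series (fun j => normc (a j)))) _ _).1 => n.
  exact: normc_ge0.
apply: le_trans (@series_ge0_partial _ _ (u + n) (fun n => normc_ge0 _) ha1).
rewrite big_split_ord /=; apply: le_trans (ler_wpDl _ (lexx _)); last first.
  by apply: sumr_ge0 => i _; exact: normc_ge0.
by apply: ler_sum => i _; rewrite addnC.
Qed.

Lemma hankelD x y u : l2 x -> l2 y ->
  hankel a (fun n => x n + y n) u = hankel a x u + hankel a y u.
Proof.
move=> hx hy; rewrite /hankel.
have [_ <-] := csumD (hankel_bound ha u hx).1 (hankel_bound ha u hy).1.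
by apply: csum_ext => n; rewrite mulrDl.
Qed.

Lemma hankelZ z x u : l2 x ->
  hankel a (fun n => z * x n) u = z * hankel a x u.
Proof.
move=> hx; rewrite /hankel.
have [_ <-] := csumZ z (hankel_bound ha u hx).1.
by apply: csum_ext => n; rewrite mulrA.
Qed.

(** A maximizing sequence in the unit ball has a coordinatewise limit, which stays in the ball.
    Domination makes the squared norm of the Hankel image continuous along it, so the limit is a
    maximizer; homogeneity extends the bound to all vectors. *)
Lemma hankel_norm_attained : exists nu : R, [/\ 0 <= nu,
  forall x, l2 x -> l2_sqnorm (hankel a x) <= nu ^+ 2 * l2_sqnorm x &
  exists x, [/\ l2 x, exists n, x n <> 0 &
    l2_sqnorm (hankel a x) = nu ^+ 2 * l2_sqnorm x]].
Proof.
pose S := [set l2_sqnorm (hankel a x) | x in [set x | l2 x /\ l2_sqnorm x <= 1]].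
have l20 : l2 (fun=> 0 : R[i]) /\ l2_sqnorm (fun=> 0 : R[i]) = 0.
  by have [//|h ->] := @l2_finite (fun=> 0) 0; rewrite big_ord0.
have hankel0 u : hankel a (fun=> 0) u = 0.
  have [|_ e] := @csum_finite (fun p => 0 * a (p + u)%N) 0.
    by move=> n _; rewrite mul0r.
  by rewrite /hankel e big_ord0.
have hb x : l2 x -> l2_sqnorm (hankel a x) <=
    l2_sqnorm x * limn (series (tail_sq a)).
  move=> hx; apply: (l2_bounded _).2 => n.
  apply: (@le_trans _ _ (\sum_(k < n) l2_sqnorm x * tail_sq a k)).
    by apply: ler_sum => k _; exact: (hankel_bound ha k hx).2.
  rewrite -mulr_sumr; apply: ler_wpM2l; first exact: l2_sqnorm_ge0.
  by apply: series_ge0_partial; [exact: tail_sq_ge0|exact: tail_sq_summable].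
have T0 : 0 <= limn (series (tail_sq a)).
  by apply: lim_series_ge0; [exact: tail_sq_ge0|exact: tail_sq_summable].
have hS : has_sup S.
  split; first by exists (l2_sqnorm (hankel a (fun=> 0))), (fun=> 0) => //=;
    rewrite l20.2; split => //; exact: l20.1.
  exists (limn (series (tail_sq a))) => _ [x [hx x1] <-].
  apply: le_trans (hb x hx) _; exact: ler_piMl.
pose mu := sup S.
have Smu x : l2 x -> l2_sqnorm x <= 1 -> l2_sqnorm (hankel a x) <= mu.
  by move=> hx x1; apply: sup_ubound; [exact: hS.2|exists x].
have mu0 : 0 <= mu.
  apply: le_trans (Smu _ l20.1 _); last by rewrite l20.2.
  by apply: l2_sqnorm_ge0; exact: (hankel_l2 ha l20.1).
have musq : Num.sqrt mu ^+ 2 = mu by rewrite sqr_sqrtr.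
have all_le x : l2 x -> l2_sqnorm (hankel a x) <= mu * l2_sqnorm x.
  move=> hx; have [x0|x0] := eqVneq (l2_sqnorm x) 0.
    have -> : x = fun=> 0 by apply/funext => n; exact: (l2_sqnorm0 hx x0).
    have -> : hankel a (fun=> 0) = fun=> 0 by apply/funext => u; exact: hankel0.
    by rewrite l20.2 mulr0.
  have xp : 0 < l2_sqnorm x by rewrite lt_neqAle eq_sym x0 l2_sqnorm_ge0.
  pose c := (Num.sqrt (l2_sqnorm x))^-1.
  have c2 : c ^+ 2 = (l2_sqnorm x)^-1 by rewrite exprVn sqr_sqrtr // ltW.
  have [h1 h2] := l2Z c%:C hx.
  have := Smu _ h1; rewrite h2 sqmodr c2 mulVf // => /(_ (lexx _)).
  have -> : hankel a (fun n => c%:C * x n) = fun u => c%:C * hankel a x u.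
    by apply/funext => u; exact: hankelZ.
  rewrite (l2Z _ (hankel_l2 ha hx)).2 sqmodr c2.
  by rewrite mulrC ler_pdivrMr.
have ex n : exists x, [/\ l2 x, l2_sqnorm x <= 1 &
    mu - n.+1%:R^-1 < l2_sqnorm (hankel a x)].
  have [|_ [x [hx x1] <-] h] := @sup_adherent _ S n.+1%:R^-1 _ hS.
    by rewrite invr_gt0.
  by exists x.
have [X hX] := choice ex.
have Xb n q : normc (X n q) <= 1.
  apply: normc_le_sqmod => //; rewrite expr1n.
  have [h1 h2 _] := hX n.
  exact: le_trans (l2_coord q h1) h2.
have [s [x [hs hx]]] := cdiagonal_subsequence Xb.
have [lx nx] : l2 x /\ l2_sqnorm x <= 1.
  apply: l2_bounded => n.
  have c : (fun m => \sum_(k < n) sqmod (X (s m) k)) @ \oo -->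
      \sum_(k < n) sqmod (x k) by apply: cvg_sumr => k; exact: cvg_sqmod.
  rewrite -(cvg_lim _ c) //; apply: limr_le; first exact: (cvgP _ c).
  near=> m; have [h1 h2 _] := hX (s m).
  exact: le_trans (l2_partial n h1) h2.
(* The coordinates of the vectors are at most 1, so the absolutely summable coefficients [a]
   dominate. *)
have Hc u : cvgC (fun m => hankel a (X (s m)) u) (hankel a x u).
  apply: (@ctannery R (fun m p => X (s m) p * a (p + u)%N)
    (fun p => x p * a (p + u)%N) _ (summable_shift (u := u)) _ _).2.
    by move=> m p; rewrite normcM' ler_piMl ?normc_ge0.
  by move=> p; apply: cvgCM => //; exact: cvgC_cst.
have Gc : (fun m => l2_sqnorm (hankel a (X (s m)))) @ \oo -->
    l2_sqnorm (hankel a x).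
  have b1 m u : `|sqmod (hankel a (X (s m)) u)| <= tail_sq a u.
    rewrite ger0_norm ?sqmod_ge0 //.
    have [h1 h2 _] := hX (s m).
    apply: le_trans (hankel_bound ha u h1).2 _.
    by rewrite ler_piMl // tail_sq_ge0.
  by have [_ _] := tannery (tail_sq_summable ha) b1 (fun u => cvg_sqmod (Hc u)).
have Gmu : l2_sqnorm (hankel a x) = mu.
  apply/eqP; rewrite eq_le Smu //=.
  rewrite -(cvg_lim _ Gc) //.
  apply/ler_addgt0Pr => e e0; rewrite -lerBlDr.
  apply: limr_ge; first exact: (cvgP _ Gc).
  near=> m; have [_ _ h] := hX (s m).
  apply: le_trans (ltW h); rewrite lerD2l lerN2.
  apply: (@le_trans _ _ m.+1%:R^-1).
    by rewrite lef_pV2 ?posrE // ler_nat ltnS subseq_geq.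
  by apply: ltW; near: m; exact: near_infty_natSinv_lt (PosNum e0).
exists (Num.sqrt mu); rewrite musq; split => //.
(* For norm zero the limit vector may vanish, and a coordinate vector is taken instead. *)
have [m0|m0] := eqVneq mu 0.
  exists (delta_seq 0 1); split; first exact: l2_delta.
    by exists 0%N; rewrite /delta_seq eqxx; apply/eqP; exact: oner_neq0.
  apply/eqP; rewrite eq_le all_le ?m0 ?mul0r; last exact: l2_delta.
  by apply: l2_sqnorm_ge0; apply: hankel_l2 => //; exact: l2_delta.
exists x; split => //.
  apply: contrapT => h; move/eqP : m0; apply.
  have x0 : x = fun=> 0.
    by apply/funext => n; apply: contrapT => xn; apply: h; exists n.
  have -> : mu = l2_sqnorm (hankel a (fun=> 0)) by rewrite -x0.
  have -> : hankel a (fun=> 0) = fun=> 0 by apply/funext => u; exact: hankel0.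
  exact: l20.2.
apply/eqP; rewrite eq_le all_le //= Gmu.
exact: ler_piMr.
Unshelve. all: by end_near. Qed.

(** The quadratic form nu^2 |y|^2 - |hankel a y|^2 is nonnegative and vanishes at [x], so its first
    variation at [x] vanishes in every direction. *)
Lemma extremal_eigenvector (nu : R) x :
  (forall y, l2 y -> l2_sqnorm (hankel a y) <= nu ^+ 2 * l2_sqnorm y) ->
  l2 x -> l2_sqnorm (hankel a x) = nu ^+ 2 * l2_sqnorm x ->
  forall q, matrix_op (Qmx a) x q = (nu ^+ 2)%:C * x q.
Proof.
move=> H hx ex q.
(* The variation is taken in the coordinate direction [q], scaled by the residual [w] itself, so
   that its linear coefficient is the real number 2 |w|^2. *)
pose w := (nu ^+ 2)%:C * x q - matrix_op (Qmx a) x q.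
suff w0 : w = 0 by move/eqP : w0; rewrite subr_eq0 eq_sym => /eqP.
pose y := delta_seq q w.
have hy : l2 y := l2_delta q w.
pose N := nu ^+ 2 * l2_sqnorm y - l2_sqnorm (hankel a y).
have N0 : 0 <= N by rewrite subr_ge0 H.
have key (t : R) : 0 <= 2 * t * sqmod w + t ^+ 2 * N.
  have [h1 h2] := l2Z t%:C hy.
  have := H _ (l2D hx h1); rewrite -subr_ge0.
  have -> : hankel a (fun n => x n + t%:C * y n) =
      fun u => hankel a x u + t%:C * hankel a y u.
    by apply/funext => u; rewrite hankelD // hankelZ.
  have [h3 h4] := l2Z t%:C (hankel_l2 ha hy).
  rewrite !l2_sqnormD //; last exact: hankel_l2.
  rewrite h2 h4 sqmodr ex.
  have innerZ u v : l2 u -> l2 v ->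
      l2_inner u (fun n => t%:C * v n) = t%:C * l2_inner u v.
    move=> hu hv; rewrite /l2_inner.
    have [_ <-] := csumZ t%:C (l2_CS hu (l2J hv)).1.
    by apply: csum_ext => n; rewrite rmorphM /= conjCr; ring.
  rewrite !innerZ //; try exact: hankel_l2.
  rewrite -(Q_inner ha hx hy) !l2_inner_delta.
  suff : Re (t%:C * ((nu ^+ 2)%:C * (x q * w^*) -
     matrix_op (Qmx a) x q * w^*)) = t * sqmod w.
    rewrite !ReImE /= => e1 e2; move: e1 e2; rewrite /N; lra.
  have -> : (nu ^+ 2)%:C * (x q * w^*) - matrix_op (Qmx a) x q * w^* = w * w^*.
    by rewrite /w; ring.
  by rewrite mulcJ /=; ring.
apply: sqmod_eq0; apply/eqP; rewrite eq_le sqmod_ge0 andbT leNgt; apply/negP => wp.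
have Np : 0 < N + 1 by rewrite ltr_wpDl.
(* This is near the minimum of the quadratic in [t]; the denominator N + 1 covers the case N = 0. *)
have := key (- (sqmod w / (N + 1))).
have -> : 2 * - (sqmod w / (N + 1)) * sqmod w + (- (sqmod w / (N + 1))) ^+ 2 * N
  = - (sqmod w / (N + 1)) ^+ 2 * (N + 2).
  by field; rewrite gt_eqF.
rewrite mulNr oppr_ge0 leNgt mulr_gt0 //; last by rewrite ltr_wpDl.
by rewrite exprn_gt0 // divr_gt0.
Qed.

(** Pair the eigenvalue equation with [x] and use [Q_inner]. This forces [mu] to be real, and later
    evaluates the lower bound at a normalized eigenvector. *)
Lemma eigenvector_hankel (mu : R[i]) x : is_eigenvector (matrix_op (Qmx a)) mu x ->
  (l2_sqnorm (hankel a x))%:C = mu * (l2_sqnorm x)%:C.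
Proof.
move=> [hx _ ex].
rewrite -(l2_inner_self (hankel_l2 ha hx)) -(Q_inner ha hx hx) -(l2_inner_self hx).
rewrite /l2_inner.
have [_ <-] := csumZ mu (l2_CS hx (l2J hx)).1.
by apply: csum_ext => n; rewrite ex mulrA.
Qed.

Lemma hankel_greatest_eigenvalue : exists nu : R, [/\ 0 <= nu,
  forall x, l2 x -> l2_sqnorm (hankel a x) <= nu ^+ 2 * l2_sqnorm x &
  greatest_eigenvalue (matrix_op (Qmx a)) (nu ^+ 2)].
Proof.
have [nu [nu0 H [x [hx nx ex]]]] := hankel_norm_attained.
exists nu; split => //; split.
  by exists x; split => // q; exact: extremal_eigenvector.
move=> mu [y ey]; have [hy [n yn] _] := ey.
have yp : 0 < l2_sqnorm y.
  rewrite lt_neqAle l2_sqnorm_ge0 // andbT eq_sym; apply/negP => /eqP y0.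
  by apply: yn; exact: l2_sqnorm0.
have := eigenvector_hankel ey => /(congr1 (fun z => z * ((l2_sqnorm y)^-1)%:C)).
rewrite -mulrA -!(rmorphM (real_complex R)) /= divff ?gt_eqF // mulr1 => <-.
by rewrite lecR ler_pdivrMr // H.
Qed.

End SingularVector.

(** * Completeness and convexity identities for minimizing sequences *)

Section QuadraticMinimization.
Context {R : realType}.

Lemma real_cauchy (u : nat -> R) :
  (forall e, 0 < e -> exists n0, forall m n, (n0 <= m)%N -> (n0 <= n)%N ->
     `|u m - u n| <= e) -> cvgn u.
Proof.
move=> h; apply/cauchy_cvgP/cauchy_ballP => e e0.
have e2 : 0 < e / 2 by rewrite divr_gt0.
have [n0 hn] := h _ e2.
exists (u @` [set n | (n0 <= n)%N], u @` [set n | (n0 <= n)%N]) => /=.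
  by split; exists n0 => // n /= hn'; exists n.
move=> _ [/= [m /= hm <-] [n /= hn' <-]].
rewrite /ball /=; apply: le_lt_trans (hn _ _ hm hn') _.
by rewrite ltr_pdivrMr // ltr_pMr // ltr1n.
Qed.

Lemma complex_cauchy (u : nat -> R[i]) :
  (forall e, 0 < e -> exists n0, forall m n, (n0 <= m)%N -> (n0 <= n)%N ->
     sqmod (u m - u n) <= e) -> exists l, cvgC u l.
Proof.
move=> h.
have [l1 h1] : exists l : R, (fun n => Re (u n)) @ \oo --> l.
  apply/cvg_ex/real_cauchy => e e0.
  have [n0 hn] := h (e ^+ 2) (exprn_gt0 _ e0).
  exists n0 => m n hm hn'; rewrite -(@ler_pXn2r _ 2) ?nnegrE ?(ltW e0) //.
  rewrite real_normK ?num_real //; apply: le_trans (hn _ _ hm hn').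
  by rewrite -ReN -ReD; exact: Re_sqr_le.
have [l2 h2] : exists l : R, (fun n => Im (u n)) @ \oo --> l.
  apply/cvg_ex/real_cauchy => e e0.
  have [n0 hn] := h (e ^+ 2) (exprn_gt0 _ e0).
  exists n0 => m n hm hn'; rewrite -(@ler_pXn2r _ 2) ?nnegrE ?(ltW e0) //.
  rewrite real_normK ?num_real //; apply: le_trans (hn _ _ hm hn').
  by rewrite -ImN -ImD; exact: Im_sqr_le.
by exists (l1 +i* l2).
Qed.

(* In the uses, [d] is the infimum of a quadratic functional on a convex set,
   [Nu] and [Nv] are its values at two points and [D] its value at their
   difference. *)
Lemma convex_gap (Nu Nv D d t : R) : 0 < t < 1 ->
  d <= (1 - t) * Nu + t * Nv - t * (1 - t) * D ->
  (1 - t) * D <= (1 - t) / t * (Nu - d) + (Nv - d).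
Proof.
move=> /andP[t0 t1] h.
rewrite -(ler_pM2l t0).
have -> : t * ((1 - t) / t * (Nu - d) + (Nv - d)) =
  (1 - t) * (Nu - d) + t * (Nv - d) by field; rewrite gt_eqF.
by lra.
Qed.

Lemma l2_sqnorm_convex (x y : nat -> R[i]) (t : R) : l2 x -> l2 y ->
  l2_sqnorm (fun n => (1 - t)%:C * x n + t%:C * y n) =
  (1 - t) * l2_sqnorm x + t * l2_sqnorm y
    - t * (1 - t) * l2_sqnorm (fun n => x n - y n).
Proof.
move=> hx hy; apply: cvg_lim => //.
have cx := cvg_series_ord hx; have cy := cvg_series_ord hy.
have cd := cvg_series_ord (l2B hx hy).
rewrite (_ : series _ = fun n => (1 - t) * (\sum_(k < n) sqmod (x k)) +
   t * (\sum_(k < n) sqmod (y k)) -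
   t * (1 - t) * (\sum_(k < n) sqmod (x k - y k))).
  apply: cvgB; last by apply: cvgM => //; exact: cvg_cst.
  by apply: cvgD; apply: cvgM => //; exact: cvg_cst.
apply/funext => n; rewrite /series /= big_mkord !mulr_sumr -big_split /= -sumrB.
by apply: eq_bigr => k _; rewrite !sqmodE !ReImE /=; ring.
Qed.

End QuadraticMinimization.

(** * Prepending a coefficient without increasing the Hankel norm *)

Section OneStepExtension.
Context {R : realType}.
Implicit Types (b w : nat -> R[i]).

(** The memberships in [l2] belong to the bound because [l2_sqnorm] is meaningful only for
    convergent series. *)
Definition hankel_le (nu : R) b : Prop := l2 b /\
  forall w, l2 w -> l2 (hankel b w) /\
    l2_sqnorm (hankel b w) <= nu ^+ 2 * l2_sqnorm w.

Definition cons_seq (x : R[i]) b : nat -> R[i] :=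
  fun j => if j is j'.+1 then b j' else x.

Lemma l2_behead w : l2 w -> l2 (fun n => w n.+1) /\
  l2_sqnorm w = sqmod (w 0%N) + l2_sqnorm (fun n => w n.+1).
Proof.
move=> hw.
have h : l2 (fun n => w n.+1).
  apply: (@l2_bounded _ _ (l2_sqnorm w) _).1 => n.
  apply: le_trans (l2_partial n.+1 hw); rewrite big_ord_recl lerDr.
  exact: sqmod_ge0.
split => //.
have c1 := cvg_series_ord h.
have c2 : (fun n => \sum_(k < n.+1) sqmod (w k)) @ \oo -->
    sqmod (w 0%N) + l2_sqnorm (fun n => w n.+1).
  rewrite (_ : (fun n => _) = fun n => sqmod (w 0%N) + \sum_(k < n) sqmod (w k.+1)).
    by apply: cvgD; [exact: cvg_cst|exact: c1].
  by apply/funext => n; rewrite big_ord_recl.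
have c3 : (fun n => \sum_(k < n.+1) sqmod (w k)) @ \oo --> l2_sqnorm w.
  by rewrite (cvg_shiftS (fun n => \sum_(k < n) sqmod (w k))); exact: cvg_series_ord.
exact: (cvg_unique _ c3 c2).
Qed.

Lemma l2_cons x b : l2 b -> l2 (cons_seq x b).
Proof.
move=> hb; apply: (@l2_bounded _ _ (sqmod x + l2_sqnorm b) _).1 => -[|n].
  by rewrite big_ord0 addr_ge0 ?sqmod_ge0 ?l2_sqnorm_ge0.
by rewrite big_ord_recl /= lerD2l l2_partial.
Qed.

Lemma l2_drop b u : l2 b -> l2 (fun p => b (p + u)%N).
Proof.
move=> hb; elim: u => [|u ih]; first by under eq_fun do rewrite addn0.
have := (l2_behead ih).1; by under eq_fun do rewrite addSnnS.
Qed.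
Arguments l2_drop b u : clear implicits.

Lemma hankel_lin b x y (s t : R[i]) u : l2 b -> l2 x -> l2 y ->
  hankel b (fun n => s * x n + t * y n) u =
  s * hankel b x u + t * hankel b y u.
Proof.
move=> hb hx hy; rewrite /hankel.
have [cx ex] := csumZ s (l2_CS hx (l2_drop b u hb)).1.
have [cy ey] := csumZ t (l2_CS hy (l2_drop b u hb)).1.
rewrite -ex -ey; have [_ <-] := csumD cx cy.
by apply: csum_ext => n; rewrite mulrDl !mulrA.
Qed.

Lemma hankel_scale b w z u : l2 b -> l2 w ->
  hankel b (fun n => z * w n) u = z * hankel b w u.
Proof.
move=> hb hw; rewrite /hankel.
have [_ <-] := csumZ z (l2_CS hw (l2_drop b u hb)).1.
by apply: csum_ext => n; rewrite mulrA.
Qed.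

Lemma csum_behead (v : nat -> R[i]) : csummable (fun n => v n.+1) ->
  csum v = v 0%N + csum (fun n => v n.+1).
Proof.
move=> /csummable_cvg h.
have c : cvgC (fun n => \sum_(k < n.+1) v k) (v 0%N + csum (fun n => v n.+1)).
  under eq_fun do rewrite big_ord_recl; apply: cvgCD => //; exact: cvgC_cst.
apply: (csumP _).2; case: c => c1 c2; split.
  by rewrite -(cvg_shiftS (fun n => Re (\sum_(k < n) v k))).
by rewrite -(cvg_shiftS (fun n => Im (\sum_(k < n) v k))).
Qed.

Lemma hankel_cons0 x b w : l2 b -> l2 w ->
  hankel (cons_seq x b) w 0 = w 0%N * x + hankel b (fun n => w n.+1) 0.
Proof.
move=> hb hw; rewrite /hankel csum_behead //=.
have := (l2_CS (l2_behead hw).1 hb).1.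
by under [X in _ -> csummable X]eq_fun do rewrite addn0.
Qed.

Lemma hankel_consS x b w p :
  hankel (cons_seq x b) w p.+1 = hankel b w p.
Proof. by apply: csum_ext => n; rewrite addnS. Qed.

Lemma hankel_behead b w p : l2 b -> l2 w -> w 0%N = 0 ->
  hankel b w p = hankel b (fun n => w n.+1) p.+1.
Proof.
move=> hb hw w0; rewrite /hankel csum_behead /= ?w0 ?mul0r ?add0r.
  by apply: csum_ext => n; rewrite addSnnS.
have := (l2_CS (l2_behead hw).1 (l2_drop b p.+1 hb)).1.
by under eq_fun do rewrite addnS -addSn.
Qed.

(* With [N w = nu^2 |w|^2 - |hankel b w|^2], the new entry [x] must satisfy
   [|x + ell w|^2 <= N w] whenever [w 0 = 1]; it is minus the limit of [ell]
   along a minimizing sequence of [N]. *)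
Lemma one_step_extension (nu : R) b : hankel_le nu b ->
  exists x, hankel_le nu (cons_seq x b).
Proof.
move=> [hb H].
pose N w := nu ^+ 2 * l2_sqnorm w - l2_sqnorm (hankel b w).
have N0 w : l2 w -> 0 <= N w by move=> hw; rewrite subr_ge0 (H w hw).2.
pose ell w := hankel b (fun n => w n.+1) 0.
have l2cmb s t w v : l2 w -> l2 v -> l2 (fun n => s * w n + t * v n).
  by move=> hw hv; apply: l2D; exact: (l2Z _ _).1.
have subE w v : (fun n => w n - v n) = (fun n => 1 * w n + (-1) * v n).
  by apply/funext => n; rewrite mul1r mulN1r.
(* [N] is a difference of squared norms of linear images, hence obeys the same parallelogram
   identity as a norm. *)
have Nconvex w v (t : R) : l2 w -> l2 v ->
    N (fun n => (1 - t)%:C * w n + t%:C * v n) =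
    (1 - t) * N w + t * N v - t * (1 - t) * N (fun n => w n - v n).
  move=> hw hv; rewrite /N.
  have -> : hankel b (fun n => (1 - t)%:C * w n + t%:C * v n) =
     fun u => (1 - t)%:C * hankel b w u + t%:C * hankel b v u.
    by apply/funext => u; exact: hankel_lin.
  have -> : hankel b (fun n => w n - v n) =
     fun u => hankel b w u - hankel b v u.
    by apply/funext => u; rewrite subE hankel_lin // mul1r mulN1r.
  rewrite !l2_sqnorm_convex //; [ring|exact: (H _ hw).1|exact: (H _ hv).1].
have ellB w v : l2 w -> l2 v -> ell (fun n => w n - v n) = ell w - ell v.
  move=> hw hv; rewrite /ell subE.
  rewrite (hankel_lin 1 (-1) 0 hb (l2_behead hw).1 (l2_behead hv).1).
  by rewrite mul1r mulN1r.
(* If [w] starts with 0, the Hankel image of its shift consists of [ell w] followed by the image of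
   [w], and the norm bound for the shift is the claim. *)
have ell0 w : l2 w -> w 0%N = 0 -> sqmod (ell w) <= N w.
  move=> hw w0; have [hw' e] := l2_behead hw.
  have [h1 h2] := H _ hw'.
  have e2 := (l2_behead h1).2.
  have e3 : (fun n => hankel b (fun n => w n.+1) n.+1) = hankel b w.
    by apply/funext => p; rewrite -hankel_behead.
  rewrite /N e w0 sqmod0 add0r; move: h2; rewrite e2 e3 /ell; lra.
pose S := [set N w | w in [set w | l2 w /\ w 0%N = 1]].
have S0 : S !=set0.
  exists (N (delta_seq 0 1)), (delta_seq 0 1) => //; split=> //.
  exact: l2_delta.
have lS : has_lbound S by exists 0 => _ [w [hw _] <-]; exact: N0.
pose d := inf S.
have d0 : 0 <= d by apply: lb_le_inf => // _ [w [hw _] <-]; exact: N0.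
have dle w : l2 w -> w 0%N = 1 -> d <= N w.
  by move=> hw w0; apply: ge_inf => //; exists w.
have ex n : exists w, [/\ l2 w, w 0%N = 1 & N w < d + n.+1%:R^-1].
  have [|_ [w [hw w0] <-] h] := @inf_adherent _ S n.+1%:R^-1 _ (conj S0 lS).
    by rewrite invr_gt0.
  by exists w.
have [w hw] := choice ex.
(* The difference of two admissible vectors starts with 0, so [ell0] applies to it, while their
   convex combinations remain admissible and have [N] at least [d]. *)
have gap v n t : l2 v -> v 0%N = 1 -> 0 < t < 1 ->
    (1 - t) * sqmod (ell v - ell (w n)) <=
    (1 - t) / t * (N (w n) - d) + (N v - d).
  move=> hv v0 t01; have [h1 h2 h3] := hw n.
  have t1 : 0 < 1 - t by case/andP : t01 => _; rewrite subr_gt0.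
  apply: (@le_trans _ _ ((1 - t) * N (fun n0 => w n n0 - v n0))).
    rewrite ler_pM2l // sqmodBC -ellB //; apply: ell0; first exact: l2B.
    by rewrite h2 v0 subrr.
  apply: convex_gap => //; rewrite -Nconvex //; apply: dle; first exact: l2cmb.
  by rewrite h2 v0 !mulr1 -rmorphD /= subrK.
(* The gap with t = 1/2 shows that [ell] is Cauchy along the minimizing sequence. *)
have [l hl] : exists l, cvgC (fun n => ell (w n)) l.
  apply: complex_cauchy => e e0.
  have e4 : 0 < e / 4 by rewrite divr_gt0.
  have [n0 _ hn0] := near_infty_natSinv_lt (PosNum e4).
  exists n0 => m n hm hn.
  have [h1 h2 h3] := hw m; have [_ _ h4] := hw n.
  have t01 : 0 < (1 / 2 : R) < 1.
    by rewrite divr_gt0 //= ltr_pdivrMr // mul1r ltr1n.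
  have := gap (w m) n (1/2) h1 h2 t01.
  have := hn0 m hm; have := hn0 n hn => /= k1 k2.
  rewrite (_ : (1 - 1 / 2) / (1 / 2) = 1); last by field.
  move: h3 h4 k1 k2.
  move: (N (w m)) (N (w n)) m.+1%:R^-1 n.+1%:R^-1 (sqmod _) => A B q r s.
  clear -d e; lra.
exists (- l); split; first exact: l2_cons.
have key v : l2 v -> v 0%N = 1 -> sqmod (- l + ell v) <= N v.
  move=> hv v0.
  have c : (fun n => sqmod (ell v - ell (w n))) @ \oo --> sqmod (- l + ell v).
    by rewrite [- l + _]addrC; apply: cvg_sqmod; apply: cvgCB => //; exact: cvgC_cst.
  have cN : (fun n => N (w n)) @ \oo --> d.
    apply: (@squeeze_cvgr _ _ _ _ (fun=> d) (fun n => d + n.+1%:R^-1)).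
    - near=> n; have [h1 h2 h3] := hw n.
      by rewrite dle //= ltW.
    - exact: cvg_cst.
    - rewrite -[X in _ --> X]addr0; apply: cvgD; first exact: cvg_cst.
      exact: cvg_harmonic.
  (* Letting [n] go to infinity removes the term (N (w n) - d); letting [t] go to 0 afterwards gives
     the claim, since d >= 0. *)
  have kt (t : R) : 0 < t < 1 -> (1 - t) * sqmod (- l + ell v) <= N v - d.
    move=> t01.
    have c1 : (fun n => (1 - t) * sqmod (ell v - ell (w n))) @ \oo -->
       (1 - t) * sqmod (- l + ell v) by apply: cvgM => //; exact: cvg_cst.
    have c2 : (fun n => (1 - t) / t * (N (w n) - d) + (N v - d)) @ \oo -->
        (1 - t) / t * (d - d) + (N v - d).
      apply: cvgD; last exact: cvg_cst.
      by apply: cvgM; [exact: cvg_cst|apply: cvgB => //; exact: cvg_cst].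
    rewrite subrr mulr0 add0r in c2.
    apply: (ler_cvg_to c1 c2); near=> n; exact: gap.
  apply/ler_addgt0Pr => e e0.
  set s := sqmod _ in kt *; have s0 : 0 <= s by exact: sqmod_ge0.
  (* Chosen so that t s <= e, with 0 < t < 1 whatever the size of [s]. *)
  pose t := e / (e + s + 1).
  have p0 : 0 < e + s + 1 by rewrite ltr_wpDl // addr_ge0 // ltW.
  have t01 : 0 < t < 1.
    by rewrite divr_gt0 //= ltr_pdivrMr // mul1r -addrA ltrDl ltr_wpDl.
  have := kt t t01.
  have : t * s <= e.
    rewrite /t mulrAC ler_pdivrMr //.
    have := mulr_ge0 (ltW e0) s0; have := sqr_ge0 e; rewrite expr2; lra.
  lra.
move=> v hv.
have [h1 h2] := H _ hv.
(* The extended operator adds this single coordinate to the image. The case of a nonzero first entry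
   is rescaled to entry 1. *)
have key2 : sqmod (hankel (cons_seq (- l) b) v 0) <= N v.
  rewrite hankel_cons0 //; have [v0|v0] := eqVneq (v 0%N) 0.
    by rewrite v0 mul0r add0r; exact: ell0.
  have [k1 k2] := l2Z (v 0%N)^-1 hv.
  have := key _ k1 (mulVf v0).
  have e1 : hankel b (fun n => (v 0%N)^-1 * v n) =
     fun u => (v 0%N)^-1 * hankel b v u.
    by apply/funext => u; exact: hankel_scale.
  have e2 : ell (fun n => (v 0%N)^-1 * v n) = (v 0%N)^-1 * ell v.
    exact: hankel_scale _ _ hb (l2_behead hv).1.
  rewrite /N e1 k2 (l2Z _ h1).2 e2 => hk.
  have sp : 0 < sqmod (v 0%N).
    rewrite lt_neqAle sqmod_ge0 andbT eq_sym; apply/negP => /eqP /sqmod_eq0 v1.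
    by rewrite v1 eqxx in v0.
  have e5 : v 0%N * (- l + (v 0%N)^-1 * ell v) = v 0%N * - l + ell v.
    by rewrite mulrDr mulrA mulfV // mul1r.
  have e6 : sqmod (v 0%N) * sqmod (v 0%N)^-1 = 1.
    by rewrite -sqmodM mulfV // sqmodE /= expr1n expr0n addr0.
  have := ler_wpM2l (ltW sp) hk; rewrite -[leLHS]sqmodM e5 => hk'.
  apply: le_trans hk' _.
  have -> : sqmod (v 0%N) * (nu ^+ 2 * (sqmod (v 0%N)^-1 * l2_sqnorm v) -
    sqmod (v 0%N)^-1 * l2_sqnorm (hankel b v)) =
    (sqmod (v 0%N) * sqmod (v 0%N)^-1) *
    (nu ^+ 2 * l2_sqnorm v - l2_sqnorm (hankel b v)) by ring.
  by rewrite e6 mul1r.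
have e3 : hankel (cons_seq (- l) b) v =
    cons_seq (hankel (cons_seq (- l) b) v 0) (hankel b v).
  by apply/funext => -[|p] //=; rewrite hankel_consS.
have l2c : l2 (hankel (cons_seq (- l) b) v) by rewrite e3; exact: l2_cons.
split => //; have [_ ->] := l2_behead l2c.
have -> : (fun n => hankel (cons_seq (- l) b) v n.+1) = hankel b v.
  by apply/funext => p; rewrite hankel_consS.
by move: key2; rewrite /N; lra.
Unshelve. all: by end_near. Qed.

End OneStepExtension.

(** * Exponentials on the circle *)

Section Exponentials.
Context {R : realType}.
Implicit Types (x : R) (n k : int).

Lemma cexpiD n k x : cexpi (n + k) x = cexpi n x * cexpi k x.
Proof.
apply: complex_eqP; rewrite ReImE /= intrD mulrDl ?cosD ?sinD //.
by rewrite addrC [X in X + _]mulrC [X in _ + X]mulrC addrC.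
Qed.

Lemma cexpi0 x : cexpi 0 x = 1.
Proof. by apply: complex_eqP; rewrite /= mul0r ?cos0 ?sin0. Qed.

Lemma sqmod_cexpi n x : sqmod (cexpi n x) = 1.
Proof. by rewrite sqmodE /= cos2Dsin2. Qed.

Lemma normc_cexpi n x : normc (cexpi n x) = 1.
Proof.
apply/eqP; rewrite -(@eqrXn2 _ 2) ?normc_ge0 // expr1n.
by rewrite -[_ ^+ 2]/(sqmod _) sqmod_cexpi.
Qed.

Lemma cexpiJ n x : (cexpi n x)^* = cexpi (- n) x.
Proof.
by apply: complex_eqP; rewrite ReImE /= intrN mulNr ?cosN ?sinN.
Qed.

Lemma cexpiX (j : nat) x : cexpi (- j%:Z) x = cexpi (-1) x ^+ j.
Proof.
elim: j => [|j ih]; first by rewrite oppr0 cexpi0.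
by rewrite exprS -ih -cexpiD; congr cexpi; lia.
Qed.

End Exponentials.

(** * Approximation of the symbol by past polynomials *)

Section SymbolExtension.
Context {R : realType}.
Variable a : nat -> R[i].
Hypothesis ha1 : cvgn (series (fun j => normc (a j))).

Lemma normc_A_term x j : normc (a j * cexpi j%:Z x) = normc (a j).
Proof. by rewrite normcM' normc_cexpi mulr1. Qed.

Lemma A_spectral_summable x :
  cvgn (series (fun j => normc (a j * cexpi j%:Z x))).
Proof. by under [X in cvgn (series X)]eq_fun do rewrite normc_A_term. Qed.

Arguments A_spectral_summable : clear implicits.

Definition abs_tail (m : nat) : R :=
  limn (series (fun j => normc (a j))) - series (fun j => normc (a j)) m.

Lemma A_spectral_tail x m :
  normc (A_spectral a x - \sum_(j < m) a j * cexpi j%:Z x) <= abs_tail m.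
Proof.
have := csum_tail m (A_spectral_summable x).
rewrite (_ : (fun n => normc (a n * cexpi n%:Z x)) = fun n => normc (a n)) //.
by apply/funext => j; exact: normc_A_term.
Qed.

Lemma abs_tail_cvg0 : abs_tail @ \oo --> 0.
Proof.
rewrite -(subrr (limn (series (fun j => normc (a j))))).
by apply: cvgB => //; exact: cvg_cst.
Qed.

Lemma abs_tail_ge0 m : 0 <= abs_tail m.
Proof. exact: le_trans (normc_ge0 _) (A_spectral_tail 0 m). Qed.

(** Entry [j] of [B k] is the coefficient of frequency j - k; each level keeps the old coefficients
    and adds one at the next negative frequency. *)
Lemma hankel_tower (nu : R) : hankel_le nu a ->
  exists B : nat -> nat -> R[i], [/\ B 0%N = a,
    forall k, hankel_le nu (B k) & forall k j, B k.+1 j.+1 = B k j].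
Proof.
move=> h.
have ex b : exists x, hankel_le nu b -> hankel_le nu (cons_seq x b).
  have [hb|hb] := pselect (hankel_le nu b); last by exists 0.
  by have [x hx] := one_step_extension hb; exists x.
have [f hf] := choice ex.
exists (fun k => iter k (fun b => cons_seq (f b) b) a); split => //.
by elim => //= k ih; exact: hf.
Qed.

(* The left side pairs [e] with the Hankel image of an exponential vector; the
   two vectors have length [n] and norm [sqrt n]. *)
Lemma fejer_bound (nu : R) (b : nat -> R[i]) (n : nat) (e : nat -> R[i]) x :
  0 <= nu -> hankel_le nu b -> (forall p, sqmod (e p) = 1) ->
  normc (\sum_(p < n) e p * \sum_(u < n) cexpi u%:Z x * b (u + p)%N) <= nu * n%:R.
Proof.
move=> nu0 [hb H] he.
pose v u := if (u < n)%N then cexpi u%:Z x else 0.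
have vout u : (n <= u)%N -> v u = 0 by rewrite /v ltnNge => ->.
have [hv nv] := l2_finite vout.
have ve p : hankel b v p = \sum_(u < n) cexpi u%:Z x * b (u + p)%N.
  have [|_ e1] := @csum_finite R (fun u => v u * b (u + p)%N) n.
    by move=> u nu'; rewrite vout // mul0r.
  by rewrite /hankel e1; apply: eq_bigr => u _; rewrite /v ltn_ord.
have nv' : l2_sqnorm v = n%:R.
  rewrite nv (eq_bigr (fun=> 1)); first by rewrite sumr_const card_ord.
  by move=> u _; rewrite /v ltn_ord sqmod_cexpi.
have [h1 h2] := H v hv.
apply: normc_le_sqmod; first by rewrite mulr_ge0.
apply: le_trans (CS_sqmod _ _ _) _.
rewrite (eq_bigr (fun=> 1)) ?sumr_const ?card_ord; last by move=> p _; exact: he.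
have -> : (nu * n%:R) ^+ 2 = n%:R * (nu ^+ 2 * n%:R) by ring.
apply: ler_wpM2l => //.
apply: le_trans (_ : l2_sqnorm (hankel b v) <= _); last first.
  by rewrite -nv'.
under eq_bigr do rewrite -ve; exact: l2_partial.
Qed.

(* Prepending [m] coefficients to [a] without increasing the Hankel norm and
   taking the Fejer mean leaves on the nonnegative frequencies a Cesaro mean of
   the partial sums of [A_spectral a]. *)
Lemma nehari_approximation (nu : R) : 0 <= nu -> hankel_le nu a ->
  exists (eps : nat -> R) (P : nat -> {poly R[i]}), eps @ \oo --> 0 /\
    forall m x, normc (A_spectral a x - cexpi (-1) x * (P m).[cexpi (-1) x])
      <= nu + eps m.
Proof.
move=> nu0 /hankel_tower [B [B0 HB BS]].
have Ba k j : B k (k + j)%N = a j.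
  by elim: k => [|k ih]; [rewrite B0|rewrite addSn BS].
exists (arithmetic_mean (fun p => abs_tail p.+1)).
pose c (m : nat) : R[i] := (m.+1%:R^-1 : R)%:C.
(* The exponents are lowered by one because a past polynomial carries a separate factor
   [cexpi (-1) x]. The sign is negative because the extension approximates A minus the estimate. *)
exists (fun m => - (c m *: \sum_(p < m.+1) \sum_(u < m - p)
  B m (p + u)%N *: 'X^((m - p - u).-1))).
split.
  apply: cesaro; have := abs_tail_cvg0.
  by rewrite -(cvg_shiftS abs_tail).
move=> m x.
set w := cexpi (-1) x.
(* The phases put entry u + p of [B m] at its own frequency u + p - m. Terms with u + p < m form
   [neg]; the others form, for each [p], the partial sum of A with p + 1 terms. *)
pose sig := \sum_(p < m.+1) cexpi (p%:Z - m%:Z) x *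
  \sum_(u < m.+1) cexpi u%:Z x * B m (u + p)%N.
have sigb : normc sig <= nu * m.+1%:R.
  exact: (@fejer_bound nu (B m) m.+1 (fun p => cexpi (p%:Z - m%:Z) x) x nu0
    (HB m) (fun p => sqmod_cexpi _ x)).
pose neg := \sum_(p < m.+1) \sum_(u < m - p) B m (p + u)%N * w ^+ (m - p - u).
pose pos := \sum_(p < m.+1) \sum_(j < p.+1) a j * cexpi j%:Z x.
have sigE : sig = neg + pos.
  rewrite /sig /neg /pos -big_split /=; apply: eq_bigr => p _.
  have pm : (p <= m)%N by rewrite -ltnS.
  have e1 : m.+1 = (m - p + p.+1)%N by rewrite addnS subnK.
  rewrite mulr_sumr.
  pose g (u : nat) := cexpi (p%:Z - m%:Z) x * (cexpi u%:Z x * B m (u + p)%N).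
  have -> : \sum_(u < m.+1) g u = \sum_(u < m - p + p.+1) g u.
    by rewrite -!(big_mkord predT g) -e1.
  rewrite big_split_ord /=; congr (_ + _); apply: eq_bigr => u _; rewrite /g.
    rewrite mulrA -cexpiD mulrC addnC; congr (_ * _).
    rewrite /w -cexpiX; congr cexpi.
    have := ltn_ord u; lia.
  rewrite mulrA -cexpiD mulrC; congr (_ * _).
    by rewrite -(Ba m u); congr B; lia.
  by congr cexpi; lia.
have PE : w * (- (c m *: \sum_(p < m.+1) \sum_(u < m - p)
    B m (p + u)%N *: 'X^((m - p - u).-1))).[w] = - (c m * neg).
  rewrite hornerN mulrN; congr (- _); rewrite hornerZ mulrCA; congr (_ * _).
  rewrite horner_sum mulr_sumr; apply: eq_bigr => p _.
  rewrite horner_sum mulr_sumr; apply: eq_bigr => u _.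
  rewrite hornerZ hornerXn mulrCA -exprS prednK // subn_gt0 ltn_ord //.
rewrite PE opprK.
have cc : c m * (m.+1%:R : R)%:C = 1.
  by rewrite /c -(rmorphM (real_complex R)) mulVf // pnatr_eq0.
have -> : A_spectral a x + c m * neg =
   c m * sig + c m * \sum_(p < m.+1) (A_spectral a x - \sum_(j < p.+1) a j * cexpi j%:Z x).
  rewrite sumrB sumr_const card_ord -/pos sigE.
  have -> : A_spectral a x *+ m.+1 = (m.+1%:R : R)%:C * A_spectral a x.
    by rewrite (rmorph_nat (real_complex R)) mulr_natl.
  have -> : c m * (neg + pos) + c m * ((m.+1%:R : R)%:C * A_spectral a x - pos) =
    c m * neg + (c m * (m.+1%:R : R)%:C) * A_spectral a x by ring.
  by rewrite cc mul1r addrC.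
have nc : normc (c m) = m.+1%:R^-1.
  by rewrite normcr ger0_norm // invr_ge0.
apply: le_trans (le_normcD _ _) _; rewrite !normcM' nc; apply: lerD.
  by rewrite mulrC ler_pdivrMr.
rewrite /arithmetic_mean /= ; apply: ler_wpM2l; first by rewrite invr_ge0.
apply: le_trans (normc_sum _ _ _) _.
rewrite /series /= big_mkord; apply: ler_sum => p _; exact: A_spectral_tail.
Qed.

End SymbolExtension.

(** * Complex square integrable functions *)

Section ComplexL2.
Context {R : realType} {d : measure_display} {T : measurableType d}.
Variables (mu : {measure set T -> \bar R}) (D : set T).
Hypothesis mD : measurable D.
Implicit Types (f g h : T -> R[i]).

Lemma cmeasurable_cst (z : R[i]) : cmeasurable D (fun=> z).
Proof. by split; exact: measurable_cst. Qed.

Lemma cmeasurableD f g : cmeasurable D f -> cmeasurable D g ->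
  cmeasurable D (fun x => f x + g x).
Proof.
move=> [f1 f2] [g1 g2]; split.
  by under eq_fun do rewrite ReD; exact: measurable_funD.
by under eq_fun do rewrite ImD; exact: measurable_funD.
Qed.

Lemma cmeasurableM f g : cmeasurable D f -> cmeasurable D g ->
  cmeasurable D (fun x => f x * g x).
Proof.
move=> [f1 f2] [g1 g2]; split.
  under eq_fun do rewrite ReM.
  by apply: measurable_funB; exact: measurable_funM.
under eq_fun do rewrite ImM.
by apply: measurable_funD; exact: measurable_funM.
Qed.

Lemma cmeasurableJ f : cmeasurable D f -> cmeasurable D (fun x => (f x)^*).
Proof.
move=> [f1 f2]; split.
  by under eq_fun do rewrite ReJ.
by under eq_fun do rewrite ImJ; exact: measurableT_comp.
Qed.

Lemma cmeasurableN f : cmeasurable D f -> cmeasurable D (fun x => - f x).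
Proof.
move=> [f1 f2]; split.
  by under eq_fun do rewrite ReN; exact: measurableT_comp.
by under eq_fun do rewrite ImN; exact: measurableT_comp.
Qed.

Lemma cmeasurableB f g : cmeasurable D f -> cmeasurable D g ->
  cmeasurable D (fun x => f x - g x).
Proof. by move=> mf mg; apply: cmeasurableD => //; exact: cmeasurableN. Qed.

Lemma cmeasurable_sum I (s : seq I) (f : I -> T -> R[i]) :
  (forall i, cmeasurable D (f i)) ->
  cmeasurable D (fun x => \sum_(i <- s) f i x).
Proof.
move=> h; elim: s => [|i s ih].
  by under eq_fun do rewrite big_nil; exact: cmeasurable_cst.
by under eq_fun do rewrite big_cons; exact: cmeasurableD.
Qed.

Lemma cmeasurable_lim (f : nat -> T -> R[i]) g :
  (forall n, cmeasurable D (f n)) ->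
  (forall x, D x -> cvgC (fun n => f n x) (g x)) -> cmeasurable D g.
Proof.
move=> mf fg; split.
  apply: (@measurable_fun_cvg _ _ _ D (fun n x => Re (f n x))) => [n|x Dx].
    exact: (mf n).1.
  exact: (fg x Dx).1.
apply: (@measurable_fun_cvg _ _ _ D (fun n x => Im (f n x))) => [n|x Dx].
  exact: (mf n).2.
exact: (fg x Dx).2.
Qed.

Lemma measurable_sqmod f : cmeasurable D f ->
  measurable_fun D (fun x => sqmod (f x)).
Proof.
move=> [f1 f2]; under eq_fun do rewrite sqmodE.
by apply: measurable_funD; exact: measurable_funX.
Qed.

Definition nrm2 f : R := Rintegral mu D (fun x => sqmod (f x)).

Definition in_L2 f : Prop := cmeasurable D f /\
  mu.-integrable D (EFin \o (fun x => sqmod (f x))).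

Lemma in_L2P f : in_L2 f <->
  cmeasurable D f /\ (\int[mu]_(x in D) (sqmod (f x))%:E < +oo)%E.
Proof.
have e : (\int[mu]_(x in D) `|(sqmod (f x))%:E|)%E =
    (\int[mu]_(x in D) (sqmod (f x))%:E)%E.
  by apply: eq_integral => x _; rewrite abse_EFin ger0_norm // sqmod_ge0.
split=> -[mf].
  by move=> /integrableP[_]; rewrite e.
move=> h; split => //; apply/integrableP; split.
  by apply/measurable_EFinP; exact: measurable_sqmod.
by rewrite e.
Qed.

Lemma nrm2E f : in_L2 f -> (\int[mu]_(x in D) (sqmod (f x))%:E)%E = (nrm2 f)%:E.
Proof.
move=> [mf fi]; rewrite fineK //; exact: integrable_fin_num.
Qed.

Lemma nrm2_ge0 f : 0 <= nrm2 f.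
Proof. by apply: Rintegral_ge0 => x _; exact: sqmod_ge0. Qed.

Lemma in_L2_le f (g : T -> R) : cmeasurable D f ->
  mu.-integrable D (EFin \o g) -> (forall x, D x -> sqmod (f x) <= g x) ->
  in_L2 f.
Proof.
move=> mf gi fg; split => //; apply: le_integrable gi => //.
  by apply/measurable_EFinP; exact: measurable_sqmod.
move=> x Dx /=; rewrite lee_fin ger0_norm ?sqmod_ge0 //.
exact: le_trans (fg x Dx) (ler_norm _).
Qed.

Lemma in_L2D f g : in_L2 f -> in_L2 g -> in_L2 (fun x => f x + g x).
Proof.
move=> [mf fi] [mg gi].
apply: (@in_L2_le _ (fun x => 2 * sqmod (f x) + 2 * sqmod (g x))).
- exact: cmeasurableD.
- exact: (integrableD mD (integrableZl mD 2 fi) (integrableZl mD 2 gi)).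
- by move=> x _; exact: sqmodD_le.
Qed.

Lemma in_L2Z z f : in_L2 f -> in_L2 (fun x => z * f x).
Proof.
move=> [mf fi]; apply: (@in_L2_le _ (fun x => sqmod z * sqmod (f x))).
- by apply: cmeasurableM => //; exact: cmeasurable_cst.
- exact: (integrableZl mD (sqmod z) fi).
- by move=> x _; rewrite sqmodM.
Qed.

Lemma in_L2N f : in_L2 f -> in_L2 (fun x => - f x).
Proof.
move=> [mf fi]; apply: (in_L2_le (cmeasurableN mf) fi) => x _.
by rewrite sqmodN.
Qed.

Lemma in_L2B f g : in_L2 f -> in_L2 g -> in_L2 (fun x => f x - g x).
Proof. by move=> hf hg; apply: in_L2D => //; exact: in_L2N. Qed.

Lemma in_L2_0 : in_L2 (fun=> 0).
Proof.
split; first exact: cmeasurable_cst.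
under [X in _.-integrable D X]eq_fun do rewrite /= sqmod0.
exact: integrable0.
Qed.

Lemma in_L2_sum I (s : seq I) (f : I -> T -> R[i]) :
  (forall i, in_L2 (f i)) -> in_L2 (fun x => \sum_(i <- s) f i x).
Proof.
move=> h; elim: s => [|i s ih].
  by under [X in in_L2 X]eq_fun do rewrite big_nil; exact: in_L2_0.
by under [X in in_L2 X]eq_fun do rewrite big_cons; exact: in_L2D.
Qed.

Definition cintegrable f : Prop :=
  mu.-integrable D (EFin \o (fun x => Re (f x))) /\
  mu.-integrable D (EFin \o (fun x => Im (f x))).

Lemma in_L2_mul f g : in_L2 f -> in_L2 g -> cintegrable (fun x => f x * (g x)^*).
Proof.
move=> [mf fi] [mg gi].
have [m1 m2] := cmeasurableM mf (cmeasurableJ mg).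
have si := integrableD mD fi gi.
have b (r : R) x : r ^+ 2 <= sqmod (f x * (g x)^*) ->
    `|r| <= sqmod (f x) + sqmod (g x).
  move=> h; rewrite -(@ler_pXn2r _ 2) ?nnegrE ?addr_ge0 ?sqmod_ge0 //.
  rewrite real_normK ?num_real //; apply: le_trans h _.
  rewrite sqmodM sqmodJ.
  have := sqmod_ge0 (f x); have := sqmod_ge0 (g x).
  have := sqr_ge0 (sqmod (f x)); have := sqr_ge0 (sqmod (g x)); nra.
split; apply: (le_integrable mD _ _ si) => //.
- exact/measurable_EFinP.
- move=> x Dx /=; rewrite lee_fin [leRHS]ger0_norm ?addr_ge0 ?sqmod_ge0 //.
  by apply: b; exact: Re_sqr_le.
- exact/measurable_EFinP.
- move=> x Dx /=; rewrite lee_fin [leRHS]ger0_norm ?addr_ge0 ?sqmod_ge0 //.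
  by apply: b; exact: Im_sqr_le.
Qed.

Lemma cintegralD f g : cintegrable f -> cintegrable g ->
  cintegrable (fun x => f x + g x) /\
  cintegral mu D (fun x => f x + g x) = cintegral mu D f + cintegral mu D g.
Proof.
move=> [f1 f2] [g1 g2]; split.
  split; first by under [X in _.-integrable D X]eq_fun do rewrite /= ReD;
    exact: (integrableD mD f1 g1).
  by under [X in _.-integrable D X]eq_fun do rewrite /= ImD; exact: (integrableD mD f2 g2).
apply: complex_eqP; rewrite ReImE /=.
  by rewrite -RintegralD //; congr Rintegral; apply/funext => x; rewrite ReD.
by rewrite -RintegralD //; congr Rintegral; apply/funext => x; rewrite ImD.
Qed.

Lemma cintegralZ z f : cintegrable f ->
  cintegrable (fun x => z * f x) /\
  cintegral mu D (fun x => z * f x) = z * cintegral mu D f.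
Proof.
move=> [f1 f2].
have a1 := integrableZl mD (Re z) f1; have a2 := integrableZl mD (Im z) f2.
have a3 := integrableZl mD (Re z) f2; have a4 := integrableZl mD (Im z) f1.
split.
  split.
    by under [X in _.-integrable D X]eq_fun do rewrite /= ReM; exact: (integrableB mD a1 a2).
  by under [X in _.-integrable D X]eq_fun do rewrite /= ImM; exact: (integrableD mD a3 a4).
apply: complex_eqP; rewrite ReImE /=.
  rewrite -!RintegralZl // -RintegralB //.
  by congr Rintegral; apply/funext => x; rewrite ReM.
rewrite -!RintegralZl // -RintegralD //.
by congr Rintegral; apply/funext => x; rewrite ImM.
Qed.

Lemma cintegralJ f : cintegrable f ->
  cintegral mu D (fun x => (f x)^*) = (cintegral mu D f)^*.
Proof.
move=> [f1 f2]; apply: complex_eqP; rewrite ReImE /=.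
  by congr Rintegral; apply/funext => x; rewrite ReJ.
rewrite -mulN1r -RintegralZl //.
by congr Rintegral; apply/funext => x; rewrite ImJ mulN1r.
Qed.

Definition ip f g : R[i] := cintegral mu D (fun x => f x * (g x)^*).

Lemma ip_self f : ip f f = (nrm2 f)%:C.
Proof.
apply: complex_eqP => /=.
  by congr Rintegral; apply/funext => x; rewrite mulcJ.
under [X in Rintegral mu D X]eq_fun do rewrite mulcJ /=.
by rewrite Rintegral_cst // mul0r.
Qed.

Lemma ipDl f g h : in_L2 f -> in_L2 g -> in_L2 h ->
  ip (fun x => f x + g x) h = ip f h + ip g h.
Proof.
move=> hf hg hh; have [_ <-] := cintegralD (in_L2_mul hf hh) (in_L2_mul hg hh).
by congr cintegral; apply/funext => x; rewrite mulrDl.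
Qed.

Lemma ipZl z f h : in_L2 f -> in_L2 h -> ip (fun x => z * f x) h = z * ip f h.
Proof.
move=> hf hh; have [_ <-] := cintegralZ z (in_L2_mul hf hh).
by congr cintegral; apply/funext => x; rewrite mulrA.
Qed.

Lemma ipJ f g : in_L2 f -> in_L2 g -> ip g f = (ip f g)^*.
Proof.
move=> hf hg; rewrite -(cintegralJ (in_L2_mul hf hg)).
by congr cintegral; apply/funext => x; rewrite rmorphM /= conjCK mulrC.
Qed.

Lemma ipBl f g h : in_L2 f -> in_L2 g -> in_L2 h ->
  ip (fun x => f x - g x) h = ip f h - ip g h.
Proof.
move=> hf hg hh.
have := ipDl hf (in_L2Z (-1) hg) hh; rewrite ipZl // mulN1r => <-.
by congr ip; apply/funext => x; rewrite mulN1r.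
Qed.

Lemma ip_suml I (s : seq I) (z : I -> R[i]) (f : I -> T -> R[i]) h :
  (forall i, in_L2 (f i)) -> in_L2 h ->
  ip (fun x => \sum_(i <- s) z i * f i x) h = \sum_(i <- s) z i * ip (f i) h.
Proof.
move=> hf hh; elim: s => [|i s ih].
  rewrite big_nil (_ : (fun x => _) = fun x => 0 * 0).
    by rewrite ipZl ?mul0r //; exact: in_L2_0.
  by apply/funext => x; rewrite big_nil mul0r.
rewrite big_cons -ih -ipZl // -ipDl //.
- by congr ip; apply/funext => x; rewrite big_cons.
- exact: in_L2Z.
- by apply: in_L2_sum => j; exact: in_L2Z.
Qed.

Lemma ip_sumr I (s : seq I) (z : I -> R[i]) (f : I -> T -> R[i]) h :
  (forall i, in_L2 (f i)) -> in_L2 h ->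
  ip h (fun x => \sum_(i <- s) z i * f i x) = \sum_(i <- s) (z i)^* * ip h (f i).
Proof.
move=> hf hh; rewrite (ipJ _ hh); last by apply: in_L2_sum => j; exact: in_L2Z.
rewrite ip_suml // rmorph_sum /=; apply: eq_bigr => i _.
by rewrite rmorphM /= -ipJ.
Qed.

Lemma nrm2D f g : in_L2 f -> in_L2 g ->
  nrm2 (fun x => f x + g x) = nrm2 f + 2 * Re (ip f g) + nrm2 g.
Proof.
move=> hf hg; have [i1 _] := in_L2_mul hf hg.
rewrite /= -RintegralZl // -RintegralD //; last exact: (integrableZl mD 2 i1).
  rewrite -RintegralD //; [|exact: (integrableD mD hf.2 (integrableZl mD 2 i1))|exact: hg.2].
  congr Rintegral; apply/funext => x; rewrite !sqmodE !ReImE; ring.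
exact: hf.2.
Qed.

Lemma nrm2Z z f : in_L2 f -> nrm2 (fun x => z * f x) = sqmod z * nrm2 f.
Proof.
move=> [_ hf]; rewrite -RintegralZl //.
by congr Rintegral; apply/funext => x; rewrite sqmodM.
Qed.

Lemma nrm2N f : nrm2 (fun x => - f x) = nrm2 f.
Proof. by congr Rintegral; apply/funext => x; rewrite sqmodN. Qed.

Lemma nrm2BC f g : nrm2 (fun x => f x - g x) = nrm2 (fun x => g x - f x).
Proof. by congr Rintegral; apply/funext => x; rewrite sqmodBC. Qed.

Lemma nrm2_le f (g : T -> R) : in_L2 f -> mu.-integrable D (EFin \o g) ->
  (forall x, D x -> sqmod (f x) <= g x) -> nrm2 f <= Rintegral mu D g.
Proof. by move=> [_ hf] hg fg; exact: le_Rintegral. Qed.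

Lemma nrm2D_le f g : in_L2 f -> in_L2 g ->
  nrm2 (fun x => f x + g x) <= 2 * nrm2 f + 2 * nrm2 g.
Proof.
move=> hf hg; rewrite -!RintegralZl //; [|exact: hg.2|exact: hf.2].
have i1 := integrableZl mD 2 hf.2; have i2 := integrableZl mD 2 hg.2.
rewrite -RintegralD //; apply: nrm2_le; first exact: in_L2D.
  exact: (integrableD mD i1 i2).
by move=> x _; exact: sqmodD_le.
Qed.

Lemma nrm2_convex f g (t : R) : in_L2 f -> in_L2 g ->
  nrm2 (fun x => (1 - t)%:C * f x + t%:C * g x) =
  (1 - t) * nrm2 f + t * nrm2 g - t * (1 - t) * nrm2 (fun x => f x - g x).
Proof.
move=> hf hg; rewrite (nrm2D (in_L2Z _ hf) (in_L2Z _ hg)).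
rewrite !nrm2Z // !sqmodr.
have -> : nrm2 (fun x => f x - g x) = nrm2 f - 2 * Re (ip f g) + nrm2 g.
  rewrite nrm2D //; last exact: in_L2N.
  rewrite nrm2N (_ : (fun x => - g x) = fun x => (-1) * g x); last first.
    by apply/funext => x; rewrite mulN1r.
  have := ip_sumr [:: tt] (fun=> -1) (fun=> hg) hf.
  rewrite big_seq1 rmorphN1.
  under [X in ip f X]eq_fun do rewrite big_seq1.
  by move=> ->; rewrite mulN1r ReN; ring.
rewrite ipZl //; last exact: in_L2Z.
have := ip_sumr [:: tt] (fun=> t%:C) (fun=> hg) hf.
rewrite big_seq1 conjCr; under [X in ip f X]eq_fun do rewrite big_seq1.
by move=> ->; rewrite !ReImE /=; ring.
Qed.

(** The choice t = 1/B gives the bound; for B = 0 and s nonzero, t = (A + 1) / (2 s) would make the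
    expression equal to -1. *)
Lemma quadratic_discriminant (A B s : R) : 0 <= B -> 0 <= s ->
  (forall t : R, 0 <= A - 2 * t * s + t ^+ 2 * s * B) -> s <= A * B.
Proof.
move=> B0 s0 h; have [B1|B1] := eqVneq B 0.
  have [sn|sn] := eqVneq s 0; first by rewrite sn B1 mulr0.
  have := h ((A + 1) / (2 * s)).
  have -> : 2 * ((A + 1) / (2 * s)) * s = A + 1 by field.
  rewrite B1 mulr0 addr0; lra.
have := h B^-1.
have -> : B^-1 ^+ 2 * s * B = B^-1 * s by field.
have Bp : 0 < B by rewrite lt_neqAle eq_sym B1.
rewrite -(ler_pM2r Bp) mul0r.
have -> : (A - 2 * B^-1 * s + B^-1 * s) * B = A * B - s by field.
by rewrite subr_ge0.
Qed.

Lemma ip_CS f g : in_L2 f -> in_L2 g -> sqmod (ip f g) <= nrm2 f * nrm2 g.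
Proof.
move=> hf hg; apply: quadratic_discriminant => [||t]; first exact: nrm2_ge0.
  exact: sqmod_ge0.
have := nrm2_ge0 (fun x => f x + ((- t)%:C * ip f g) * g x).
rewrite (nrm2D hf (in_L2Z _ hg)) nrm2Z // !sqmodM sqmodr sqrrN.
have := ip_sumr [:: tt] (fun=> (- t)%:C * ip f g) (fun=> hg) hf.
rewrite big_seq1; under [X in ip f X]eq_fun do rewrite big_seq1.
have cz : ((- t)%:C * ip f g)^* = (- t)%:C * (ip f g)^*.
  by rewrite rmorphM; congr (_ * _); exact: conjCr.
move=> ->; rewrite cz.
have -> : (- t)%:C * (ip f g)^* * ip f g = (- t)%:C * (sqmod (ip f g))%:C.
  by rewrite -mulcJ; ring.
by rewrite !ReImE /=; move: (sqmod (ip f g)) (nrm2 f) (nrm2 g) => s p q; lra.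
Qed.

(** What remains of [f] after subtracting its components along the [e i] has nonnegative norm. *)
Lemma bessel n (e : nat -> T -> R[i]) f : (forall i, in_L2 (e i)) ->
  (forall i j, ip (e i) (e j) = (i == j)%:R) -> in_L2 f ->
  \sum_(i < n) sqmod (ip f (e i)) <= nrm2 f.
Proof.
move=> he oe hf.
pose c (i : 'I_n) := ip f (e i).
pose g x := \sum_(i < n) (- c i) * e i x.
have hg : in_L2 g by apply: in_L2_sum => i; exact: in_L2Z.
have := nrm2_ge0 (fun x => f x + g x); rewrite nrm2D //.
have e1 : ip f g = - (\sum_(i < n) sqmod (c i))%:C.
  rewrite ip_sumr // sqmod_real_sum -sumrN; apply: eq_bigr => i _.
  by rewrite rmorphN mulNr mulrC -mulcJ.
have e2 : (nrm2 g)%:C = (\sum_(i < n) sqmod (c i))%:C :> R[i].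
  rewrite -ip_self ip_suml // sqmod_real_sum; apply: eq_bigr => i _.
  rewrite ip_sumr // (bigD1 i) //= oe eqxx mulr1 big1 ?addr0.
    by rewrite rmorphN mulrNN mulcJ.
  by move=> j ji; rewrite oe eq_sym val_eqE (negbTE ji) mulr0.
move: e2 => [->]; rewrite e1 ReN /=; lra.
Qed.

(** The difference of the inner products splits into three terms, each with a factor tending to 0 in
    norm, and Cauchy-Schwarz bounds them. *)
Lemma ip_cvg (f : nat -> T -> R[i]) g (u : nat -> T -> R[i]) v :
  (forall n, in_L2 (f n)) -> in_L2 g -> (forall n, in_L2 (u n)) -> in_L2 v ->
  (fun n => nrm2 (fun x => f n x - g x)) @ \oo --> 0 ->
  (fun n => nrm2 (fun x => u n x - v x)) @ \oo --> 0 ->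
  cvgC (fun n => ip (f n) (u n)) (ip g v).
Proof.
move=> hf hg hu hv cf cu.
have c1 : cvgC (fun n => ip (fun x => f n x - g x) (fun x => u n x - v x)) 0.
  apply: cvgC_sqmod; apply: (squeeze_cvgr _ (cvg_cst 0)); last first.
    by rewrite -(mulr0 (0 : R)); exact: cvgM cf cu.
  near=> n; rewrite subr0 sqmod_ge0 /=; apply: ip_CS; exact: in_L2B.
have c2 : cvgC (fun n => ip (fun x => f n x - g x) v) 0.
  apply: cvgC_sqmod; apply: (squeeze_cvgr _ (cvg_cst 0)); last first.
    by rewrite -(mul0r (nrm2 v)); apply: cvgM cf _; exact: cvg_cst.
  near=> n; rewrite subr0 sqmod_ge0 /=; apply: ip_CS => //; exact: in_L2B.
have c3 : cvgC (fun n => ip g (fun x => u n x - v x)) 0.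
  apply: cvgC_sqmod; apply: (squeeze_cvgr _ (cvg_cst 0)); last first.
    by rewrite -(mulr0 (nrm2 g)); apply: cvgM cu; exact: cvg_cst.
  near=> n; rewrite subr0 sqmod_ge0 /=; apply: ip_CS => //; exact: in_L2B.
have c4 := cvgCD (cvgCD (cvgCD c1 c2) c3) (cvgC_cst (ip g v)).
rewrite !add0r in c4.
suff -> : (fun n => ip (f n) (u n)) = (fun n =>
   ip (fun x => f n x - g x) (fun x => u n x - v x) +
   ip (fun x => f n x - g x) v + ip g (fun x => u n x - v x) + ip g v) by [].
apply/funext => n.
have ipBr a b c : in_L2 a -> in_L2 b -> in_L2 c ->
    ip a (fun x => b x - c x) = ip a b - ip a c.
  move=> ha hb hc; rewrite (ipJ (in_L2B hb hc) ha) ipBl // rmorphB /=.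
  by rewrite -!ipJ.
rewrite !ipBr //; [|exact: in_L2B].
rewrite !ipBl //; ring.
Unshelve. all: by end_near. Qed.

End ComplexL2.

(** * Completeness of L_2 and minimization over convex sets *)

Section RieszFischer.
Context {R : realType} {d : measure_display} {T : measurableType d}.
Variables (mu : {measure set T -> \bar R}) (D : set T).
Hypothesis mD : measurable D.
Implicit Types (f g h : T -> R[i]).

Lemma cmeasurable_patch (E : set T) f : measurable E -> cmeasurable D f ->
  cmeasurable D (fun x => (\1_E x)%:C * f x).
Proof.
move=> mE mf; apply: cmeasurableM => //; split; last exact: measurable_cst.
exact: measurable_indic.
Qed.

Lemma nrm2_cvg (f : nat -> T -> R[i]) g : (forall n, in_L2 mu D (f n)) ->
  in_L2 mu D g -> (fun n => nrm2 mu D (fun x => f n x - g x)) @ \oo --> 0 ->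
  (fun n => nrm2 mu D (f n)) @ \oo --> nrm2 mu D g.
Proof.
move=> hf hg c; have [h _] := ip_cvg mD hf hg hf hg c c.
have e k : nrm2 mu D k = Re (ip mu D k k) by rewrite ip_self.
by rewrite e; under eq_fun do rewrite e.
Qed.

Lemma bounded_convergence (f : nat -> T -> R[i]) g (M : R) : (mu D < +oo)%E ->
  (forall n, cmeasurable D (f n)) -> (forall n x, D x -> sqmod (f n x) <= M) ->
  (forall x, D x -> cvgC (fun n => f n x) (g x)) ->
  [/\ forall n, in_L2 mu D (f n), in_L2 mu D g &
      (fun n => nrm2 mu D (fun x => f n x - g x)) @ \oo --> 0].
Proof.
move=> muD mf fM fg.
have icst (c : R) : mu.-integrable D (EFin \o (fun=> c)).
  apply/integrableP; split; first exact: measurable_cst.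
  under eq_integral do rewrite /=.
  by rewrite integral_cst //= lte_mul_pinfty.
have mg := cmeasurable_lim mf fg.
have gM x : D x -> sqmod (g x) <= M.
  move=> Dx; have h := cvg_sqmod (fg x Dx).
  rewrite -(cvg_lim _ h) //; apply: limr_le; first exact: (cvgP _ h).
  by near=> n; exact: fM.
have h1 n := in_L2_le mD (mf n) (icst M) (fM n).
have h2 := in_L2_le mD mg (icst M) gM.
split => //.
have hfg n := in_L2B mD (h1 n) h2.
have a1 n : measurable_fun D (fun x => (sqmod (f n x - g x))%:E).
  by apply/measurable_EFinP; apply: measurable_sqmod; exact: (hfg n).1.
have a2 : {ae mu, forall x, D x ->
    (fun n => (sqmod (f n x - g x))%:E) @ \oo --> 0%E}.
  apply: aeW => x Dx; apply/cvg_EFin; first by near=> n.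
  have := cvg_sqmod (cvgCB (fg x Dx) (cvgC_cst (g x))).
  by rewrite subrr sqmod0.
have a3 : {ae mu, forall x n, D x ->
    (`|(sqmod (f n x - g x))%:E| <= (4 * M)%:E)%E}.
  apply: aeW => x n Dx; rewrite abse_EFin lee_fin ger0_norm ?sqmod_ge0 //.
  apply: le_trans (sqmodD_le _ _) _; rewrite sqmodN.
  have := fM n x Dx; have := gM x Dx; lra.
have [_ _ dc] := dominated_convergence mD a1 (measurable_cst _) a2 (icst (4 * M)) a3.
move: dc; rewrite integral0 /=.
under eq_fun do rewrite (nrm2E mD (hfg _)).
by move/fine_cvgP => [_].
Unshelve. all: by end_near. Qed.

(** The set [E] of pointwise convergence is part of the conclusion: the optimal characteristic is
    redefined off it, where other measures may have mass. *)
Lemma riesz_fischer (f : nat -> T -> R[i]) :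
  (forall n, in_L2 mu D (f n)) ->
  (forall e, 0 < e -> exists n0, forall m n, (n0 <= m)%N -> (n0 <= n)%N ->
     nrm2 mu D (fun x => f m x - f n x) <= e) ->
  exists (g : T -> R[i]) (s : nat -> nat) (E : set T),
  [/\ {homo s : m n / (m < n)%N >-> (m < n)%N},
      [/\ measurable E, E `<=` D & mu (D `\` E) = 0%E],
      forall x, E x -> cvgC (fun k => f (s k) x) (g x),
      in_L2 mu D g &
      (fun n => nrm2 mu D (fun x => f n x - g x)) @ \oo --> 0].
Proof.
move=> hf cauchy.
(* Squared increments of order 8^-k, weighted by 4^k, have a convergent sum of integrals; where the
   weighted sum [G] is finite, the increments are of order 2^-k and hence summable. *)
have e8 k : 0 < (8%:R ^+ k.+1)^-1 :> R by rewrite invr_gt0 exprn_gt0.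
have [NN hNN] := choice (fun k => cauchy _ (e8 k)).
pose s := fix s k := if k is k'.+1 then maxn (s k').+1 (NN k) else NN 0%N.
have sS k : (s k < s k.+1)%N by rewrite /= leq_max ltnSn.
have sN k : (NN k <= s k)%N by case: k => //= k; rewrite leq_maxr.
have hs : {homo s : m n / (m < n)%N >-> (m < n)%N}.
  by apply: homo_ltn => //; exact: ltn_trans.
pose dl k x := f (s k.+1) x - f (s k) x.
have hdl k : in_L2 mu D (dl k) by exact: in_L2B.
have ndl k : nrm2 mu D (dl k) <= (8%:R ^+ k.+1)^-1.
  by apply: hNN => //; exact: leq_trans (sN k) (ltnW (sS k)).
pose G x := (\sum_(k <oo) (4%:R ^+ k * sqmod (dl k x))%:E)%E.
have w0 k x : 0 <= 4%:R ^+ k * sqmod (dl k x).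
  by rewrite mulr_ge0 ?sqmod_ge0 // exprn_ge0.
have mw k : measurable_fun D (fun x => (4%:R ^+ k * sqmod (dl k x))%:E).
  apply/measurable_EFinP; apply: measurable_funM; first exact: measurable_cst.
  by apply: measurable_sqmod; exact: (hdl k).1.
have mG : measurable_fun D G.
  apply: ge0_emeasurable_sum => // k x Dx _; by rewrite lee_fin.
have G0 x : (0 <= G x)%E by apply: nneseries_ge0 => k _ _; rewrite lee_fin.
have geo n : \sum_(0 <= k < n) (2%:R ^+ k.+1)^-1 = 1 - (2%:R ^+ n)^-1 :> R.
  elim: n => [|n ih]; first by rewrite big_geq // expr0 invr1 subrr.
  rewrite big_nat_recr //= ih exprS invfM.
  by field; rewrite expf_neq0.
have intG : (\int[mu]_(x in D) G x <= 1)%E.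
  rewrite integral_nneseries //; last by move=> k x Dx; rewrite lee_fin.
  apply: lime_le.
    by apply: is_cvg_nneseries => k _ _; apply: integral_ge0 => x _; rewrite lee_fin.
  near=> n.
  apply: (@le_trans _ _ (\sum_(0 <= k < n) ((2%:R ^+ k.+1)^-1 : R)%:E)%E).
    apply: lee_sum => k _.
    rewrite (_ : \int[mu]_(x in D) _ = (4%:R ^+ k * nrm2 mu D (dl k))%:E)%E.
      rewrite lee_fin; apply: (@le_trans _ _ (4%:R ^+ k * (8%:R ^+ k.+1)^-1)).
        by apply: ler_wpM2l; [rewrite exprn_ge0|exact: ndl].
      rewrite (_ : (8%:R : R) = 4%:R * 2%:R); last by rewrite -natrM.
      rewrite exprMn invfM mulrA [_ ^+ k.+1 in X in X * _]exprS.
      apply: ler_piMl; first by rewrite invr_ge0 exprn_ge0.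
      rewrite ler_pdivrMr ?mulr_gt0 ?exprn_gt0 // mul1r.
      by apply: ler_peMl; rewrite ?exprn_ge0 // ler1n.
    under eq_integral do rewrite EFinM.
    rewrite integralZl //; last exact: (hdl k).2.
    by rewrite (nrm2E mD (hdl k)) EFinM.
  rewrite sumEFin lee_fin.
  by rewrite geo lerBlDr lerDl invr_ge0 exprn_ge0.
have iG : mu.-integrable D G.
  apply/integrableP; split => //.
  under eq_integral do rewrite gee0_abs //.
  exact: le_lt_trans intG (ltry 1).
pose E := D `&` [set x | (G x < +oo)%E].
have mE : measurable E by exact: emeasurable_fun_infty_o.
have ED : E `<=` D by move=> x [].
have muE : mu (D `\` E) = 0%E.
  have [N [mN N0 sub]] := integrable_ae mD iG.
  apply: (subset_measure0 _ mN _ N0); first exact: measurableD.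
  move=> x [Dx nE]; apply: sub => /= h; apply: nE; split => //=.
  by have := h Dx; rewrite fin_numElt => /andP[].
have cE x : E x -> exists l, cvgC (fun k => f (s k) x) l.
  move=> [Dx Gx].
  have Gfin : G x \is a fin_num by rewrite ge0_fin_numE.
  pose C := fine (G x).
  have C0 : 0 <= C by exact: fine_ge0.
  have tC k : 4%:R ^+ k * sqmod (dl k x) <= C.
    rewrite -lee_fin fineK //.
    apply: le_trans (nneseries_lim_ge k.+1 _); last by move=> *; rewrite lee_fin.
    rewrite big_nat_recr //= leeDr // sumEFin lee_fin; exact: sumr_ge0.
  have bd k : normc (dl k x) <= Num.sqrt C * (2^-1) ^+ k.
    apply: normc_le_sqmod; first by rewrite mulr_ge0 ?sqrtr_ge0 ?exprn_ge0 ?invr_ge0.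
    rewrite exprMn sqr_sqrtr // -exprM mulnC exprM exprVn exprVn.
    rewrite ler_pdivlMr ?exprn_gt0 //.
    by rewrite mulrC (_ : (2 ^+ 2 : R) = 4%:R) ?tC // -natrX.
  have cb : cvgn (series (fun k => Num.sqrt C * (2^-1) ^+ k)).
    apply: is_cvg_geometric_series; rewrite ger0_norm ?invr_ge0 //.
    by rewrite invf_lt1 // ltr1n.
  have cs := csummable_cvg (csummable_le cb bd).
  exists (f (s 0%N) x + csum (fun k => dl k x)).
  suff -> : (fun k => f (s k) x) =
      (fun n => f (s 0%N) x + \sum_(k < n) dl k x).
    by apply: cvgCD => //; exact: cvgC_cst.
  apply/funext => n; elim: n => [|n ih]; first by rewrite big_ord0 addr0.
  by rewrite big_ord_recr /= addrA -ih /dl addrC subrK.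
have ex x : exists l, E x -> cvgC (fun k => f (s k) x) l.
  have [Ex|Ex] := pselect (E x); last by exists 0.
  by have [l hl] := cE x Ex; exists l.
have [l hl] := choice ex.
pose g x := (\1_E x)%:C * l x.
have gE x : E x -> g x = l x.
  by move=> Ex; rewrite /g indicE mem_set // mul1r.
have g0 x : ~ E x -> g x = 0.
  by move=> Ex; rewrite /g indicE memNset // mul0r.
have mg : cmeasurable D g.
  apply: (@cmeasurable_lim _ _ _ D (fun n x => (\1_E x)%:C * f (s n) x)).
    by move=> n; apply: cmeasurable_patch => //; exact: (hf _).1.
  move=> x Dx; have [Ex|Ex] := pselect (E x).
    by apply: cvgCM; [exact: cvgC_cst|exact: hl].
  rewrite /g indicE memNset // mul0r.
  by under [X in cvgC X]eq_fun do rewrite mul0r; exact: cvgC_cst.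
(* Fatou's lemma along the subsequence turns the Cauchy bound into a bound on the distance to the
   limit; the null set off [E] is discarded first. *)
have key (e : R) n : (exists n0, forall k, (n0 <= k)%N ->
    nrm2 mu D (fun x => f n x - f k x) <= e) ->
    (\int[mu]_(x in D) (sqmod (f n x - g x))%:E <= e%:E)%E.
  move=> [n0 hn0].
  have mfg : cmeasurable D (fun x => f n x - g x).
    by apply: cmeasurableB => //; exact: (hf n).1.
  rewrite (@ge0_negligible_integral _ _ _ mu D (D `\` E)) //; last first.
  - by move=> x _; rewrite lee_fin sqmod_ge0.
  - by apply/measurable_EFinP; exact: measurable_sqmod.
  - exact: measurableD.
  rewrite setDD setIidr //.
  have -> : (\int[mu]_(x in E) (sqmod (f n x - g x))%:E)%E =
      (\int[mu]_(x in E) limn_einf (fun k => (sqmod (f n x - f (s k) x))%:E))%E.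
    apply: eq_integral => x; rewrite inE => Ex.
    have c : (fun k => (sqmod (f n x - f (s k) x))%:E) @ \oo -->
        (sqmod (f n x - g x))%:E.
      apply/cvg_EFin; first by near=> k.
      apply: cvg_sqmod; apply: cvgCB; first exact: cvgC_cst.
      by rewrite gE //; exact: hl.
    by rewrite (cvg_limn_einf_sup c).1.
  have hk k : in_L2 mu D (fun x => f n x - f (s k) x) by exact: in_L2B.
  apply: le_trans (fatou _ mE _ _) _.
  - move=> k; apply: (measurable_funS mD ED); apply/measurable_EFinP.
    by apply: measurable_sqmod; exact: (hk k).1.
  - by move=> k x _; rewrite lee_fin sqmod_ge0.
  rewrite limn_einf_lim; apply: lime_le; first exact: is_cvg_einfs.
  near=> k.
  apply: (@le_trans _ _ (\int[mu]_(x in E) (sqmod (f n x - f (s k) x))%:E)%E).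
    by apply: ereal_inf_lbound; exists k => //=.
  apply: (@le_trans _ _ (\int[mu]_(x in D) (sqmod (f n x - f (s k) x))%:E)%E).
    apply: ge0_subset_integral => //.
      by apply/measurable_EFinP; apply: measurable_sqmod; exact: (hk k).1.
    by move=> x _; rewrite lee_fin sqmod_ge0.
  rewrite (nrm2E mD (hk k)) lee_fin; apply: hn0.
  apply: leq_trans (subseq_geq hs k); near: k; exact: nbhs_infty_ge.
have hg : in_L2 mu D g.
  have [n0 hn0] := cauchy 1 ltr01.
  have h : in_L2 mu D (fun x => f n0 x - g x).
    apply/in_L2P; split; first by apply: cmeasurableB => //; exact: (hf n0).1.
    apply: le_lt_trans (key 1 n0 _) (ltry 1).
    by exists n0 => k hk; exact: hn0.
  have := in_L2B mD (hf n0) h.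
  by under [X in in_L2 mu D X -> _]eq_fun do rewrite opprB addrC subrK.
exists g, s, E; split => //; first by move=> x Ex; rewrite gE //; exact: hl.
apply/cvgrPdist_le => e e0.
have [n0 hn0] := cauchy e e0.
exists n0 => // n /= nn.
rewrite sub0r normrN ger0_norm ?nrm2_ge0 //.
rewrite -lee_fin -(nrm2E mD (in_L2B mD (hf n) hg)); apply: key.
by exists n0 => k hk; exact: hn0.
Unshelve. all: by end_near. Qed.

(** The infima over the shrinking sets increase and are bounded by [K], hence converge; the
    parallelogram identity then makes almost minimal elements a Cauchy sequence in norm. *)
Lemma convex_minimizers (C : nat -> (T -> R[i]) -> Prop) (K : R) :
  (forall n f, C n f -> in_L2 mu D f) ->
  (forall n m f, (n <= m)%N -> C m f -> C n f) ->
  (forall n f g, C n f -> C n g ->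
     C n (fun x => (1 - 2^-1 : R)%:C * f x + (2^-1 : R)%:C * g x)) ->
  (forall n, exists f, C n f /\ nrm2 mu D f <= K) ->
  exists p : nat -> T -> R[i], [/\ forall n, C n (p n),
    forall n f, C n f -> nrm2 mu D (p n) <= nrm2 mu D f + n.+1%:R^-1 &
    forall e, 0 < e -> exists n0, forall m n, (n0 <= m)%N -> (n0 <= n)%N ->
     nrm2 mu D (fun x => p m x - p n x) <= e].
Proof.
move=> C2 Cdec Cmid CK.
pose S n := [set nrm2 mu D f | f in C n].
have lS n : has_lbound (S n) by exists 0 => _ [f _ <-]; exact: nrm2_ge0.
have S0 n : S n !=set0 by have [f [hf _]] := CK n; exists (nrm2 mu D f), f.
pose m_ n := inf (S n).
have mle n f : C n f -> m_ n <= nrm2 mu D f.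
  by move=> hf; apply: ge_inf => //; exists f.
have mK n : m_ n <= K by have [f [hf]] := CK n; apply: le_trans; exact: mle.
have mnd : nondecreasing_seq m_.
  move=> n k nk; apply: lb_le_inf => // _ [f hf <-].
  by apply: mle; exact: Cdec hf.
have cm : cvgn m_.
  by apply: nondecreasing_is_cvgn => //; exists K => _ [n _ <-]; exact: mK.
have ex n : exists f, C n f /\ nrm2 mu D f < m_ n + n.+1%:R^-1.
  have [|_ [f hf <-] h] := @inf_adherent _ (S n) n.+1%:R^-1 _ (conj (S0 n) (lS n)).
    by rewrite invr_gt0.
  by exists f.
have [p hp] := choice ex.
exists p; split.
- by move=> n; exact: (hp n).1.
- move=> n f hf; apply: ltW; apply: lt_le_trans (hp n).2 _.
  by rewrite lerD2r; exact: mle.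
(* Both points lie in the larger set [C k], so their midpoint has norm at least the infimum
   there. *)
have gap k n : (k <= n)%N -> nrm2 mu D (fun x => p k x - p n x) <=
    2 * (k.+1%:R^-1 + n.+1%:R^-1 + (m_ n - m_ k)).
  move=> kn; have h1 := C2 _ _ (hp k).1; have h2 := C2 _ _ (hp n).1.
  have hn := Cdec _ _ _ kn (hp n).1.
  have := mle _ _ (Cmid _ _ _ (hp k).1 hn).
  rewrite nrm2_convex // => /convex_gap.
  have -> : 0 < (2^-1 : R) < 1 by rewrite invr_gt0 ltr0n /= invf_lt1 // ltr1n.
  move=> /(_ isT).
  have -> : (1 - 2^-1) / 2^-1 = 1 :> R by field.
  have := (hp k).2; have := (hp n).2.
  move: (nrm2 _ _ _) (nrm2 _ _ _) (nrm2 _ _ _) (m_ n) (m_ k) => x y z mn mk.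
  move: (k.+1%:R^-1) (n.+1%:R^-1) => u v; clear; lra.
move=> e e0.
have e8 : 0 < e / 8 by rewrite divr_gt0.
have [n1 _ h1] := near_infty_natSinv_lt (PosNum e8).
have /cvgrPdist_le/(_ _ e8)[n2 _ h2] : m_ @ \oo --> limn m_ by [].
exists (maxn n1 n2).
suff main k n : (maxn n1 n2 <= k)%N -> (k <= n)%N ->
    nrm2 mu D (fun x => p k x - p n x) <= e.
  move=> m n hm hn; have [mn|/ltnW nm] := leqP m n; first exact: main.
  by rewrite nrm2BC; exact: main.
rewrite geq_max => /andP[k1 k2] kn.
apply: le_trans (gap _ _ kn) _.
have a1 := h1 k k1; have a2 := h1 n (leq_trans k1 kn).
have := h2 k k2; have := h2 n (leq_trans k2 kn).
rewrite /= !ler_norml => /andP[b1 b2] /andP[b3 b4]; rewrite /= in a1 a2.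
move: a1 a2 b1 b2 b3 b4; move: (limn m_) (m_ n) (m_ k) (k.+1%:R^-1) (n.+1%:R^-1).
by clear -e; move=> l mn mk u v; lra.
Qed.

(** [convex_minimizers] is applied to the constant family of the translates A - f. As [S] need not
    be closed, the minimizer is a limit of its elements. *)
Lemma projection_attained (A : T -> R[i]) (S : (T -> R[i]) -> Prop) :
  in_L2 mu D A -> (forall f, S f -> in_L2 mu D f) -> (exists f, S f) ->
  (forall f g, S f -> S g ->
     S (fun x => (1 - 2^-1 : R)%:C * f x + (2^-1 : R)%:C * g x)) ->
  exists h, [/\ in_L2 mu D h,
    exists q : nat -> T -> R[i], (forall n, S (q n)) /\
      (fun n => nrm2 mu D (fun x => h x - q n x)) @ \oo --> 0 &
    forall f, S f -> nrm2 mu D (fun x => A x - h x) <= nrm2 mu D (fun x => A x - f x)].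
Proof.
move=> hA S2 [f0 hf0] Smid.
pose C (n : nat) h := exists2 f, S f & h = (fun x => A x - f x).
have [||||p [pC pmin pC']] := @convex_minimizers C
  (nrm2 mu D (fun x => A x - f0 x)).
- by move=> n _ [f /S2 hf ->]; exact: in_L2B.
- by [].
- move=> n _ _ [f hf ->] [g hg ->]; eexists; first exact: Smid hf hg.
  have e1 : (1 - 2^-1 : R)%:C + (2^-1 : R)%:C = 1 :> R[i].
    by rewrite -(rmorphD (real_complex R)) subrK.
  apply/funext => x; rewrite -[in RHS](mul1r (A x)) -e1; ring.
- by move=> n; exists (fun x => A x - f0 x); split => //; exists f0.
have p2 n : in_L2 mu D (p n) by have [f /S2 hf ->] := pC n; exact: in_L2B.
have [g [_ [_ [_ _ _ hg cg]]]] := riesz_fischer p2 pC'.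
have [q hq] := choice (fun n => let: ex_intro2 f hf e := pC n in
   ex_intro (fun f => S f /\ p n = fun x => A x - f x) f (conj hf e)).
exists (fun x => A x - g x); split; first exact: in_L2B.
  exists q; split; first by move=> n; exact: (hq n).1.
  rewrite (_ : (fun n => _) = fun n => nrm2 mu D (fun x => p n x - g x)) //.
  apply/funext => n.
  by congr nrm2; apply/funext => x; rewrite (hq n).2; ring.
move=> f hf.
have -> : (fun x => A x - (A x - g x)) = g by apply/funext => x; ring.
have c := nrm2_cvg p2 hg cg.
have c2 : (fun n => nrm2 mu D (fun x => A x - f x) + n.+1%:R^-1) @ \oo -->
    nrm2 mu D (fun x => A x - f x) + 0.
  by apply: cvgD; [exact: cvg_cst|exact: cvg_harmonic].
rewrite addr0 in c2; apply: (ler_cvg_to c c2).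
by near=> n; apply: pmin; exists f.
Unshelve. all: by end_near. Qed.

End RieszFischer.

(** * Normalized Lebesgue measure and orthonormality of the exponentials *)

Section UniformMeasure.
Context {R : realType}.

Lemma neg_pi_lt_pi : (- pi < pi :> R).
Proof. by rewrite gtrN // pi_gt0. Qed.

Definition unif : probability (measurableTypeR R) R := uniform_prob neg_pi_lt_pi.

Lemma unif_setT : fine (unif setT) = 1.
Proof. by rewrite probability_setT. Qed.

Lemma measurable_torus : measurable (torus R).
Proof. exact: measurable_itv. Qed.

Lemma unif_mean0 (g G : R -> R) : (forall x : R, is_derive x 1 G (g x)) ->
  continuous g -> (forall x, `|g x| <= 1) -> G pi = G (- pi) ->
  Rintegral unif setT g = 0.
Proof.
move=> dG cg g1 Gpi.
have mg : measurable_fun [set: measurableTypeR R] g.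
  exact: continuous_measurable_fun.
have cst_int (c : R) : unif.-integrable setT (EFin \o (fun=> c)).
  exact: finite_measure_integrable_cst.
have ig : unif.-integrable setT (EFin \o g).
  apply: le_integrable (cst_int 1) => //; first exact/measurable_EFinP.
  by move=> x _ /=; rewrite lee_fin normr1.
(* Adding 1 makes the integrand nonnegative, the form in which [integral_uniform] applies. *)
have : Rintegral unif setT (fun x => 1 + g x) = 1.
  rewrite /Rintegral integral_uniform; last 2 first.
  - by apply/measurable_EFinP; apply: measurable_funD.
  - by move=> x; rewrite lee_fin; have := g1 x; rewrite ler_norml; lra.
  rewrite (@continuous_FTC2 _ _ (fun x => x + G x)) /=.
  - rewrite Gpi; have -> : (pi + G (- pi) - (- pi + G (- pi)) = pi - - pi :> R) by ring.
    by rewrite mulVf // gt_eqF // subr_gt0 neg_pi_lt_pi.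
  - exact: neg_pi_lt_pi.
  - by apply: continuous_subspaceT => x; apply: cvgD; [exact: cvg_cst|exact: cg].
  - have dF (x : R) : derivable (fun x => x + G x) x 1 by [].
    have cF (x : R) : {for x, continuous (fun x => x + G x)}.
      exact/differentiable_continuous/derivable1_diffP.
    split => //; first exact: cvg_at_right_filter (cF _).
    exact: cvg_at_left_filter (cF _).
  - by move=> x _; rewrite derive1E derive_val.
rewrite RintegralD //.
rewrite Rintegral_cst // mul1r (_ : fine _ = 1); last exact: unif_setT.
by move=> h; apply: (addrI (1 : R)); rewrite h addr0.
Qed.

Lemma continuous_cexpi (n : int) :
  continuous (fun x : R => Re (cexpi n x)) /\
  continuous (fun x : R => Im (cexpi n x)).
Proof.
have c : continuous (fun x : R => n%:~R * x).
  by move=> x; apply: cvgM; [exact: cvg_cst|exact: cvg_id].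
split => x; apply: continuous_comp; by [exact: c|exact: continuous_cos|exact: continuous_sin].
Qed.

Lemma cmeasurable_cexpi (n : int) (D : set (measurableTypeR R)) :
  cmeasurable D (cexpi n).
Proof.
have [c1 c2] := continuous_cexpi n.
by split; apply: measurable_funTS; exact: continuous_measurable_fun.
Qed.

Lemma sin_intpi (n : int) : sin (n%:~R * pi) = 0 :> R.
Proof.
have nat_case (k : nat) : sin (k%:R * pi) = 0 :> R.
  elim: k => [|k ih]; first by rewrite mul0r sin0.
  by rewrite -natr1 mulrDl mul1r sinDpi ih oppr0.
case: n => k; first exact: nat_case.
by rewrite NegzE intrN mulNr sinN nat_case oppr0.
Qed.

Lemma is_derive_linear (c x : R) : is_derive x 1 (fun y : R => c * y) c.
Proof.
have := is_deriveZ c (is_derive_id x (1 : R)).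
by rewrite /GRing.scale /= mulr1.
Qed.

Lemma cintegral_unif_cexpi (n : int) :
  cintegral unif setT (cexpi n) = (n == 0)%:R.
Proof.
have [->|n0] := eqVneq n 0.
  rewrite (_ : cexpi 0 = fun=> 1); last by apply/funext => x; exact: cexpi0.
  apply: complex_eqP => /=; rewrite Rintegral_cst // ?mul0r //.
  by rewrite mul1r; exact: unif_setT.
have c0 : n%:~R != 0 :> R by rewrite intr_eq0.
have [c1 c2] := continuous_cexpi n.
apply: complex_eqP => /=.
  apply: (@unif_mean0 _ (fun x => n%:~R^-1 * sin (n%:~R * x))) => //.
  - move=> x.
    have := is_deriveZ n%:~R^-1 (@is_derive1_comp R (@sin R) _ x _ _
      (is_derive_sin _) (is_derive_linear n%:~R x)).
    by rewrite /GRing.scale /= [cos _ * _]mulrC mulKf.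
  - by move=> x; rewrite ler_norml cos_geN1 cos_le1.
  - by rewrite mulrN sinN sin_intpi oppr0.
apply: (@unif_mean0 _ (fun x => - n%:~R^-1 * cos (n%:~R * x))) => //.
- move=> x.
  have := is_deriveZ (- n%:~R^-1) (@is_derive1_comp R (@cos R) _ x _ _
    (is_derive_cos _) (is_derive_linear n%:~R x)).
  by rewrite /GRing.scale /= [- sin _ * _]mulrC mulNr mulKf // opprK.
- by move=> x; rewrite ler_norml sin_geN1 sin_le1.
- by rewrite mulrN cosN.
Qed.

Lemma in_L2_bounded (mu : {measure set (measurableTypeR R) -> \bar R}) D f (M : R) :
  measurable D -> (mu D < +oo)%E -> cmeasurable D f ->
  (forall x, D x -> sqmod (f x) <= M) -> in_L2 mu D f.
Proof.
move=> mD muD mf fM.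
have [h _ _] := @bounded_convergence R _ _ mu D mD (fun=> f) f M muD (fun=> mf)
  (fun=> fM) (fun x _ => cvgC_cst (f x)).
exact: h 0%N.
Qed.

Lemma in_L2_cexpi (mu : {measure set (measurableTypeR R) -> \bar R}) D (n : int) :
  measurable D -> (mu D < +oo)%E -> in_L2 mu D (cexpi n).
Proof.
move=> mD muD; apply: (@in_L2_bounded _ _ _ 1) => //.
  exact: cmeasurable_cexpi.
by move=> x _; rewrite sqmod_cexpi.
Qed.

Lemma unif_fin : (unif setT < +oo)%E.
Proof. by rewrite probability_setT ltry. Qed.

Lemma ip_unif_cexpi (n m : int) :
  ip unif setT (cexpi n) (cexpi m) = (n == m)%:R.
Proof.
rewrite /ip (_ : (fun x => _) = cexpi (n - m)).
  by rewrite cintegral_unif_cexpi subr_eq0.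
by apply/funext => x; rewrite cexpiJ -cexpiD.
Qed.

End UniformMeasure.

(** * Inner regularity of finite Borel measures on the line *)

Section InnerRegularity.
Context {R : realType}.
Variable F : {measure set (measurableTypeR R) -> \bar R}.
Hypothesis F_fin : (F setT < +oo)%E.

Let F_le (A : set (measurableTypeR R)) : measurable A -> (F A < +oo)%E.
Proof.
by move=> mA; apply: le_lt_trans F_fin; apply: le_measure => //; rewrite inE.
Qed.

Lemma decreasing_measure_small (A : nat -> set (measurableTypeR R)) (e : R) :
  (forall n, measurable (A n)) -> nonincreasing_seq A -> (\bigcap_n A n = set0) ->
  0 < e -> exists n, (F (A n) < e%:E)%E.
Proof.
move=> mA dA A0 e0.
have c := @nonincreasing_cvg_mu _ _ _ F A (F_le (mA 0%N)) mA.
rewrite A0 measure0 in c; have {}c := c measurable0 dA.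
move/fine_cvgP : c => [_ /cvgrPdist_lt/(_ e e0)[n _ hn]].
exists n; have := hn n (leqnn n); rewrite /= sub0r normrN.
have fA : F (A n) \is a fin_num by rewrite ge0_fin_numE // F_le.
by rewrite -[in X in _ -> X](fineK fA) lte_fin; apply: le_lt_trans; exact: ler_norm.
Qed.

(** Closed inner and open outer approximation are required together because passing to complements
    exchanges them. *)
Definition regular_set (A : set (measurableTypeR R)) : Prop :=
  measurable A /\ forall e : R, 0 < e -> exists C U : set R,
    [/\ closed C, open U, C `<=` A, A `<=` U & (F (U `\` C) < e%:E)%E].

Let mopen (U : set R) : open U -> measurable (U : set (measurableTypeR R)).
Proof. exact: open_measurable. Qed.

Let mclosed (C : set R) : closed C -> measurable (C : set (measurableTypeR R)).
Proof. exact: closed_measurable. Qed.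

Lemma regular_setC A : regular_set A -> regular_set (~` A).
Proof.
move=> [mA h]; split; first exact: measurableC.
move=> e /h[C [U [cC oU CA AU FUC]]]; exists (~` U), (~` C); split.
- exact: open_closedC.
- exact: closed_openC.
- exact: subsetC.
- exact: subsetC.
- by rewrite setDE setCK setIC -setDE.
Qed.

Lemma regular_bigcup (A : nat -> set (measurableTypeR R)) :
  (forall n, regular_set (A n)) -> regular_set (\bigcup_n A n).
Proof.
move=> h; split; first by apply: bigcupT_measurable => n; exact: (h n).1.
move=> e e0.
have e2 : 0 < e / 2 by rewrite divr_gt0.
have ee n : 0 < (e / 2) / (2 ^ n.+1)%:R :> R.
  by rewrite divr_gt0 // ltr0n expn_gt0.
have [C hC] := choice (fun n => (h n).2 _ (ee n)).
have [U hU] := choice hC.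
pose Cn n := \big[setU/set0]_(k < n) C k.
have cCn n : closed (Cn n).
  rewrite /Cn; elim: n => [|n ih]; first by rewrite big_ord0; exact: closed0.
  by rewrite big_ord_recr /=; apply: closedU => //; have [] := hU n.
have oU : open (\bigcup_n U n).
  by apply: bigcup_open => n _; have [] := hU n.
(* A countable union of closed sets need not be closed, so only finitely many are kept. [W n] is
   what this loses beyond the sets [U k] minus [C k]; it decreases to the empty set. *)
pose W n := (\bigcup_k U k) `\` Cn n `\` \bigcup_k (U k `\` C k).
have mUC k : measurable ((U k `\` C k) : set (measurableTypeR R)).
  have [cC oUk _ _ _] := hU k.
  by apply: measurableD; [exact: mopen|exact: mclosed].
have [n hn] : exists n, (F (W n) < (e / 2)%:E)%E.
  apply: decreasing_measure_small => //.
  - move=> n; apply: measurableD; last exact: bigcupT_measurable.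
    by apply: measurableD; [exact: mopen|exact: mclosed].
  - apply/nonincreasing_seqP => n; apply/subsetPset => x [[Ux nC] nUC].
    by split => //; split => // Cx; apply: nC; rewrite /Cn big_ord_recr /=; left.
  - apply/seteqP; split => // x hx.
    have [[[k _ Ukx] _] nUC] := hx 0%N I.
    have Ckx : C k x by apply: contrapT => nC; apply: nUC; exists k.
    have [[_ nC] _] := hx k.+1 I.
    by apply: nC; rewrite /Cn big_ord_recr /=; right.
exists (Cn n), (\bigcup_k U k); split => //.
- move=> x; rewrite /Cn -bigcup_mkord => -[k _ Ckx]; exists k => //.
  by have [_ _ + _ _] := hU k; apply.
- move=> x [k _ Akx]; exists k => //; by have [_ _ _ + _] := hU k; apply.
have mB : measurable (\bigcup_k (U k `\` C k) : set (measurableTypeR R)).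
  exact: bigcupT_measurable.
have mWn : measurable (W n).
  apply: measurableD => //.
  by apply: measurableD; [exact: mopen|exact: mclosed].
apply: (@le_lt_trans _ _ (F (W n) + F (\bigcup_k (U k `\` C k)))%E).
  rewrite -measureU //.
    apply: le_measure; rewrite ?inE.
    - by apply: measurableD; [exact: mopen|exact: mclosed].
    - exact: measurableU.
    move=> x [Ux nC].
    by have [hx|hx] := pselect ((\bigcup_k (U k `\` C k)) x); [right|left].
  by rewrite /W setDKI.
have Ble : (F (\bigcup_k (U k `\` C k)) <= (e / 2)%:E)%E.
  apply: le_trans (measure_sigma_subadditive _ mUC mB (@subset_refl _ _)) _.
  apply: le_trans (epsilon_trick0 xpredT (ltW e2)).
  by apply: lee_nneseries => k _ //; have [_ _ _ _ /ltW] := hU k.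
rewrite [e]splitr EFinD; apply: lte_leD => //.
by rewrite ge0_fin_numE //; exact: le_lt_trans Ble (ltry _).
Qed.

Lemma regular_ray (x : R) : regular_set `[x, +oo[%classic.
Proof.
split; first exact: measurable_itv.
move=> e e0.
pose J n : set R := `]x - n.+1%:R^-1, x[%classic.
have JE n y : J n y = (x - n.+1%:R^-1 < y < x) :> Prop by rewrite /J /= in_itv.
have [n hn] : exists n, (F (J n) < e%:E)%E.
  apply: decreasing_measure_small => //.
  - by move=> n; exact: measurable_itv.
  - apply/nonincreasing_seqP => n; apply/subsetPset => y; rewrite !JE.
    move=> /andP[h1 ->]; rewrite andbT.
    by apply: lt_trans h1; rewrite ltrD2l ltrN2 ltf_pV2 ?posrE // ltr_nat.
  - apply/seteqP; split => // y hy.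
    have yx : y < x by have := hy 0%N I; rewrite JE => /andP[].
    have xy : 0 < x - y by rewrite subr_gt0.
    have [m _ hm] := near_infty_natSinv_lt (PosNum xy).
    have := hm m (leqnn m); have := hy m I; rewrite JE /= => /andP[+ _].
    by rewrite ltrBlDr -ltrBlDl => h1 /(lt_trans h1); rewrite ltxx.
exists `[x, +oo[%classic, `]x - n.+1%:R^-1, +oo[%classic; split => //.
- exact: rray_closed.
- move=> y /=; rewrite !in_itv /= !andbT => xy.
  by apply: lt_le_trans xy; rewrite gtrBl invr_gt0.
- rewrite (_ : _ `\` _ = J n) //.
  apply/seteqP; split => y; rewrite JE /= !in_itv /= !andbT.
    by move=> [-> /negP]; rewrite -ltNge.
  by move=> /andP[-> xy]; split => //; apply/negP; rewrite -ltNge.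
Qed.

(** The regular sets form a sigma-algebra containing the closed rays, which generate the Borel
    sets. *)
Lemma regular_borel (A : set (measurableTypeR R)) : measurable A -> regular_set A.
Proof.
have h : (@RGenCInfty.G R).-sigma.-measurable `<=` regular_set.
  apply: smallest_sub; last by move=> _ [x ->]; exact: regular_ray.
  split.
  - split => // e e0; exists set0, set0; rewrite setDv measure0.
    by split => //; first [exact: closed0|exact: open0].
  - by move=> B hB; rewrite setTD; exact: regular_setC.
  - exact: regular_bigcup.
move=> mA; apply: h.
by rewrite -(RGenCInfty.measurableE R).
Qed.

Lemma inner_regular (A : set (measurableTypeR R)) (e : R) :
  measurable A -> 0 < e ->
  exists C : set R, [/\ closed C, C `<=` A & (F (A `\` C) < e%:E)%E].
Proof.
move=> mA e0; have [_ /(_ e e0)[C [U [cC oU CA AU h]]]] := regular_borel mA.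
exists C; split => //; apply: le_lt_trans h; apply: le_measure; rewrite ?inE.
- by apply: measurableD => //; exact: mclosed.
- by apply: measurableD; [exact: mopen|exact: mclosed].
- exact: setSD.
Qed.

End InnerRegularity.

(** * Economical covers of compact null sets *)

Section NullCover.
Context {R : realType}.

Lemma compact_null_cover (K : set R) (eta : R) :
  compact K -> lebesgue_measure K = 0%E -> 0 < eta ->
  exists s : seq (R * R), [/\
    forall p, p \in s -> K p.1 /\ 0 < p.2 <= 1,
    forall x, K x -> exists2 p, p \in s & `|x - p.1| <= p.2 &
    \sum_(p <- s) p.2 <= eta].
Proof.
move=> cK K0 eta0.
have clK : closed K by apply: compact_closed => //; exact: Rhausdorff.
have mK : measurable (K : set (measurableTypeR R)) by exact: closed_measurable.
have [U [oU KU mUK]] : exists U : set R, [/\ open U, K `<=` U &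
    (lebesgue_measure (U `\` K) < (eta / 2)%:E)%E].
  apply: lebesgue_regularity_outer => //; last by rewrite divr_gt0.
  by apply: le_lt_trans (ltry (0 : R)); rewrite le_eqVlt; apply/orP; left; apply/eqP; exact: K0.
have mU : (lebesgue_measure U < (eta / 2)%:E)%E.
  have mU' : measurable (U : set (measurableTypeR R)) by exact: open_measurable.
  rewrite -(setDUK KU) setUC measureU //; last by rewrite setDKI.
  + apply: le_lt_trans mUK; rewrite -[leRHS]adde0; apply: leeD => //.
    by rewrite le_eqVlt; apply/orP; left; apply/eqP; exact: K0.
  + exact: measurableD.
(* The radii are tripled by Vitali's lemma below, and must then still be at most 1. *)
have exr x : exists r : R, 0 < r <= 3^-1 /\ (K x -> ball x r `<=` U).
  have [Kx|nK] := pselect (K x); last first.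
    by exists 3^-1; rewrite lexx invr_gt0 ltr0n; split.
  have /nbhs_ballP[r /= r0 hr] : nbhs x U.
    by apply: open_nbhs_nbhs; split => //; exact: KU.
  exists (Num.min r 3^-1); rewrite lt_min r0 invr_gt0 /= ge_min lexx orbT ltr0n.
  split => // _; apply: subset_trans hr; apply: le_ball.
  by rewrite ge_min lexx.
have [r hr] := choice exr.
have r0 x : 0 < r x by have [/andP[]] := hr x.
pose B x := ball x (r x).
move: cK; rewrite compact_cover => /(_ R K B) [].
- by move=> x _; exact: ball_open.
- by move=> x Kx; exists x => //; exact: ballxx.
move=> D' D'K KD'.
(* The selected balls are disjoint and lie in [U], so their lengths 2 r add up to less than eta / 2,
   while the tripled balls cover [K]; hence the sum of the 3 r is below (3/2)(eta/2). *)
have [D [uD DD' tD cD]] := vitali_lemma_finite_cover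
  (fun x => is_ball_ball x (r x))
  (fun x => ex_intro _ x (ballxx x (r0 x))) (finmap.enum_fset D').
have DK x : x \in D -> K x by move=> /DD' /D'K; rewrite inE.
exists [seq (x, 3 * r x) | x <- D]; split.
- move=> p /mapP[x xD ->] /=; split; first exact: DK.
  rewrite mulr_gt0 //= mulrC -ler_pdivlMr // div1r.
  by have [/andP[]] := hr x.
- move=> x /KD' /cD [y /= yD].
  rewrite /= scale_ballE // /ball /= => hx.
  exists (y, 3 * r y); first by apply/mapP; exists y.
  by rewrite distrC; exact: ltW.
rewrite big_map /=.
have e1 : (\sum_(x <- D) (r x *+ 2)%:E)%E = lebesgue_measure (\bigcup_(x in [set` D]) B x).
  rewrite measure_fin_bigcup //.
    rewrite -fsbig_seq //; apply: eq_bigr => x _.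
    by apply/esym; exact: (lebesgue_measure_ball x (ltW (r0 x))).
  exact: finite_seq.
  by move=> x _; exact: measurable_ball.
have e2 : (\sum_(x <- D) (r x *+ 2)%:E < (eta / 2)%:E)%E.
  rewrite e1; apply: le_lt_trans mU; apply: le_measure; rewrite ?inE.
  - by apply: fin_bigcup_measurable => // x _; exact: measurable_ball.
  - exact: open_measurable.
  - by move=> y [x xD]; have [_ h] := hr x; exact: h (DK x xD) y.
rewrite sumEFin lte_fin in e2.
have -> : \sum_(x <- D) 3 * r x = 3 / 2 * \sum_(x <- D) (r x *+ 2).
  by rewrite mulr_sumr; apply: eq_bigr => x _; rewrite -mulr_natr; field.
move: e2; move: (\sum_(x <- D) _) => S; lra.
Qed.

End NullCover.

(** * Uniform limits of polynomials on the circle *)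

Section UniformPolynomials.
Context {R : realType}.
Implicit Types (f g : R -> R[i]) (P : {poly R[i]}).

(** This is the disc algebra in the variable w = [cexpi (-1) x], seen through boundary values. *)
Definition unif_poly f : Prop := forall e : R, 0 < e ->
  exists P, forall x, normc (f x - P.[cexpi (-1) x]) <= e.

Lemma unif_poly_poly P : unif_poly (fun x => P.[cexpi (-1) x]).
Proof. by move=> e e0; exists P => x; rewrite subrr normc0' ltW. Qed.

Lemma unif_poly_closed f : (forall e : R, 0 < e ->
  exists g, unif_poly g /\ forall x, normc (f x - g x) <= e) -> unif_poly f.
Proof.
move=> h e e0; have e2 : 0 < e / 2 by rewrite divr_gt0.
have [g [/(_ _ e2)[P hP] hg]] := h _ e2; exists P => x.
have -> : f x - P.[cexpi (-1) x] = (f x - g x) + (g x - P.[cexpi (-1) x]) by ring.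
by apply: le_trans (le_normcD _ _) _; rewrite [e]splitr; exact: lerD.
Qed.

Lemma poly_torus_bound P : exists M : R, 0 < M /\
  forall x, normc P.[cexpi (-1) x] <= M.
Proof.
exists (1 + \sum_(i < size P) normc P`_i); split.
  by rewrite ltr_pwDl // sumr_ge0 // => i _; exact: normc_ge0.
move=> x; rewrite horner_coef; apply: le_trans (normc_sum _ _ _) _.
apply: ler_wpDl => //; apply: ler_sum => i _.
by rewrite -cexpiX normcM' normc_cexpi mulr1.
Qed.

Lemma unif_poly_bounded f : unif_poly f ->
  exists M : R, 0 < M /\ forall x, normc (f x) <= M.
Proof.
move=> /(_ 1 ltr01)[P hP]; have [M [M0 hM]] := poly_torus_bound P.
exists (1 + M); split; first by rewrite addr_gt0.
move=> x; rewrite -[f x](subrK P.[cexpi (-1) x]).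
by apply: le_trans (le_normcD _ _) _; exact: lerD.
Qed.

Lemma unif_polyD f g : unif_poly f -> unif_poly g ->
  unif_poly (fun x => f x + g x).
Proof.
move=> hf hg e e0; have e2 : 0 < e / 2 by rewrite divr_gt0.
have [P hP] := hf _ e2; have [Q hQ] := hg _ e2; exists (P + Q) => x.
rewrite hornerD opprD addrACA [e]splitr.
by apply: le_trans (le_normcD _ _) _; exact: lerD.
Qed.

Lemma unif_polyM f g : unif_poly f -> unif_poly g ->
  unif_poly (fun x => f x * g x).
Proof.
move=> hf hg e e0.
have [M [M0 hM]] := unif_poly_bounded hf.
have eM : 0 < e / 2 / M by rewrite !divr_gt0.
have [Q hQ] := hg _ eM; have [N [N0 hN]] := poly_torus_bound Q.
have eN : 0 < e / 2 / N by rewrite !divr_gt0.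
have [P hP] := hf _ eN; exists (P * Q) => x; rewrite hornerM.
set w := cexpi (-1) x.
have -> : f x * g x - P.[w] * Q.[w] = f x * (g x - Q.[w]) + (f x - P.[w]) * Q.[w].
  by ring.
apply: le_trans (le_normcD _ _) _; rewrite !normcM' [e]splitr; apply: lerD.
  rewrite -[e / 2](divfK (lt0r_neq0 M0)) mulrC.
  by apply: ler_pM; [exact: normc_ge0|exact: normc_ge0|exact: hQ|exact: hM].
rewrite -[e / 2](divfK (lt0r_neq0 N0)).
by apply: ler_pM; [exact: normc_ge0|exact: normc_ge0|exact: hP|exact: hN].
Qed.

Lemma unif_poly_cst z : unif_poly (fun=> z).
Proof. by have := unif_poly_poly z%:P; under eq_fun do rewrite hornerC. Qed.

Lemma unif_poly_w : unif_poly (cexpi (-1)).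
Proof. by have := unif_poly_poly 'X; under eq_fun do rewrite hornerX. Qed.

Lemma unif_poly_sum (I : eqType) (s : seq I) (f : I -> R -> R[i]) :
  (forall i, i \in s -> unif_poly (f i)) -> unif_poly (fun x => \sum_(i <- s) f i x).
Proof.
elim: s => [|i s ih] h.
  by under eq_fun do rewrite big_nil; exact: unif_poly_cst.
under eq_fun do rewrite big_cons; apply: unif_polyD.
  by apply: h; rewrite mem_head.
by apply: ih => k ks; apply: h; rewrite in_cons ks orbT.
Qed.

Lemma unif_polyX f n : unif_poly f -> unif_poly (fun x => f x ^+ n).
Proof.
move=> hf; elim: n => [|n ih].
  by under eq_fun do rewrite expr0; exact: unif_poly_cst.
by under eq_fun do rewrite exprS; exact: unif_polyM.
Qed.

Lemma normcX (z : R[i]) n : normc (z ^+ n) = normc z ^+ n.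
Proof.
elim: n => [|n ih]; last by rewrite !exprS normcM' ih.
by rewrite !expr0 -[1 in LHS]/((1 : R)%:C) normcr normr1.
Qed.

Lemma normcV' (z : R[i]) : normc z^-1 = (normc z)^-1.
Proof. exact: ComplexField.Normc.normcV. Qed.

Lemma normc_gt0 (z : R[i]) : 0 < normc z -> z != 0.
Proof. by apply: contraTneq => ->; rewrite normc0' ltxx. Qed.

(** The partial sums of the geometric series differ from the limit by g^n / (1 - g), which is at
    most q^n / (1 - q) uniformly. *)
Lemma unif_poly_geom g (q : R) : unif_poly g -> 0 <= q < 1 ->
  (forall x, normc (g x) <= q) -> unif_poly (fun x => (1 - g x)^-1).
Proof.
move=> hg /andP[q0 q1] gq; apply: unif_poly_closed => e e0.
have q1' : 0 < 1 - q by rewrite subr_gt0.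
have : (fun n => q ^+ n) @ \oo --> 0 by apply: cvg_expr; rewrite ger0_norm.
move=> /cvgrPdist_le/(_ _ (mulr_gt0 e0 q1'))[n _ hn].
exists (fun x => \sum_(l < n) g x ^+ l); split.
  by apply: unif_poly_sum => l _; exact: unif_polyX.
move=> x.
have n1 : 1 - q <= normc (1 - g x).
  have := le_normcD (1 - g x) (g x); rewrite subrK.
  rewrite ComplexField.Normc.normc1 => h.
  by rewrite lerBlDr; apply: le_trans h _; rewrite lerD2l.
have nz : 1 - g x != 0 by apply: normc_gt0; exact: lt_le_trans n1.
have -> : (1 - g x)^-1 - \sum_(l < n) g x ^+ l = g x ^+ n * (1 - g x)^-1.
  apply: (mulIf nz); rewrite mulrBl mulVf // mulfVK //.
  have := subrX1 (g x) n => h.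
  have -> : (\sum_(l < n) g x ^+ l) * (1 - g x) = 1 - g x ^+ n.
    by rewrite -[1 - _ ^+ n]opprB h -mulNr opprB mulrC.
  by rewrite opprB addrC subrK.
rewrite normcM' normcX normcV' ler_pdivrMr ?(lt_le_trans q1') //.
have := hn n (leqnn n); rewrite /= sub0r normrN ger0_norm ?exprn_ge0 // => h.
apply: (@le_trans _ _ (q ^+ n)).
  by apply: lerXn2r; rewrite ?nnegrE ?normc_ge0.
by apply: le_trans h _; apply: ler_wpM2l => //; exact: ltW.
Qed.

(* [(1 + G)^-1] is a geometric series in [(s - 1 - G) / s] as soon as [s] is
   large compared with the bound of [G]. *)
Lemma unif_poly_inv G : unif_poly G -> (forall x, 0 <= Re (G x)) ->
  unif_poly (fun x => (1 + G x)^-1).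
Proof.
move=> hG G0; have [M [M0 hM]] := unif_poly_bounded hG.
(* Since Re G >= 0, |s - 1 - G|^2 <= (s - 1)^2 + M^2, and this is less than s^2 exactly when M^2 < 2
   s - 1. *)
pose s : R := M ^+ 2 + 1.
have s1 : 1 <= s by rewrite /s lerDr sqr_ge0.
have s0 : 0 < s by exact: lt_le_trans s1.
have sC : s%:C != 0 :> R[i] by apply/eqP => -[] /eqP; rewrite gt_eqF.
pose g x := (s%:C)^-1 * ((s - 1)%:C + (-1) * G x).
have hg : unif_poly g.
  apply: unif_polyM; first exact: unif_poly_cst.
  apply: unif_polyD; first exact: unif_poly_cst.
  by apply: unif_polyM => //; exact: unif_poly_cst.
pose q2 := ((s - 1) ^+ 2 + M ^+ 2) / s ^+ 2.
have q20 : 0 <= q2 by rewrite divr_ge0 ?addr_ge0 ?sqr_ge0.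
have q21 : q2 < 1.
  rewrite ltr_pdivrMr ?exprn_gt0 // mul1r /s.
  have : 0 < M ^+ 2 by rewrite exprn_gt0.
  by move: (M ^+ 2) => m m0; nra.
have gq x : normc (g x) <= Num.sqrt q2.
  apply: normc_le_sqmod; first exact: sqrtr_ge0.
  rewrite sqr_sqrtr // sqmodM.
  have -> : sqmod (s%:C)^-1 = (s ^+ 2)^-1.
    by rewrite -[LHS]/(normc _ ^+ 2) normcV' normcr ger0_norm ?(ltW s0) // exprVn.
  rewrite mulrC /q2; apply: ler_wpM2r; first by rewrite invr_ge0 sqr_ge0.
  have := sqmod_le_normc (hM x); have := G0 x.
  rewrite !sqmodE !ReImE /=.
  have : 0 <= s - 1 by rewrite subr_ge0.
  move: (Re (G x)) (Im (G x)) => a b h1 h2 h3.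
  have := mulr_ge0 h1 h2; nra.
have hq : 0 <= Num.sqrt q2 < 1.
  by rewrite sqrtr_ge0 /= -sqrtr1 ltr_sqrt.
have := unif_polyM (unif_poly_cst (s%:C)^-1) (unif_poly_geom hg hq gq).
congr unif_poly; apply/funext => x.
rewrite -invfM; congr (_^-1); rewrite /g.
have -> : (s - 1)%:C = s%:C - 1 by rewrite (rmorphB (real_complex R)).
by rewrite mulrBr mulr1 mulrA mulfV // mul1r; ring.
Qed.

End UniformPolynomials.

(** * Cauchy kernels with a pole close to the circle *)

Section PoissonKernels.
Context {R : realType}.
Implicit Types (x t r : R).

Lemma lipschitz1 (f df : R -> R) : (forall x : R, is_derive x 1 f (df x)) ->
  (forall x, `|df x| <= 1) -> forall x, `|f x - f 0| <= `|x|.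
Proof.
move=> hf hd x.
have cf : continuous f.
  by move=> y; apply/differentiable_continuous/derivable1_diffP.
have [x0|x0] := leP 0 x.
  have [c _ ->] := MVT_segment x0 (fun y _ => hf y) (continuous_subspaceT cf).
  by rewrite subr0 normrM ler_piMl.
have [c _ e] := MVT_segment (ltW x0) (fun y _ => hf y) (continuous_subspaceT cf).
by rewrite distrC e sub0r normrM normrN ler_piMl.
Qed.

Lemma sqmod_1B_cexpi_le t : sqmod (1 - cexpi (-1) t) <= 2 * t ^+ 2.
Proof.
have h1 : `|cos t - 1| <= `|t|.
  rewrite -cos0; apply: (@lipschitz1 _ (fun x => - sin x)) => // x.
  by rewrite normrN ler_norml sin_geN1 sin_le1.
have h2 : `|sin t| <= `|t|.
  have := @lipschitz1 (@sin R) cos (fun x => is_derive_sin x).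
  rewrite sin0; move=> /(_ _ t); rewrite subr0; apply => x.
  by rewrite ler_norml cos_geN1 cos_le1.
rewrite sqmodE !ReImE /= mulN1r cosN sinN opprK add0r.
have sq (y : R) : `|y| <= `|t| -> y ^+ 2 <= t ^+ 2.
  by move=> h; rewrite -(real_normK (num_real y)) -(real_normK (num_real t)) ler_pXn2r ?nnegrE.
have := sq _ h1; have := sq _ h2.
have -> : (1 - cos t) ^+ 2 = (cos t - 1) ^+ 2 by ring.
lra.
Qed.

Lemma sqmod_1B_cexpi t : sqmod (1 - cexpi (-1) t) = 2 - 2 * cos t.
Proof.
rewrite sqmodE !ReImE /= mulN1r cosN sinN opprK add0r.
have := cos2Dsin2 t; lra.
Qed.

Lemma sqmod_1B_cexpi_gt0 t : `|t| < 2 * pi -> t != 0 ->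
  0 < sqmod (1 - cexpi (-1) t).
Proof.
move=> tpi t0; rewrite sqmod_1B_cexpi.
have e : 2 - 2 * cos t = 4 * sin (t / 2) ^+ 2.
  rewrite {1}[t]splitr cosD; have := cos2Dsin2 (t / 2).
  rewrite -!expr2; lra.
have s2 : sin (t / 2) ^+ 2 = sin (`|t| / 2) ^+ 2.
  by have [h|h] := leP 0 t; rewrite ?(ger0_norm h) // (ltr0_norm h) mulNr sinN sqrrN.
rewrite e s2 mulr_gt0 // exprn_gt0 // sin_gt0_pi //.
by rewrite divr_gt0 ?normr_gt0 //= ltr_pdivrMr // mulrC.
Qed.

Lemma cexpi_addr (n : int) x y : cexpi n (x + y) = cexpi n x * cexpi n y.
Proof.
apply: complex_eqP; rewrite ReImE /= mulrDr ?cosD ?sinD //.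
by rewrite addrC.
Qed.

(** In the variable w = e^{-ix} this is analytic on the closed disc, its only pole being (1 + r)
    e^{-i th}; its real part is nonnegative on the circle. *)
Definition kern r (th x : R) : R[i] :=
  (1 - (1 + r)^-1%:C * cexpi (-1) (x - th))^-1.

Lemma unif_poly_kern r th : 0 < r -> unif_poly (kern r th).
Proof.
move=> r0; have r1 : 0 < 1 + r by rewrite addr_gt0.
apply: (@unif_poly_geom _ _ (1 + r)^-1).
- have := unif_polyM (unif_poly_cst ((1 + r)^-1%:C * cexpi (-1) (- th))) unif_poly_w.
  congr unif_poly; apply/funext => x.
  by rewrite cexpi_addr; ring.
- by rewrite invr_ge0 ltW //= invf_lt1 // ltrDl.
- by move=> x; rewrite normcM' normc_cexpi mulr1 normcr ger0_norm // invr_ge0 ltW.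
Qed.

Lemma sqmodV (z : R[i]) : sqmod z^-1 = (sqmod z)^-1.
Proof. by rewrite /sqmod normcV' exprVn. Qed.

Lemma ReV (z : R[i]) : Re z^-1 = Re z / sqmod z.
Proof. by rewrite sqmodE; case: z. Qed.

(** The radial and the angular distance to the pole are separated here; [kern_near] uses both,
    [kern_far] only the second. *)
Lemma sqmod_kern_den (p : R) (v : R[i]) : sqmod v = 1 ->
  sqmod (1 - p%:C * v) = (1 - p) ^+ 2 + p * sqmod (1 - v).
Proof.
rewrite !sqmodE !ReImE /= => h; apply/eqP; rewrite -subr_eq0; apply/eqP.
transitivity ((p ^+ 2 - p) * (Re v ^+ 2 + Im v ^+ 2 - 1)); first by ring.
by rewrite h subrr mulr0.
Qed.

Lemma kern_Re_ge0 r th x : 0 < r -> 0 <= Re (kern r th x).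
Proof.
move=> r0; rewrite ReV divr_ge0 ?sqmod_ge0 //.
rewrite !ReImE /= mul0r subr0 subr_ge0.
have p1 : (1 + r)^-1 <= 1 by rewrite invf_le1 ?lerDl ?addr_gt0 // ltW.
have p0 : 0 <= (1 + r)^-1 by rewrite invr_ge0 addr_ge0 // ltW.
apply: le_trans (ler_wpM2l p0 (cos_le1 _)) _; by rewrite mulr1.
Qed.

(** The real part is a quotient with numerator at least r / 2 and denominator at most r^2 + 2 r^2,
    whence 1/6 after multiplication by [r]. *)
Lemma kern_near r th x : 0 < r <= 1 -> `|x - th| <= r ->
  6^-1 <= r * Re (kern r th x).
Proof.
move=> /andP[r0 r1] xr; have q0 : 0 < 1 + r by rewrite addr_gt0.
set p := (1 + r)^-1.
have e1 : 1 - p = r * p by rewrite /p; field; rewrite gt_eqF.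
have p0 : 0 < p by rewrite invr_gt0.
have p1 : p <= 1 by rewrite invf_le1 // lerDl ltW.
have p2 : 2^-1 <= p by rewrite lef_pV2 ?posrE //; lra.
have s1 := sqmod_1B_cexpi_le (x - th).
have xr2 : (x - th) ^+ 2 <= r ^+ 2.
  by rewrite -(real_normK (num_real (x - th))) ler_pXn2r ?nnegrE // ltW.
rewrite ReV -/p (sqmod_kern_den _ (sqmod_cexpi _ _)).
rewrite !ReImE /= mul0r subr0 -/p.
set S := sqmod _; have S0 : 0 <= S by exact: sqmod_ge0.
have D0 : 0 < (1 - p) ^+ 2 + p * S.
  apply: ltr_wpDr; first by rewrite mulr_ge0 // ltW.
  by rewrite exprn_gt0 // e1 mulr_gt0.
have D1 : (1 - p) ^+ 2 + p * S <= 3 * r ^+ 2.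
  have : (1 - p) ^+ 2 <= r ^+ 2.
    by rewrite ler_pXn2r ?nnegrE ?(ltW r0) // e1 ?mulr_ge0 ?ler_piMr // ltW.
  have : p * S <= S by exact: ler_piMl.
  move: s1 xr2; rewrite -/S; lra.
have N1 : r / 2 <= 1 - p * cos (-1%:~R * (x - th)).
  apply: (@le_trans _ _ (1 - p)); last first.
    by rewrite lerD2l lerN2 ler_piMr ?cos_le1 // ltW.
  by rewrite e1; apply: ler_wpM2l => //; exact: ltW.
rewrite mulrA ler_pdivlMr //.
have := ler_wpM2l (ltW r0) N1.
nra.
Qed.

Lemma kern_far r th x (dlt : R) : 0 < r <= 1 -> 0 < dlt ->
  dlt ^+ 2 <= sqmod (1 - cexpi (-1) (x - th)) ->
  normc (kern r th x) <= 2 / dlt.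
Proof.
move=> /andP[r0 r1] d0 hd; have q0 : 0 < 1 + r by rewrite addr_gt0.
have p2 : 2^-1 <= (1 + r)^-1 by rewrite lef_pV2 ?posrE //; lra.
apply: normc_le_sqmod; first by rewrite divr_ge0 // ltW.
rewrite sqmodV (sqmod_kern_den _ (sqmod_cexpi _ _)).
have d2 : 0 < dlt ^+ 2 by rewrite exprn_gt0.
have h : dlt ^+ 2 / 4 <= (1 - (1 + r)^-1) ^+ 2 +
    (1 + r)^-1 * sqmod (1 - cexpi (-1) (x - th)).
  have := sqr_ge0 (1 - (1 + r)^-1).
  move: p2 hd; move: ((1 + r)^-1) (sqmod _) => p S; nra.
have -> : (2 / dlt) ^+ 2 = (dlt ^+ 2 / 4)^-1.
  by field; rewrite gt_eqF.
by rewrite lef_pV2 ?posrE // ?(lt_le_trans _ h) // divr_gt0.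
Qed.

End PoissonKernels.

(** * Polynomials that tend to 0 on a compact null set and to 1 elsewhere *)

Section PeakPolynomials.
Context {R : realType}.

Lemma sum_ge_mem (I : eqType) (s : seq I) (f : I -> R) (i0 : I) :
  (forall i, i \in s -> 0 <= f i) -> i0 \in s -> f i0 <= \sum_(i <- s) f i.
Proof.
elim: s => // i s ih h; rewrite big_cons in_cons => /orP[/eqP ->|i0s].
  rewrite lerDl big_seq; apply: sumr_ge0 => k ks.
  by apply: h; rewrite in_cons ks orbT.
apply: ler_wpDl; first by apply: h; rewrite mem_head.
by apply: ih => // k ks; apply: h; rewrite in_cons ks orbT.
Qed.

(* With [G] the sum of [n.+1 * r] times the Cauchy kernels of a cover of [K] by
   intervals of radius [r], [1 / (1 + G)] is bounded by [1], is small on [K],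
   where [Re G] is at least [n.+1 / 6], and is close to [1] away from [K], since
   the radii have a small sum. *)
Lemma peak_polynomial (K : set R) (n : nat) :
  compact K -> lebesgue_measure K = 0%E ->
  exists P : {poly R[i]}, [/\
    forall x, normc P.[cexpi (-1) x] <= 2,
    forall x, K x -> normc P.[cexpi (-1) x] <= 7 / n.+1%:R &
    forall x (dlt : R), 0 < dlt ->
      (forall th, K th -> dlt ^+ 2 <= sqmod (1 - cexpi (-1) (x - th))) ->
      normc (P.[cexpi (-1) x] - 1) <= (2 / dlt + 1) / n.+1%:R].
Proof.
move=> cK K0; pose B : R := n.+1%:R.
have B0 : 0 < B by rewrite ltr0n.
have B1 : 1 <= B by rewrite ler1n.
have eta0 : 0 < (B ^+ 2)^-1 by rewrite invr_gt0 exprn_gt0.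
(* With total radius at most 1/B^2, the weights B r of the kernels add up to at most 1/B, so [G] is
   small away from [K] although it is at least B/6 on [K]. *)
have [s [hs sK ssum]] := compact_null_cover cK K0 eta0.
have hs' p : p \in s -> 0 < p.2 <= 1 by move=> /hs[].
pose G x := \sum_(p <- s) (B * p.2)%:C * kern p.2 p.1 x.
have ReG x : Re (G x) = \sum_(p <- s) B * p.2 * Re (kern p.2 p.1 x).
  rewrite /G Re_sum; apply: eq_bigr => p _; rewrite ReM; case: (kern _ _ _) => u v /=; ring.
have t0 x p : p \in s -> 0 <= B * p.2 * Re (kern p.2 p.1 x).
  move=> /hs' /andP[p0 _].
  by rewrite mulr_ge0 ?kern_Re_ge0 // mulr_ge0 // ltW.
have G0 x : 0 <= Re (G x).
  by rewrite ReG big_seq; apply: sumr_ge0 => p ps; exact: t0.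
have uG : unif_poly G.
  apply: unif_poly_sum => p /hs' /andP[p0 _].
  by apply: unif_polyM; [exact: unif_poly_cst|exact: unif_poly_kern].
have den x : 1 <= normc (1 + G x).
  apply: le_trans (normr_Re_le _); rewrite ReD /=.
  by apply: le_trans (ler_norm _); rewrite lerDl.
have nz x : 1 + G x != 0 by apply: normc_gt0; exact: lt_le_trans (den x).
have f1 x : normc (1 + G x)^-1 <= 1.
  by rewrite normcV' invf_le1 // (lt_le_trans ltr01).
have iB0 : 0 < B^-1 by rewrite invr_gt0.
have [P hP] := unif_poly_inv uG G0 iB0.
have PE x : normc P.[cexpi (-1) x] <= normc (1 + G x)^-1 + B^-1.
  have -> : P.[cexpi (-1) x] = (1 + G x)^-1 + - ((1 + G x)^-1 - P.[cexpi (-1) x]).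
    by ring.
  by apply: le_trans (le_normcD _ _) _; rewrite normcN lerD2l.
exists P; split.
- move=> x; apply: le_trans (PE x) _.
  have b1 : B^-1 <= 1 by rewrite invf_le1.
  by rewrite -[2]/(1 + 1); exact: lerD.
- move=> x /sK[p ps xp].
  apply: le_trans (PE x) _.
  (* The share 6 / B bounds the inverse of Re (1 + G) on [K]; the share 1 / B is the error of the
     polynomial approximation. *)
  have -> : 7 / n.+1%:R = 6 / B + B^-1 by rewrite -/B; field; rewrite gt_eqF.
  rewrite lerD2r normcV' -[6 / B]invrK lef_pV2 ?posrE; last 2 first.
  + exact: lt_le_trans (den x).
  + by rewrite invr_gt0 divr_gt0.
  apply: le_trans (normr_Re_le _); apply: le_trans (ler_norm _).
  rewrite ReD /= ReG; apply: ler_wpDl => //.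
  apply: le_trans (sum_ge_mem (t0 x) ps).
  rewrite -mulrA invfM invrK mulrC; apply: ler_wpM2l; first exact: ltW.
  exact: kern_near (hs' p ps) xp.
- move=> x dlt d0 hd.
  have nG : normc (G x) <= 2 / dlt / B.
    apply: le_trans (normc_sum _ _ _) _.
    apply: (@le_trans _ _ (\sum_(p <- s) B * (2 / dlt) * p.2)).
      rewrite big_seq [leRHS]big_seq; apply: ler_sum => p ps.
      have /andP[p0 p1] := hs' p ps.
      rewrite normcM' normcr ger0_norm; last by rewrite mulr_ge0 // ltW.
      rewrite mulrAC; apply: ler_wpM2r; first exact: ltW.
      apply: ler_wpM2l; first exact: ltW.
      by apply: kern_far => //; [rewrite p0|apply: hd; have [] := hs p ps].
    rewrite -mulr_sumr.
    have c0 : 0 <= B * (2 / dlt) by rewrite mulr_ge0 ?divr_ge0 // ltW.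
    apply: le_trans (ler_wpM2l c0 ssum) _.
    rewrite le_eqVlt; apply/orP; left; apply/eqP; field.
    by rewrite !gt_eqF.
  have -> : P.[cexpi (-1) x] - 1 =
      - (G x * (1 + G x)^-1) + - ((1 + G x)^-1 - P.[cexpi (-1) x]).
    have e : G x * (1 + G x)^-1 = 1 - (1 + G x)^-1.
      by apply: (mulIf (nz x)); rewrite mulfVK // mulrBl mulVf // mul1r addrAC subrr add0r.
    by rewrite e; ring.
  apply: le_trans (le_normcD _ _) _; rewrite !normcN mulrDl mul1r -/B.
  apply: lerD => //; rewrite normcM'; apply: le_trans nG.
  by apply: ler_piMr => //; exact: normc_ge0.
Qed.

Lemma peak_polynomials (K : set R) :
  compact K -> K `<=` torus R -> lebesgue_measure K = 0%E ->
  exists P : nat -> {poly R[i]}, [/\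
    forall n x, normc (P n).[cexpi (-1) x] <= 2,
    forall x, K x -> cvgC (fun n => (P n).[cexpi (-1) x]) 0 &
    forall x, torus R x -> ~ K x -> cvgC (fun n => (P n).[cexpi (-1) x]) 1].
Proof.
move=> cK KT K0.
have [P hP] := choice (fun n => peak_polynomial n cK K0).
have c0 (c : R) : (fun n => c / n.+1%:R) @ \oo --> 0.
  by rewrite -(mulr0 c); apply: cvgM; [exact: cvg_cst|exact: cvg_harmonic].
exists P; split.
- by move=> n x; have [h _ _] := hP n.
- move=> x Kx; apply: cvgC_normc.
  apply: (squeeze_cvgr _ (cvg_cst 0) (c0 7)); near=> n.
  by have [_ h _] := hP n; rewrite subr0 normc_ge0 /= h.
- move=> x Tx nKx.
  suff [dlt d0 hd] : exists2 dlt, 0 < dlt &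
      forall th, K th -> dlt ^+ 2 <= sqmod (1 - cexpi (-1) (x - th)).
    apply: cvgC_normc.
    apply: (squeeze_cvgr _ (cvg_cst 0) (c0 (2 / dlt + 1))); near=> n.
    by have [_ _ h] := hP n; rewrite normc_ge0 /=; exact: h.
  have [[k Kk]|nK] := pselect (K !=set0); last first.
    by exists 1 => // th Kth; exfalso; apply: nK; exists th.
  pose f th := sqmod (1 - cexpi (-1) (x - th)).
  have cf : continuous f.
    have -> : f = fun th => 2 - 2 * cos (x - th).
      by apply/funext => th; exact: sqmod_1B_cexpi.
    move=> th; apply: cvgB; first exact: cvg_cst.
    apply: cvgM; first exact: cvg_cst.
    apply: continuous_comp; last exact: continuous_cos.
    by apply: cvgB; [exact: cvg_cst|exact: cvg_id].
  have [c cK' hc] := compact_EVT_min (ex_intro _ k Kk) cK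
    (continuous_subspaceT cf).
  have Kc : K c by rewrite inE in cK'.
  (* The distance on the circle from a point off [K] to [K] is attained at [c]. It is positive
     because two distinct points of the half-open interval differ by less than 2 pi. *)
  have fc : 0 < f c.
    apply: sqmod_1B_cexpi_gt0; last first.
      by rewrite subr_eq0; apply/eqP => xc; apply: nKx; rewrite xc.
    have := Tx; have := KT _ Kc; rewrite /torus /= !in_itv /=.
    move=> /andP[h1 h2] /andP[h3 h4]; rewrite ltr_norml; lra.
  exists (Num.sqrt (f c)); first by rewrite sqrtr_gt0.
  move=> th Kth; rewrite sqr_sqrtr ?(ltW fc) //.
  by apply: hc; rewrite inE.
Unshelve. all: by end_near. Qed.

End PeakPolynomials.

(** * Coefficients of polynomials as Fourier coefficients *)

Section PolynomialCoefficients.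
Context {R : realType}.
Implicit Types P : {poly R[i]}.

Lemma cmeasurable_poly P (D : set (measurableTypeR R)) :
  cmeasurable D (fun x => P.[cexpi (-1) x]).
Proof.
have -> : (fun x => P.[cexpi (-1) x]) =
    fun x => \sum_(k < size P) P`_k * cexpi (- k%:Z) x.
  apply/funext => x; rewrite horner_coef; apply: eq_bigr => k _.
  by rewrite cexpiX.
apply: cmeasurable_sum => k; apply: cmeasurableM; first exact: cmeasurable_cst.
exact: cmeasurable_cexpi.
Qed.

Lemma in_L2_poly (mu : {measure set (measurableTypeR R) -> \bar R}) D P :
  measurable D -> (mu D < +oo)%E -> in_L2 mu D (fun x => P.[cexpi (-1) x]).
Proof.
move=> mD muD; have [M [_ hM]] := poly_torus_bound P.
apply: (@in_L2_bounded _ _ _ _ (M ^+ 2)) => //; first exact: cmeasurable_poly.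
by move=> x _; exact: sqmod_le_normc.
Qed.

Lemma coef_unif P (j : nat) :
  ip unif setT (fun x => P.[cexpi (-1) x]) (cexpi (- j%:Z)) = P`_j.
Proof.
have -> : (fun x => P.[cexpi (-1) x]) =
    fun x => \sum_(k < size P) P`_k * cexpi (- k%:Z) x.
  apply/funext => x; rewrite horner_coef; apply: eq_bigr => k _.
  by rewrite cexpiX.
rewrite ip_suml //; last 2 first.
- by move=> k; apply: in_L2_cexpi => //; exact: unif_fin.
- by apply: in_L2_cexpi => //; exact: unif_fin.
under eq_bigr do rewrite ip_unif_cexpi eqr_opp eqz_nat.
have [jP|jP] := ltnP j (size P); last first.
  rewrite nth_default // big1 // => k _.
  by rewrite ltn_eqF ?mulr0 // (leq_trans (ltn_ord k)).
rewrite (bigD1 (Ordinal jP)) //= eqxx mulr1 big1 ?addr0 // => k kj.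
by rewrite (_ : (k == j :> nat) = false) ?mulr0 //; exact: negbTE.
Qed.

Lemma coef_unif_le P (j : nat) :
  sqmod P`_j <= nrm2 unif setT (fun x => P.[cexpi (-1) x]).
Proof.
rewrite -coef_unif; have h := @in_L2_cexpi R unif setT (- j%:Z) measurableT unif_fin.
have := ip_CS measurableT (in_L2_poly P measurableT unif_fin) h.
suff -> : nrm2 (@unif R) setT (cexpi (- j%:Z)) = 1 by rewrite mulr1.
have := @ip_unif_cexpi R (- j%:Z) (- j%:Z).
by rewrite ip_self // eqxx => /(congr1 (@complex.Re R)).
Qed.

(** Besides [K], the point pi has to be discarded: the uniform law lives on the closed interval and
    [torus] excludes its right end. *)
Lemma unif_off_torus (K : set (measurableTypeR R)) : measurable K ->
  lebesgue_measure K = 0%E -> unif (~` (torus R `\` K)) = 0%E.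
Proof.
move=> mK K0.
have dom (A : set (measurableTypeR R)) : measurable A ->
    lebesgue_measure A = 0%E -> unif A = 0%E.
  move=> mA A0.
  have /null_content_dominatesP h := dominates_uniform_prob (@neg_pi_lt_pi R).
  exact: h.
pose A : set (measurableTypeR R) := ~` `[- pi, pi]%classic.
have mA : measurable A by apply: measurableC; exact: measurable_itv.
have A0 : unif A = 0%E.
  rewrite /unif /= /uniform_prob; apply: integral0_eq => x Ax.
  rewrite /uniform_pdf; case: ifPn => // h; exfalso; apply: Ax.
have m1 : measurable ([set pi] : set (measurableTypeR R)) by exact: measurable_set1.
apply: (@subset_measure0 _ _ _ unif _ (A `|` [set pi] `|` K)).
- by apply: measurableC; apply: measurableD => //; exact: measurable_torus.
- by apply: measurableU => //; exact: measurableU.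
- move=> x /= h; have [Kx|nK] := pselect (K x); first by right.
  left; have [xp|xp] := eqVneq x pi; first by right.
  left; rewrite /A /= in_itv /= => /andP[h1 h2]; apply: h; split => //.
  by rewrite /torus /= in_itv /= h1 lt_neqAle xp.
apply/eqP; rewrite eq_le measure_ge0 andbT.
apply: le_trans (measureU2 _ _ _) _ => //; first exact: measurableU.
rewrite [X in (_ + X)%E](_ : _ = 0%E) ?adde0; last exact: dom.
apply: le_trans (measureU2 _ _ _) _ => //.
rewrite [X in (X + _)%E](_ : _ = 0%E) ?add0e //.
rewrite [leLHS](_ : _ = 0%E) //; apply: dom => //.
exact: lebesgue_measure_set1.
Qed.

Lemma nrm2_unif_torus (K : set (measurableTypeR R)) (f : measurableTypeR R -> R[i]) :
  measurable K -> lebesgue_measure K = 0%E -> cmeasurable setT f ->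
  nrm2 unif setT f = nrm2 unif (torus R `\` K) f.
Proof.
move=> mK K0 mf; rewrite /nrm2 /Rintegral; congr fine.
have mT := @measurable_torus R.
rewrite (@ge0_negligible_integral _ _ _ unif setT (~` (torus R `\` K))) //.
- by rewrite setTD setCK.
- by apply: measurableC; exact: measurableD.
- by apply/measurable_EFinP; exact: measurable_sqmod.
- by move=> x _; rewrite lee_fin sqmod_ge0.
- exact: unif_off_torus.
Qed.

End PolynomialCoefficients.

Lemma torus_fin (R : realType) (F : {measure set (measurableTypeR R) -> \bar R}) :
  (F setT < +oo)%E -> (F (torus R) < +oo)%E.
Proof.
have mT := @measurable_torus R.
by apply: le_lt_trans; apply: le_measure; rewrite ?inE.
Qed.

(** * The closed span of the past exponentials for an arbitrary finite measure *)

Section PastSpace.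
Context {R : realType}.
Variable F : {measure set (measurableTypeR R) -> \bar R}.
Hypothesis F_fin : (F setT < +oo)%E.
Implicit Types (P Q : {poly R[i]}) (f g h : measurableTypeR R -> R[i]).

Let mT : measurable (torus R) := @measurable_torus R.

Let F_torus : (F (torus R) < +oo)%E := torus_fin F_fin.

Definition past_poly P (x : measurableTypeR R) : R[i] :=
  cexpi (-1) x * P.[cexpi (-1) x].

(** A working form of [in_L2_past], with polynomials for coefficient lists and real norms;
    [in_L2_pastP] proves the equivalence. *)
Definition past h : Prop := in_L2 F (torus R) h /\
  forall e, 0 < e -> exists P,
    nrm2 F (torus R) (fun x => h x - past_poly P x) <= e.

Lemma cexpi_succ (k : nat) (x : R) :
  cexpi (- (k.+1)%:Z) x = cexpi (-1) x * cexpi (-1) x ^+ k.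
Proof. by rewrite cexpiX exprS. Qed.

Lemma in_L2_past_poly P : in_L2 F (torus R) (past_poly P).
Proof.
rewrite (_ : past_poly P = fun x => ('X * P).[cexpi (-1) x]).
  exact: in_L2_poly.
by apply/funext => x; rewrite hornerM hornerX.
Qed.

Lemma past_inL2 h : past h -> in_L2 F (torus R) h.
Proof. by case. Qed.

Lemma past_poly_sum (N : nat) (c : nat -> R[i]) x :
  \sum_(k < N) c k * cexpi (- (k.+1)%:Z) x = past_poly (\poly_(k < N) c k) x.
Proof.
rewrite /past_poly horner_poly mulr_sumr; apply: eq_bigr => k _.
by rewrite cexpi_succ mulrCA.
Qed.

Lemma in_L2_pastP h : in_L2_past F h <-> past h.
Proof.
split=> [[mh h2 ha]|[ih ha]].
  have ih : in_L2 F (torus R) h by apply/in_L2P.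
  split => // e e0; have [N [c hc]] := ha e e0.
  exists (\poly_(k < N) c k); move: hc; rewrite /L2sq.
  under eq_integral do rewrite past_poly_sum.
  rewrite (nrm2E mT) ?lte_fin; first exact: ltW.
  exact: (in_L2B mT ih (in_L2_past_poly _)).
have [mh h2] := (in_L2P F (torus R) h).1 ih.
split => // e e0; have [P hP] := ha _ (divr_gt0 e0 (ltr0Sn R 1)).
exists (size P), (fun k => P`_k); rewrite /L2sq.
under eq_integral do rewrite past_poly_sum.
have -> : \poly_(k < size P) P`_k = P by rewrite -[RHS]coefK.
rewrite (nrm2E mT) ?lte_fin; first by lra.
exact: (in_L2B mT ih (in_L2_past_poly _)).
Qed.

Lemma past_past_poly P : past (past_poly P).
Proof.
split; first exact: in_L2_past_poly.
move=> e e0; exists P; rewrite /nrm2 (_ : (fun x => _) = fun=> 0).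
  by rewrite Rintegral_cst // mul0r ltW.
by apply/funext => x; rewrite subrr sqmod0.
Qed.

Lemma past_closed g : in_L2 F (torus R) g ->
  (forall e, 0 < e -> exists h, past h /\ nrm2 F (torus R) (fun x => g x - h x) <= e) ->
  past g.
Proof.
move=> ig gh; split => // e e0.
(* Quarters, because [nrm2D_le] doubles each of the two squared norms. *)
have e4 : 0 < e / 4 by lra.
have [h [[ih hh] gh4]] := gh _ e4; have [P hP] := hh _ e4; exists P.
rewrite (_ : (fun x => _) = fun x => (g x - h x) + (h x - past_poly P x)).
  apply: le_trans (nrm2D_le mT (in_L2B mT ig ih) (in_L2B mT ih (in_L2_past_poly P))) _.
  by lra.
by apply/funext => x; rewrite addrA subrK.
Qed.

Lemma past_cvg g (h : nat -> measurableTypeR R -> R[i]) :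
  in_L2 F (torus R) g -> (forall n, past (h n)) ->
  (fun n => nrm2 F (torus R) (fun x => h n x - g x)) @ \oo --> 0 -> past g.
Proof.
move=> ig hh c; apply: past_closed => // e e0.
have /cvgr0Pnorm_le/(_ e e0)[N _ /(_ N (leqnn N))] := c.
rewrite ger0_norm ?nrm2_ge0 // => hN; exists (h N); split => //.
by rewrite nrm2BC.
Qed.

Lemma pastD f g : past f -> past g -> past (fun x => f x + g x).
Proof.
move=> [jf hf] [ig hg]; split; first exact: in_L2D.
move=> e e0; have e4 : 0 < e / 4 by lra.
have [P hP] := hf _ e4; have [Q hQ] := hg _ e4; exists (P + Q).
rewrite (_ : (fun x => _) =
    fun x => (f x - past_poly P x) + (g x - past_poly Q x)); last first.
  by apply/funext => x; rewrite /past_poly hornerD; ring.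
apply: le_trans (nrm2D_le mT (in_L2B mT jf (in_L2_past_poly P))
  (in_L2B mT ig (in_L2_past_poly Q))) _.
by lra.
Qed.

Lemma pastZ z f : past f -> past (fun x => z * f x).
Proof.
move=> [jf hf]; split; first exact: in_L2Z.
move=> e e0; have z1 : 0 < 1 + sqmod z by rewrite ltr_wpDr ?sqmod_ge0.
have [P hP] := hf _ (divr_gt0 e0 z1); exists (z *: P).
rewrite (_ : (fun x => _) = fun x => z * (f x - past_poly P x)); last first.
  by apply/funext => x; rewrite /past_poly hornerZ; ring.
rewrite (nrm2Z mT) //; last exact: (in_L2B mT jf (in_L2_past_poly P)).
move: hP; rewrite ler_pdivlMr // => hP; apply: le_trans hP.
rewrite mulrC; apply: ler_wpM2l; first exact: nrm2_ge0.
by rewrite lerDr.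
Qed.

Lemma pastB f g : past f -> past g -> past (fun x => f x - g x).
Proof.
move=> hf /(pastZ (-1)) hg; have := pastD hf hg.
by under [X in past X -> _]eq_fun do rewrite mulN1r.
Qed.

Lemma past0 : past (fun=> 0).
Proof.
have := past_past_poly 0; rewrite (_ : past_poly 0 = fun=> 0) //.
by apply/funext => x; rewrite /past_poly horner0 mulr0.
Qed.

Lemma past_sum I (s : seq I) (z : I -> R[i]) (f : I -> measurableTypeR R -> R[i]) :
  (forall i, past (f i)) -> past (fun x => \sum_(i <- s) z i * f i x).
Proof.
move=> h; elim: s => [|i s ih].
  by under [X in past X]eq_fun do rewrite big_nil; exact: past0.
by under [X in past X]eq_fun do rewrite big_cons; apply: pastD => //; exact: pastZ.
Qed.

Lemma nrm2_bounded f (M : R) : in_L2 F (torus R) f ->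
  (forall x, torus R x -> sqmod (f x) <= M) ->
  nrm2 F (torus R) f <= M * fine (F (torus R)).
Proof.
move=> jf fM; have icst : F.-integrable (torus R) (EFin \o (fun=> M)).
  apply/integrableP; split; first exact: measurable_cst.
  by under eq_integral do rewrite /=; rewrite integral_cst //= lte_mul_pinfty.
by apply: le_trans (nrm2_le mT jf icst fM) _; rewrite Rintegral_cst.
Qed.

Section NullSet.
Variable K : set (measurableTypeR R).
Hypotheses (mK : measurable K) (K0 : lebesgue_measure K = 0%E).
Variable P : nat -> {poly R[i]}.
Hypotheses
  (P_bound : forall n x, normc (P n).[cexpi (-1) x] <= 2)
  (P_on : forall x, K x -> cvgC (fun n => (P n).[cexpi (-1) x]) 0)
  (P_off : forall x, torus R x -> ~ K x ->
     cvgC (fun n => (P n).[cexpi (-1) x]) 1).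

Lemma peak_coef_bound n j : normc (P n)`_j <= 2.
Proof.
rewrite -(ler_pXn2r (ltn0Sn 1)) ?nnegrE ?normc_ge0 //.
apply: le_trans (coef_unif_le (P n) j) _.
have icst : (@unif R).-integrable setT (EFin \o (fun=> (2 : R) ^+ 2)).
  exact: finite_measure_integrable_cst.
apply: le_trans (nrm2_le measurableT (in_L2_poly (P n) measurableT unif_fin) icst _) _.
  by move=> x _; rewrite /sqmod ler_pXn2r ?nnegrE ?normc_ge0.
by rewrite Rintegral_cst // [X in _ * X](_ : _ = 1) ?mulr1 //; exact: unif_setT.
Qed.

(** A coefficient of P n - 1 is bounded by the norm under the uniform law, which does not charge
    [K]; there P n tends boundedly to 1. *)
Lemma peak_coef_cvg j : cvgC (fun n => (P n)`_j) (j == 0%N)%:R.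
Proof.
have mD : measurable (torus R `\` K) by exact: measurableD.
have muD : (@unif R (torus R `\` K) < +oo)%E.
  by apply: le_lt_trans unif_fin; apply: le_measure; rewrite ?inE.
have [] := @bounded_convergence R _ _ unif (torus R `\` K) mD
  (fun n x => (P n - 1).[cexpi (-1) x]) (fun=> 0) (3 ^+ 2) muD.
- by move=> n; exact: cmeasurable_poly.
- move=> n x _; rewrite /sqmod ler_pXn2r ?nnegrE ?normc_ge0 //.
  rewrite hornerD hornerN hornerC; apply: le_trans (le_normcD _ _) _.
  rewrite normcN (_ : 3 = 2 + 1 :> R); last by rewrite natr1.
  by apply: lerD => //; rewrite ComplexField.Normc.normc1.
- move=> x [Tx nKx]; under [X in cvgC X]eq_fun do rewrite hornerD hornerN hornerC.
  by rewrite -(subrr 1); apply: cvgCB; [exact: P_off|exact: cvgC_cst].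
move=> _ _ c; apply: cvgC_sqmod.
apply: (squeeze_cvgr _ (cvg_cst 0) c); near=> n.
rewrite sqmod_ge0 /= -coef1 -coefB.
apply: le_trans (coef_unif_le _ j) _.
rewrite (nrm2_unif_torus mK K0); last exact: cmeasurable_poly.
by under [X in _ <= nrm2 _ _ X]eq_fun do rewrite subr0.
Unshelve. all: by end_near. Qed.

(* Almost everywhere convergence of the peak polynomials to [1] forces their
   coefficients to converge to those of [1]; cutting off the first [`|m|.+1] of
   them makes [cexpi m] times the rest a past polynomial. *)
Lemma past_indic_peak (m : int) : past (fun x => (\1_K x)%:C * cexpi m x).
Proof.
pose M := `|m|%N.
pose T n x := (take_poly M.+1 (P n)).[cexpi (-1) x].
(* The difference consists of powers of w above |m|, so after the factor [cexpi m] only negative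
   frequencies remain. Its limit is 1 - 0 on [K] and 1 - 1 elsewhere. *)
pose q n x := cexpi m x * (T n x - (P n).[cexpi (-1) x]).
have TE n x : T n x = \sum_(j < M.+1) (P n)`_j * cexpi (- j%:Z) x.
  rewrite /T /take_poly horner_poly; apply: eq_bigr => j _.
  by rewrite cexpiX.
have [k km] : exists k : nat, M%:Z - m = k%:Z.
  by exists `|M%:Z - m|%N; rewrite gez0_abs // subr_ge0 /M; lia.
have qE n : q n = past_poly (- ('X^k * drop_poly M.+1 (P n))).
  apply/funext => x; rewrite /past_poly hornerN hornerM hornerXn /q /T.
  rewrite -[X in _ - X.[_]](poly_take_drop M.+1) hornerD hornerM hornerXn.
  rewrite -!cexpiX -km.
  have -> : cexpi (- (M%:Z - m)) x = cexpi m x * cexpi (- M%:Z) x.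
    by rewrite -cexpiD; congr cexpi; ring.
  rewrite cexpi_succ -cexpiX; ring.
have [] := @bounded_convergence R _ _ F (torus R) mT q
  (fun x => (\1_K x)%:C * cexpi m x) ((2 * M.+1%:R + 2) ^+ 2) F_torus.
- move=> n; rewrite qE; exact: (in_L2_past_poly _).1.
- move=> n x _; rewrite /sqmod ler_pXn2r ?nnegrE ?normc_ge0 //.
  rewrite normcM' normc_cexpi mul1r; apply: le_trans (le_normcD _ _) _.
  rewrite normcN; apply: lerD => //; rewrite TE.
  apply: le_trans (normc_sum _ _ _) _.
  apply: le_trans (_ : \sum_(j < M.+1) (2 : R) <= _).
    by apply: ler_sum => j _; rewrite normcM' normc_cexpi mulr1 peak_coef_bound.
  by rewrite sumr_const card_ord mulr_natr.
- move=> x Tx; rewrite mulrC; apply: cvgCM; first exact: cvgC_cst.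
  (* This convergence holds at every point, also on [K], since only a fixed number of coefficients
     is involved. *)
  have cT : cvgC (fun n => T n x) 1.
    under [X in cvgC X]eq_fun do rewrite TE.
    have -> : 1 = \sum_(j < M.+1) (j == 0%N :> nat)%:R * cexpi (- j%:Z) x :> R[i].
      rewrite big_ord_recl /= mul1r cexpi0 big1 ?addr0 // => j _.
      by rewrite /= mul0r.
    apply: cvgC_sum => j; apply: cvgCM; last exact: cvgC_cst.
    exact: peak_coef_cvg.
  rewrite indicE; have [Kx|nKx] := boolP (x \in K).
    rewrite -[X in cvgC _ X](subr0 (1 : R[i])); apply: cvgCB => //.
    by apply: P_on; rewrite inE in Kx.
  rewrite -[X in cvgC _ X](subrr (1 : R[i])); apply: cvgCB => //.
  by apply: P_off => //; rewrite notin_setE in nKx.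
move=> _ i1 c; apply: (past_cvg i1 _ c) => n; rewrite qE.
exact: past_past_poly.
Qed.

End NullSet.

(** Peak polynomials require a compact set. Inner regularity for [F] supplies a closed [C] in [N],
    compact as a subset of [-pi, pi], and the error in L_2(F) is the small mass of N minus C. *)
Lemma past_indic_cexpi (N : set (measurableTypeR R)) (m : int) :
  measurable N -> N `<=` torus R -> lebesgue_measure N = 0%E ->
  past (fun x => (\1_N x)%:C * cexpi m x).
Proof.
move=> mN NT N0.
have indM (A : set (measurableTypeR R)) : measurable A ->
    in_L2 F (torus R) (fun x => (\1_A x)%:C * cexpi m x).
  move=> mA; apply: (@in_L2_bounded _ _ _ _ 1) => //.
    by apply: cmeasurable_patch => //; exact: cmeasurable_cexpi.
  move=> x _; rewrite sqmodM sqmod_cexpi mulr1 sqmodr indicE.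
  by case: (_ \in _); rewrite ?expr1n // expr0n.
apply: past_closed; first exact: indM.
move=> e e0; have [C [cC CN FC]] := inner_regular F_fin mN e0.
have mC : measurable (C : set (measurableTypeR R)) by exact: closed_measurable.
have C0 : lebesgue_measure C = 0%E.
  exact: (@subset_measure0 _ _ _ (@lebesgue_measure R) C N).
have kC : compact C.
  apply: (@subclosed_compact _ C `[- pi, pi]%classic) => //; first exact: segment_compact.
  move=> x /CN/NT; rewrite /torus /= !in_itv /= => /andP[-> h]; exact: ltW.
have [P [P1 P2 P3]] := peak_polynomials kC (subset_trans CN NT) C0.
exists (fun x => (\1_C x)%:C * cexpi m x); split.
  exact: past_indic_peak mC C0 P P1 P2 P3 m.
have mNC : measurable (N `\` C) by exact: measurableD.
have iNC : F.-integrable (torus R) (EFin \o \1_(N `\` C)).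
  apply/integrableP; split; first exact/measurable_EFinP.
  rewrite (eq_integral (fun x => (\1_(N `\` C) x)%:E)); last first.
    by move=> t _; rewrite gee0_abs // lee_fin.
  rewrite integral_indic //; apply: le_lt_trans F_fin.
  by apply: le_measure; rewrite ?inE //; exact: measurableI.
apply: le_trans (nrm2_le mT (in_L2B mT (indM _ mN) (indM _ mC)) iNC _) _.
  move=> x _; rewrite -mulrBl sqmodM sqmod_cexpi mulr1 -rmorphB /= sqmodr !indicE.
  rewrite in_setD; have [xC|xC] := boolP (x \in C); last first.
    by rewrite andbT subr0; case: (_ \in N); rewrite ?expr1n // expr0n.
  by rewrite (_ : x \in N) ?subrr ?expr0n // inE; apply: CN; rewrite inE in xC.
rewrite /Rintegral integral_indic // setIidl; last by move=> x [/NT].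
by rewrite -lee_fin fineK ?ltW // ge0_fin_numE ?measure_ge0 // (lt_trans FC) ?ltry.
Qed.

End PastSpace.

(** * The minimax spectral characteristic *)

Section OptimalCharacteristic.
Context {R : realType}.
Variable a : nat -> R[i].
Hypothesis ha1 : cvgn (series (fun j => normc (a j))).

Let mT : measurable (torus R) := @measurable_torus R.

Lemma A_spectral_cvg (x : R) :
  cvgC (fun m => \sum_(j < m) a j * cexpi j%:Z x) (A_spectral a x).
Proof.
apply: cvgC_normc; apply: (squeeze_cvgr _ (cvg_cst 0) (abs_tail_cvg0 ha1)).
near=> m; rewrite normc_ge0 /=.
have -> : \sum_(j < m) a j * cexpi j%:Z x - A_spectral a x =
    - (A_spectral a x - \sum_(j < m) a j * cexpi j%:Z x) by rewrite opprB.
by rewrite normcN; exact: A_spectral_tail.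
Unshelve. all: by end_near. Qed.

Lemma A_spectral_bound (x : R) : normc (A_spectral a x) <= abs_tail a 0.
Proof. by have := A_spectral_tail ha1 x 0; rewrite big_ord0 subr0. Qed.

Let at0 : 0 <= abs_tail a 0.
Proof. exact: abs_tail_ge0. Qed.

Lemma A_partial_bound (m : nat) (x : R) :
  normc (\sum_(j < m) a j * cexpi j%:Z x) <= abs_tail a 0 + abs_tail a 0.
Proof.
have -> : \sum_(j < m) a j * cexpi j%:Z x = A_spectral a x -
    (A_spectral a x - \sum_(j < m) a j * cexpi j%:Z x) by rewrite opprB addrC subrK.
apply: le_trans (le_normcD _ _) _; apply: lerD; first exact: A_spectral_bound.
rewrite normcN; apply: le_trans (A_spectral_tail ha1 x m) _.
rewrite /abs_tail lerD2l lerN2.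
apply: nondecreasing_series => // k _ _; exact: normc_ge0.
Qed.

Lemma cmeasurable_A_spectral (D : set (measurableTypeR R)) :
  measurable D -> cmeasurable D (A_spectral a).
Proof.
move=> mD; apply: (@cmeasurable_lim _ _ _ D (fun m x => \sum_(j < m) a j * cexpi j%:Z x)).
  move=> m; apply: cmeasurable_sum => j; apply: cmeasurableM; first exact: cmeasurable_cst.
  exact: cmeasurable_cexpi.
by move=> x _; exact: A_spectral_cvg.
Qed.

(** On a Lebesgue null set all frequencies are available from the past, and A is a bounded limit of
    trigonometric polynomials. Hence an estimate may equal A on such a set. *)
Lemma past_indic_A (F : {measure set (measurableTypeR R) -> \bar R})
  (N : set (measurableTypeR R)) : (F setT < +oo)%E ->
  measurable N -> N `<=` torus R -> lebesgue_measure N = 0%E ->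
  past F (fun x => (\1_N x)%:C * A_spectral a x).
Proof.
move=> Ff mN NT N0.
have FT := torus_fin Ff.
pose f m x := \sum_(j < m) a j * ((\1_N x)%:C * cexpi j%:Z x).
have fE m x : f m x = (\1_N x)%:C * \sum_(j < m) a j * cexpi j%:Z x.
  by rewrite /f mulr_sumr; apply: eq_bigr => j _; rewrite mulrCA.
have pf m : past F (f m).
  by apply: past_sum => // j; exact: past_indic_cexpi.
have [||_ i1 c] := @bounded_convergence R _ _ F (torus R) mT f
  (fun x => (\1_N x)%:C * A_spectral a x) ((abs_tail a 0 + abs_tail a 0) ^+ 2) FT
  (fun m => (past_inL2 (pf m)).1).
- move=> m x _; rewrite /sqmod ler_pXn2r ?nnegrE ?normc_ge0 //; last exact: addr_ge0.
  rewrite fE normcM' normcr indicE.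
  case: (_ \in _); rewrite ?normr1 ?mul1r ?A_partial_bound //.
  by rewrite normr0 mul0r; exact: addr_ge0.
- move=> x _; under [X in cvgC X]eq_fun do rewrite fE.
  by apply: cvgCM; [exact: cvgC_cst|exact: A_spectral_cvg].
exact: past_cvg i1 pf c.
Qed.

Definition lebesgue_torus : {measure set (measurableTypeR R) -> \bar R} :=
  mrestr lebesgue_measure mT.

Lemma lebesgue_torus_fin : (lebesgue_torus setT < +oo)%E.
Proof.
rewrite /lebesgue_torus /= /mrestr setTI /torus lebesgue_measure_itv /=.
by case: ifP => // _; rewrite -EFinB ltry.
Qed.

(* Least-norm elements of the shrinking sets of almost optimal past polynomials
   converge off a Lebesgue null set [N]; on [N] the choice [h0 = A] is
   harmless, also for measures charging [N]. *)
Lemma optimal_characteristic (nu : R) : 0 <= nu -> hankel_le nu a ->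
  exists h0 : measurableTypeR R -> R[i],
    (forall x, torus R x -> normc (A_spectral a x - h0 x) <= nu) /\
    forall F : {measure set (measurableTypeR R) -> \bar R},
      (F setT < +oo)%E -> past F h0.
Proof.
move=> nu0 /(nehari_approximation ha1 nu0)[eps [P0 [eps0 P0h]]].
pose F := lebesgue_torus; have Ff := lebesgue_torus_fin.
have FT := torus_fin Ff.
(* These sets are convex, decreasing in [n] and uniformly bounded, and [nehari_approximation] makes
   them nonempty. *)
pose C n h := exists Q : {poly R[i]}, h = past_poly Q /\
  forall x, normc (A_spectral a x - h x) <= nu + n.+1%:R^-1.
have Cb n h : C n h -> forall x, normc (h x) <= abs_tail a 0 + (nu + 1).
  move=> [Q [_ hQ]] x.
  have -> : h x = A_spectral a x - (A_spectral a x - h x) by rewrite opprB addrC subrK.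
  apply: le_trans (le_normcD _ _) _; apply: lerD; first exact: A_spectral_bound.
  rewrite normcN; apply: le_trans (hQ x) _; rewrite lerD2l.
  by rewrite invf_le1 // ler1n.
have b0 : 0 <= abs_tail a 0 + (nu + 1) by apply: addr_ge0 => //; exact: addr_ge0.
have CL n h : C n h -> in_L2 F (torus R) h.
  by move=> [Q [-> _]]; exact: in_L2_past_poly.
have [||| p [Cp _ pC]] := @convex_minimizers R _ _ F (torus R) mT C
  ((abs_tail a 0 + (nu + 1)) ^+ 2 * fine (F (torus R))) CL.
- move=> n m h nm [Q [hQ bQ]]; exists Q; split => // x.
  by apply: le_trans (bQ x) _; rewrite lerD2l lef_pV2 ?posrE // ler_nat.
- move=> n f g [Q [fQ hQ]] [Q' [gQ hQ']].
  exists ((1 - 2^-1 : R)%:C *: Q + (2^-1 : R)%:C *: Q'); split.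
    apply/funext => x; rewrite fQ gQ /past_poly hornerD !hornerZ; ring.
  move=> x.
  have -> : A_spectral a x - ((1 - 2^-1 : R)%:C * f x + (2^-1 : R)%:C * g x) =
      (1 - 2^-1 : R)%:C * (A_spectral a x - f x) + (2^-1 : R)%:C * (A_spectral a x - g x).
    by rewrite rmorphB rmorph1; ring.
  apply: le_trans (le_normcD _ _) _; rewrite !normcM' !normcr.
  rewrite !ger0_norm ?invr_ge0 //; last by lra.
  move: (hQ x) (hQ' x); move: (nu + _) => c; move: (normc _) (normc _) => u v; lra.
- move=> n; have /cvgr0Pnorm_le/(_ n.+1%:R^-1)[|m _ /(_ m (leqnn m)) hm] := eps0.
    by rewrite invr_gt0.
  have Cm : C n (past_poly (P0 m)).
    exists (P0 m); split => // x; apply: le_trans (P0h m x) _.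
    by rewrite lerD2l; apply: le_trans hm; exact: ler_norm.
  exists (past_poly (P0 m)); split => //.
  apply: nrm2_bounded => //; first exact: CL Cm.
  by move=> x _; rewrite /sqmod ler_pXn2r ?nnegrE ?normc_ge0 //; exact: Cb Cm x.
have [g [s [E [hs [mE ET E0] cE _ _]]]] := riesz_fischer mT (fun n => CL n _ (Cp n)) pC.
pose N := torus R `\` E.
have mN : measurable N by exact: measurableD.
have NT : N `<=` torus R by move=> x [].
have N0 : lebesgue_measure N = 0%E.
  by move: E0; rewrite /F /lebesgue_torus /= /mrestr setIidl.
exists (fun x => if x \in E then g x else A_spectral a x); split.
  move=> x Tx; have [xE|xE] := boolP (x \in E); last first.
    by rewrite subrr ComplexField.Normc.normc0.
  rewrite inE in xE.
  have h1 := cvg_normc (cvgCB (cvgC_cst (A_spectral a x)) (cE x xE)).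
  have h2 : (fun k : nat => nu + k.+1%:R^-1) @ \oo --> nu.
    by rewrite -[X in _ --> X]addr0; apply: cvgD; [exact: cvg_cst|exact: cvg_harmonic].
  apply: ler_cvg_to h1 h2 _; near=> k.
  have [Q [_ hQ]] := Cp (s k); apply: le_trans (hQ x) _.
  by rewrite lerD2l lef_pV2 ?posrE // ler_nat ltnS subseq_geq.
move=> G Gf.
have GT := torus_fin Gf.
(* The approximant is replaced by A on [N]. The result is past for the given measure [G], and
   converges at every point of the torus, so bounded convergence needs no almost everywhere
   clause. *)
pose r k x := p (s k) x - (\1_N x)%:C * p (s k) x + (\1_N x)%:C * A_spectral a x.
have pr k : past G (r k).
  have [Q [pQ _]] := Cp (s k); rewrite /r pQ; apply: pastD => //; last exact: past_indic_A.
  apply: pastB => //; first exact: past_past_poly.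
  rewrite (_ : (fun x => _) =
      fun x => \sum_(j < size Q) Q`_j * ((\1_N x)%:C * cexpi (- (j.+1)%:Z) x)).
    by apply: past_sum => // j; exact: past_indic_cexpi.
  apply/funext => x; rewrite /past_poly horner_coef !mulr_sumr.
  by apply: eq_bigr => j _; rewrite cexpi_succ; ring.
have rE k x : torus R x -> r k x = if x \in E then p (s k) x else A_spectral a x.
  move=> Tx; rewrite /r indicE /N in_setD (_ : x \in torus R) ?inE //=.
  by case: (x \in E); rewrite /= ?mul0r ?mul1r ?subr0 ?subrr ?addr0 ?add0r.
have [||_ i1 c] := @bounded_convergence R _ _ G (torus R) mT r
  (fun x => if x \in E then g x else A_spectral a x)
  ((abs_tail a 0 + (nu + 1)) ^+ 2) GT (fun m => (past_inL2 (pr m)).1).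
- move=> m x Tx; rewrite /sqmod ler_pXn2r ?nnegrE ?normc_ge0 //.
  rewrite (rE _ _ Tx); case: ifP => _; first exact: Cb (Cp _) x.
  by apply: le_trans (A_spectral_bound x) _; rewrite lerDl addr_ge0.
- move=> x Tx; under [X in cvgC X]eq_fun do rewrite (rE _ _ Tx).
  by case: ifPn => xE; [apply: cE; rewrite inE in xE|exact: cvgC_cst].
exact: past_cvg i1 pr c.
Unshelve. all: by end_near. Qed.

End OptimalCharacteristic.

(** * Error bounds for a given spectral measure *)

Section EstimationError.
Context {R : realType}.
Variable a : nat -> R[i].
Hypothesis ha1 : cvgn (series (fun j => normc (a j))).

Let mT : measurable (torus R) := @measurable_torus R.

Lemma spectral_measure_fin (xi : process R) : (spectral_measure xi setT < +oo)%E.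
Proof.
rewrite /spectral_measure; case: pselect => [ex|_]; last by rewrite ltry.
by case: (cid ex) => F [].
Qed.

(** The moment of order 0 identifies the total mass with E|xi(0)|^2; in the default case the mass is
    0. *)
Lemma spectral_measure_le (P : R) (xi : process R) : 0 <= P -> Xi P xi ->
  fine (spectral_measure xi (torus R)) <= P.
Proof.
move=> P0 [[xi2 _ _] _ xiP]; rewrite /spectral_measure.
case: pselect => [ex|_] //; case: (cid ex) => F [Ff _ Fm] /=.
have ix : in_L2 (pr_prob xi) setT (xi 0) by apply/in_L2P; exact: xi2.
have := congr1 (@complex.Re R) (Fm 0); rewrite /expect /cintegral /=.
under [X in _ = Rintegral F _ X]eq_fun do rewrite mul0r cos0.
rewrite Rintegral_cst // mul1r => <-.
have := xiP 0; rewrite /second_moment nrm2E // lee_fin; apply: le_trans.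
by rewrite le_eqVlt; apply/orP; left; apply/eqP; congr Rintegral; apply/funext => x; rewrite mulcJ.
Qed.

Lemma in_L2_A (F : {measure set (measurableTypeR R) -> \bar R}) :
  (F setT < +oo)%E -> in_L2 F (torus R) (A_spectral a).
Proof.
move=> Ff; apply: (@in_L2_bounded _ _ _ _ (abs_tail a 0 ^+ 2)) => //.
- exact: torus_fin.
- exact: cmeasurable_A_spectral.
- by move=> x _; apply: sqmod_le_normc; exact: A_spectral_bound.
Qed.

Lemma Delta_past (xi : process R) h : past (spectral_measure xi) h ->
  Delta a xi h = (nrm2 (spectral_measure xi) (torus R)
    (fun x => A_spectral a x - h x))%:E.
Proof.
have Ff := spectral_measure_fin xi.
move=> hh; rewrite /Delta asboolT; last exact/in_L2_pastP.
rewrite /L2sq (nrm2E mT) //; apply: (in_L2B mT (in_L2_A Ff)); exact: past_inL2 hh.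
Qed.

Lemma Delta_not_past (xi : process R) h : ~ past (spectral_measure xi) h ->
  Delta a xi h = +oo%E.
Proof.
have Ff := spectral_measure_fin xi.
by move=> hh; rewrite /Delta asboolF // => /(in_L2_pastP Ff).
Qed.

Lemma Delta_upper_bound (P nu : R) (h0 : measurableTypeR R -> R[i]) : 0 <= P ->
  (forall x, torus R x -> normc (A_spectral a x - h0 x) <= nu) ->
  (forall F : {measure set (measurableTypeR R) -> \bar R},
    (F setT < +oo)%E -> past F h0) ->
  forall xi, Xi P xi -> (Delta a xi h0 <= (P * nu ^+ 2)%:E)%E.
Proof.
move=> P0 hnu hp xi hxi; have Ff := spectral_measure_fin xi.
have hh := hp _ Ff.
rewrite (Delta_past hh) lee_fin.
apply: le_trans (nrm2_bounded Ff (M := nu ^+ 2) _ _) _.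
- by apply: (in_L2B mT (in_L2_A Ff)); exact: past_inL2 hh.
- by move=> x Tx; apply: sqmod_le_normc; exact: hnu.
rewrite mulrC; apply: ler_wpM2r; first exact: sqr_ge0.
exact: spectral_measure_le.
Qed.

(** The norm is continuous and past polynomials are dense in the past, so a lower bound has to be
    checked on them only. *)
Lemma past_nrm2_lower (F : {measure set (measurableTypeR R) -> \bar R}) (m : R) :
  (F setT < +oo)%E ->
  (forall Q, m <= nrm2 F (torus R) (fun x => A_spectral a x - past_poly Q x)) ->
  forall h, past F h -> m <= nrm2 F (torus R) (fun x => A_spectral a x - h x).
Proof.
move=> Ff hm h [ih hh].
have [Q hQ] := choice (fun n : nat => hh n.+1%:R^-1 (ltac:(by rewrite invr_gt0))).
have iA := in_L2_A Ff.
have iQ n := in_L2_past_poly Ff (Q n).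
have c : (fun n => nrm2 F (torus R) (fun x =>
    (A_spectral a x - past_poly (Q n) x) - (A_spectral a x - h x))) @ \oo --> 0.
  apply: (squeeze_cvgr _ (cvg_cst 0) (@cvg_harmonic R)); near=> n.
  rewrite nrm2_ge0 /=; apply: le_trans (hQ n).
  rewrite le_eqVlt; apply/orP; left; apply/eqP; congr nrm2; apply/funext => x.
  ring.
have c' := nrm2_cvg mT (fun n => in_L2B mT iA (iQ n)) (in_L2B mT iA ih) c.
rewrite -(cvg_lim _ c') //; apply: limr_ge; first exact: cvgP c'.
by near=> n; exact: hm.
Unshelve. all: by end_near. Qed.

Lemma minimum_ereal_inf (S : set (\bar R)) m : is_minimum S m -> ereal_inf S = m.
Proof.
move=> [Sm lb]; apply/eqP; rewrite eq_le; apply/andP; split.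
  exact: ereal_inf_lbound.
exact: le_ereal_inf_tmp.
Qed.

(** The minimizer is the projection of A on the past in L_2(F); estimates that are not admissible
    have infinite error and do not compete. *)
Lemma min_error_attained (xi : process R) :
  is_minimum [set Delta a xi h | h in Lambda R] (min_error a xi).
Proof.
have Ff := spectral_measure_fin xi; set F := spectral_measure xi in Ff.
pose S (f : measurableTypeR R -> R[i]) := exists Q, f = past_poly Q.
have SL f : S f -> in_L2 F (torus R) f by move=> [Q ->]; exact: in_L2_past_poly.
have [||h [ih [q [Sq qc]] hmin]] :=
  @projection_attained _ _ _ F _ mT (A_spectral a) S (in_L2_A Ff) SL.
- by exists (past_poly 0), 0.
- move=> f g [Q ->] [Q' ->]; exists ((1 - 2^-1 : R)%:C *: Q + (2^-1 : R)%:C *: Q').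
  by apply/funext => x; rewrite /past_poly hornerD !hornerZ; ring.
have ph : past F h.
  apply: (past_cvg Ff ih) => [n|]; last first.
    by under eq_fun do rewrite nrm2BC; exact: qc.
  by have [Q ->] := Sq n; exact: past_past_poly.
have mh : is_minimum [set Delta a xi h | h in Lambda R] (Delta a xi h).
  split; first by exists h => //; exact: ih.1.
  move=> _ [h' _ <-]; have [ph'|ph'] := pselect (past F h'); last first.
    by rewrite (Delta_not_past ph') leey.
  rewrite (Delta_past ph) (Delta_past ph') lee_fin.
  by apply: (past_nrm2_lower Ff _ ph') => Q; apply: hmin; exists Q.
by rewrite /min_error (minimum_ereal_inf mh).
Qed.

End EstimationError.

(** * Measures given by a density *)

Section Density.
Context {R : realType} {d : measure_display} {T : measurableType d}.
Variables (mu : {measure set T -> \bar R}) (rho : T -> R).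
Hypotheses (mrho : measurable_fun setT rho) (rho0 : forall x, 0 <= rho x).

(** The two proofs are arguments so that the measure structure can be attached to the term
    itself. *)
Definition density (_ : measurable_fun setT rho) (_ : forall x, 0 <= rho x)
    (A : set T) : \bar R :=
  (\int[mu]_(x in A) (rho x)%:E)%E.

Local Notation dens := (density mrho rho0).

Let dens0 : dens set0 = 0%E.
Proof. by rewrite /density integral_set0. Qed.

Let dens_ge0 A : (0 <= dens A)%E.
Proof. by apply: integral_ge0 => x _; rewrite lee_fin. Qed.

Let dens_sigma_additive : semi_sigma_additive dens.
Proof.
move=> /= F mF tF mUF; rewrite /density; apply: cvg_toP.
  apply: ereal_nondecreasing_is_cvgn => m n mn.
  apply: lee_sum_nneg_natr => // k _ _.
  by apply: integral_ge0 => /= x Fkx; rewrite lee_fin.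
rewrite ge0_integral_bigcup //=.
- by apply: measurable_funTS; apply: measurableT_comp.
- by move=> x _; rewrite lee_fin.
Qed.

HB.instance Definition _ := isMeasure.Build _ _ _ dens
  dens0 dens_ge0 dens_sigma_additive.

Definition density_measure : {measure set T -> \bar R} := dens.

Let mE (g : T -> R) : measurable_fun setT g -> measurable_fun setT (EFin \o g).
Proof. by move=> mg; apply/measurable_EFinP. Qed.

Import HBNNSimple.

Lemma ge0_integral_density (f : T -> \bar R) : measurable_fun setT f ->
  (forall x, 0 <= f x)%E ->
  (\int[density_measure]_x f x = \int[mu]_x (f x * (rho x)%:E))%E.
Proof.
move=> mf f0; rewrite /density_measure.
have sf (g : {nnsfun T >-> R}) :
    (\int[dens]_x (g x)%:E = \int[mu]_x ((g x)%:E * (rho x)%:E))%E.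
  under [LHS]eq_integral do rewrite fimfunE -fsumEFin //.
  rewrite [LHS]ge0_integral_fsum //; last 2 first.
  - by move=> r; exact/measurable_EFinP/measurableT_comp.
  - by move=> n x _; rewrite EFinM nnfun_muleindic_ge0.
  under [RHS]eq_integral.
    move=> x xD; rewrite fimfunE -fsumEFin // muleC ge0_mule_fsumr; last first.
      by move=> r; rewrite EFinM nnfun_muleindic_ge0.
    over.
  rewrite [RHS]ge0_integral_fsum //; last 2 first.
  - move=> r; apply: emeasurable_funM; first exact: mE.
    by apply/measurable_EFinP; apply/measurableT_comp.
  - move=> n x _; apply: mule_ge0; first by rewrite lee_fin.
    by rewrite EFinM nnfun_muleindic_ge0.
  apply: eq_fsbigr => r _.
  under [RHS]eq_integral do rewrite EFinM muleCA.
  have mA : measurable (g @^-1` [set r]) by exact: measurable_funPTI.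
  set A := g @^-1` [set r] in mA *.
  (* A negative value is not taken by a nonnegative simple function, and its level set is empty. *)
  have [r0|r0] := leP 0 r; last first.
    have A0 : A = set0.
      apply/seteqP; split => // x gx; have : 0 <= g x by [].
      by rewrite /= (_ : g x = r) // leNgt r0.
    by rewrite A0; under eq_integral do rewrite indic0 mulr0;
       under [RHS]eq_integral do rewrite indic0 mule0 mule0; rewrite !integral0.
  rewrite ge0_integralZl //; last 2 first.
  - by apply: emeasurable_funM; [exact: mE|exact/measurable_EFinP].
  - by move=> x _; rewrite mule_ge0 ?lee_fin.
  under eq_integral do rewrite EFinM.
  rewrite ge0_integralZl //; last exact/measurable_EFinP.
  rewrite integral_indic // setIT; congr (_ * _)%E.
  transitivity (\int[mu]_(x in A) (rho x)%:E)%E; first by [].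
  rewrite [LHS]integral_mkcond; apply: eq_integral => x _.
  by rewrite patchE indicE; case: (x \in A); rewrite /= ?mule1 ?mule0.
pose f_ := nnsfun_approx measurableT mf.
have fc x : (f_ n x)%:E @[n --> \oo] --> f x.
  exact: cvg_nnsfun_approx.
transitivity (lim (\int[dens]_x (f_ n x)%:E @[n --> \oo])%E).
  rewrite -monotone_convergence //=.
  - by apply: eq_integral => x _; apply/esym/cvg_lim.
  - by move=> n; exact/measurable_EFinP/measurable_funTS.
  - by move=> n ? _; rewrite lee_fin.
  - by move=> ? _ ? ? mn; rewrite lee_fin; exact/lefP/nd_nnsfun_approx.
under eq_fun do rewrite sf.
rewrite -monotone_convergence //=.
- apply: eq_integral => x _; apply/cvg_lim => //.
  by apply: cvgeZr.
- move=> n; apply: emeasurable_funM; last exact: mE.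
  exact/measurable_EFinP/measurable_funTS.
- by move=> n x _; rewrite mule_ge0 ?lee_fin.
- move=> x _ m n mn; apply: lee_wpmul2r; rewrite lee_fin //.
  exact/lefP/nd_nnsfun_approx.
Qed.

Lemma Rintegral_density (f : T -> R) : measurable_fun setT f ->
  Rintegral density_measure setT f = Rintegral mu setT (fun x => f x * rho x).
Proof.
move=> mf; rewrite /Rintegral; congr fine; rewrite integralE [RHS]integralE.
have mf' := mE mf.
rewrite !ge0_integral_density //; [|exact: measurable_funeneg|exact: measurable_funepos].
congr (_ - _)%E; apply: eq_integral => x _.
  by rewrite !funeposE /= -!EFin_max -EFinM; congr EFin; rewrite maxr_pMl // mul0r.
by rewrite !funenegE /= -!EFin_max -EFinM; congr EFin; rewrite maxr_pMl // mul0r mulNr.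
Qed.

End Density.

(** * Moving averages over an orthonormal system *)

Section MovingAverage.
Context {R : realType} {d : measure_display} {T : measurableType d}.
Variables (mu : {measure set T -> \bar R}) (D : set T).
Hypothesis mD : measurable D.
Variables (e : int -> T -> R[i]) (phi : nat -> R[i]).
Hypotheses (he : forall i, in_L2 mu D (e i))
  (oe : forall i j, ip mu D (e i) (e j) = (i == j)%:R)
  (l2phi : l2 phi).

Definition ma_partial (N : nat) (j : int) (x : T) : R[i] :=
  \sum_(k < N) phi k * e (j - k%:Z) x.

Lemma in_L2_ma_partial N j : in_L2 mu D (ma_partial N j).
Proof. by apply: in_L2_sum => // k; exact: in_L2Z. Qed.

Definition filter_coef (n : int) : R[i] := if n is Posz k then phi k else 0.

(** It depends on [phi] and not on the orthonormal system, so moving averages built on the noise and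
    on the exponentials of the circle have equal covariances. *)
Definition autocov (N : nat) (n : int) : R[i] :=
  \sum_(k < N) \sum_(l < N) phi k * ((phi l)^* * (n + l%:Z == k%:Z)%:R).

Lemma ip_ma_partial N n m :
  ip mu D (ma_partial N n) (ma_partial N m) = autocov N (n - m).
Proof.
rewrite /ma_partial ip_suml //; last by apply: in_L2_sum => // k; exact: in_L2Z.
apply: eq_bigr => k _; rewrite ip_sumr // mulr_sumr.
apply: eq_bigr => l _; rewrite oe; congr (_ * (_ * _%:R)).
by congr nat_of_bool; apply/eqP/eqP => h; lia.
Qed.

Lemma ip_ma_partial_noise j u :
  cvgC (fun N => ip mu D (ma_partial N j) (e u)) (filter_coef (j - u)).
Proof.
have E M : ip mu D (ma_partial M j) (e u) = \sum_(k < M) phi k * (k%:Z == j - u)%:R.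
  rewrite /ma_partial ip_suml //; apply: eq_bigr => k _; rewrite oe.
  by congr (_ * _%:R); congr nat_of_bool; apply/eqP/eqP => h; lia.
under [X in cvgC X]eq_fun do rewrite E.
case: (j - u) => [k0|k0] /=; last first.
  apply: (cvgC_eventually (u := fun=> 0)); last exact: cvgC_cst.
  by near=> M; rewrite big1 // => k _; rewrite mulr0.
apply: (cvgC_eventually (u := fun=> phi k0)); last exact: cvgC_cst.
near=> M; have kM : (k0 < M)%N by near: M; exact: nbhs_infty_gt.
rewrite (bigD1 (Ordinal kM)) //= eqxx mulr1 big1 ?addr0 // => k.
rewrite eqz_nat -val_eqE /= => /negbTE ->; exact: mulr0.
Unshelve. all: by end_near. Qed.

Lemma nrm2_orthonormal_sum (s : seq nat) j : uniq s ->
  nrm2 mu D (fun x => \sum_(k <- s) phi k * e (j - k%:Z) x) =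
  \sum_(k <- s) sqmod (phi k).
Proof.
move=> us; have h k : in_L2 mu D (e (j - k%:Z)) by [].
have : (nrm2 mu D (fun x => \sum_(k <- s) phi k * e (j - k%:Z) x))%:C =
    (\sum_(k <- s) sqmod (phi k))%:C :> R[i].
  rewrite -ip_self // ip_suml //; last by apply: in_L2_sum => // k; exact: in_L2Z.
  rewrite rmorph_sum /= big_seq [RHS]big_seq; apply: eq_bigr => k ks.
  rewrite ip_sumr // (bigD1_seq k) //= oe eqxx mulr1 big1 ?addr0 ?mulcJ // => l lk.
  rewrite oe (_ : (_ == _) = false) ?mulr0 //.
  by apply/negbTE; apply: contra_neq lk => lk; lia.
by move=> [].
Qed.

Lemma nrm2_ma_partial N j :
  nrm2 mu D (ma_partial N j) = \sum_(k < N) sqmod (phi k).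
Proof.
rewrite -(big_mkord predT (fun k => sqmod (phi k))).
rewrite -(nrm2_orthonormal_sum j) ?iota_uniq //.
by congr nrm2; apply/funext => x; rewrite /ma_partial big_mkord.
Qed.

Lemma ma_partialB M N j : (M <= N)%N ->
  nrm2 mu D (fun x => ma_partial N j x - ma_partial M j x) =
  \sum_(M <= k < N) sqmod (phi k).
Proof.
move=> MN; rewrite -(nrm2_orthonormal_sum j) ?iota_uniq //.
congr nrm2; apply/funext => x; rewrite /ma_partial.
rewrite -!(big_mkord predT (fun k => phi k * e (j - k%:Z) x)).
by rewrite (big_cat_nat (leq0n M) MN) /= addrAC subrr add0r.
Qed.

Lemma ma_exists j : exists X : T -> R[i], in_L2 mu D X /\
  (fun N => nrm2 mu D (fun x => ma_partial N j x - X x)) @ \oo --> 0.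
Proof.
have [|X [s [E [_ _ _ iX cX]]]] := riesz_fischer mD (fun N => in_L2_ma_partial N j).
  move=> r r0; have [m hm] := series_ge0_small r0 (fun n => sqmod_ge0 (phi n)) l2phi.
  have h M N : (m <= M)%N -> (M <= N)%N -> \sum_(M <= k < N) sqmod (phi k) <= r.
    move=> mM MN; apply: le_trans (hm N); rewrite (big_cat_nat mM MN) /= lerDr.
    by apply: sumr_ge0 => k _; exact: sqmod_ge0.
  exists m => M N mM mN; have [NM|/ltnW MN] := leqP N M.
    by rewrite ma_partialB //; exact: h.
  by rewrite nrm2BC ma_partialB //; exact: h.
by exists X.
Qed.

Variable X : int -> T -> R[i].
Hypotheses (iX : forall j, in_L2 mu D (X j))
  (cX : forall j, (fun N => nrm2 mu D (fun x => ma_partial N j x - X j x)) @ \oo --> 0).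

Lemma ip_ma n m : cvgC (fun N => autocov N (n - m)) (ip mu D (X n) (X m)).
Proof.
under [X in cvgC X]eq_fun do rewrite -ip_ma_partial.
by apply: ip_cvg => // N; exact: in_L2_ma_partial.
Qed.

Lemma ip_ma_noise j u : ip mu D (X j) (e u) = filter_coef (j - u).
Proof.
have c := ip_ma_partial_noise j u.
apply: cvgC_unique c; apply: ip_cvg => //; first by move=> N; exact: in_L2_ma_partial.
rewrite (_ : (fun n : nat => _) = fun=> 0); first exact: cvg_cst.
apply/funext => n; rewrite /nrm2 (_ : (fun x => _) = fun=> 0).
  by rewrite Rintegral_cst // mul0r.
by apply/funext => x; rewrite subrr sqmod0.
Qed.

Lemma nrm2_ma j : nrm2 mu D (X j) = l2_sqnorm phi.
Proof.
have c := nrm2_cvg mD (fun N => in_L2_ma_partial N j) (iX j) (cX j).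
move: c; under eq_fun do rewrite nrm2_ma_partial.
by move=> c; apply: cvg_unique c (cvg_series_ord l2phi).
Qed.

Lemma ip_ma_shift n k : ip mu D (X (n + k)) (X k) = ip mu D (X n) (X 0).
Proof.
apply: cvgC_unique (ip_ma _ _) _; have := ip_ma n 0.
by rewrite subr0 addrK.
Qed.

Lemma ip_ma_mean g : in_L2 mu D g -> (forall u, ip mu D (e u) g = 0) ->
  forall j, ip mu D (X j) g = 0.
Proof.
move=> ig h j.
have : cvgC (fun N => ip mu D (ma_partial N j) g) (ip mu D (X j) g).
  apply: ip_cvg => //; first by move=> N; exact: in_L2_ma_partial.
  rewrite (_ : (fun n : nat => _) = fun=> 0); first exact: cvg_cst.
  apply/funext => n; rewrite /nrm2 (_ : (fun x => _) = fun=> 0).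
    by rewrite Rintegral_cst // mul0r.
  by apply/funext => x; rewrite subrr sqmod0.
move=> c; apply: cvgC_unique c _.
rewrite (_ : (fun N : nat => _) = fun=> 0); first exact: cvgC_cst.
apply/funext => N; rewrite /ma_partial ip_suml // big1 // => k _.
by rewrite h mulr0.
Qed.

Section LowerBound.
Variable F : {measure set (measurableTypeR R) -> \bar R}.
Hypotheses (F_fin : (F setT < +oo)%E)
  (F_moment : forall n, ip mu D (X n) (X 0) = cintegral F (torus R) (cexpi n)).

Let mT : measurable (torus R) := @measurable_torus R.

(** The Gram matrices of the exponentials in L_2(F) and of the variables [X n] coincide, by
    stationarity and the moments of [F]. *)
Lemma trigonometric_isometry (s : seq (R[i] * int)) :
  nrm2 F (torus R) (fun x => \sum_(p <- s) p.1 * cexpi p.2 x) =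
  nrm2 mu D (fun x => \sum_(p <- s) p.1 * X p.2 x).
Proof.
have FT := torus_fin F_fin.
have ic n : in_L2 F (torus R) (cexpi n) by exact: in_L2_cexpi.
have E n m : ip F (torus R) (cexpi n) (cexpi m) = ip mu D (X n) (X m).
  rewrite -{2}(subrK m n) ip_ma_shift F_moment /ip.
  by congr cintegral; apply/funext => x; rewrite cexpiJ -cexpiD.
have : (nrm2 F (torus R) (fun x => \sum_(p <- s) p.1 * cexpi p.2 x))%:C =
  (nrm2 mu D (fun x => \sum_(p <- s) p.1 * X p.2 x))%:C :> R[i].
  rewrite -!ip_self // !ip_suml //; last 2 first.
  - by apply: in_L2_sum => // p; exact: in_L2Z.
  - by apply: in_L2_sum => // p; exact: in_L2Z.
  apply: eq_bigr => p _; rewrite !ip_sumr //; congr (_ * _).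
  by apply: eq_bigr => q _; rewrite E.
by move=> [].
Qed.

Variable a : nat -> R[i].
Hypotheses (ha1 : cvgn (series (fun j => normc (a j))))
  (ha : cvgn (series (fun j => j.+1%:R * normc (a j) ^+ 2))).

Lemma hankel_partial u : cvgC
  (fun m => \sum_(j < m) a j * filter_coef (j%:Z - u%:Z)) (hankel a phi u).
Proof.
have [s _] := hankel_bound ha u l2phi.
have c := csummable_cvg s; rewrite /hankel.
have E m : \sum_(j < m + u) a j * filter_coef (j%:Z - u%:Z) =
    \sum_(p < m) phi p * a (p + u)%N.
  rewrite addnC big_split_ord /= big1 ?add0r => [|j _]; last first.
    rewrite (_ : j%:Z - u%:Z = Negz (u - j.+1)) ?mulr0 //.
    by have := ltn_ord j; lia.
  apply: eq_bigr => p _; rewrite mulrC addnC; congr (_ * _).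
  by rewrite PoszD addrK.
move: c => [c1 c2]; split.
  rewrite -(cvg_shiftn u); apply: cvg_trans c1.
  by apply: near_eq_cvg; near=> m; rewrite /= E.
rewrite -(cvg_shiftn u); apply: cvg_trans c2.
by apply: near_eq_cvg; near=> m; rewrite /= E.
Unshelve. all: by end_near. Qed.

(** A truncated error is carried to the variables [X], where Bessel's inequality applies with [e u],
    u >= 0. The past variables do not correlate with these, so only the Hankel coefficients remain;
    the truncation [m] is removed first, then the number [M] of noise variables. *)
Lemma error_lower_bound Q :
  l2_sqnorm (hankel a phi) <= nrm2 F (torus R) (fun x => A_spectral a x - past_poly Q x).
Proof.
have FT := torus_fin F_fin.
(* One list of pairs (coefficient, frequency) describes the truncated A minus the past polynomial,
   in the form required by the isometry. *)
pose s m := [seq (a j, j%:Z) | j <- iota 0 m] ++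
  [seq (- Q`_k, - (k.+1)%:Z) | k <- iota 0 (size Q)].
pose f m x := \sum_(p <- s m) p.1 * cexpi p.2 x.
have sE (G : int -> R[i]) m : \sum_(p <- s m) p.1 * G p.2 =
    \sum_(j < m) a j * G j%:Z - \sum_(k < size Q) Q`_k * G (- (k.+1)%:Z).
  rewrite big_cat !big_map /= -(big_mkord predT (fun j => a j * G j%:Z)).
  rewrite -(big_mkord predT (fun k => Q`_k * G (- (k.+1)%:Z))) /index_iota !subn0.
  by congr (_ + _); rewrite -sumrN; apply: eq_bigr => k _; rewrite mulNr.
have fE m x : f m x = \sum_(j < m) a j * cexpi j%:Z x - past_poly Q x.
  rewrite /f (sE (cexpi^~ x)) /past_poly horner_coef mulr_sumr; congr (_ - _).
  by apply: eq_bigr => k _; rewrite cexpi_succ mulrCA.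
have If m : in_L2 F (torus R) (f m).
  apply: in_L2_sum => // p; apply: in_L2Z => //; exact: in_L2_cexpi.
have iA := in_L2_A ha1 F_fin; have iQ := in_L2_past_poly F_fin Q.
have cf : (fun m => nrm2 F (torus R) (fun x => f m x - (A_spectral a x - past_poly Q x)))
    @ \oo --> 0.
  have c0 : (fun m => abs_tail a m ^+ 2 * fine (F (torus R))) @ \oo --> 0.
    rewrite -(mul0r (fine (F (torus R)))); apply: cvgM; last exact: cvg_cst.
    rewrite -(mulr0 (0 : R)); under eq_fun do rewrite expr2.
    by apply: cvgM; exact: abs_tail_cvg0.
  apply: (squeeze_cvgr _ (cvg_cst 0) c0); near=> m; rewrite nrm2_ge0 /=.
  apply: nrm2_bounded => //.
    by apply: in_L2B => //; exact: in_L2B.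
  move=> x _; rewrite fE opprB addrA subrK sqmodBC.
  by apply: sqmod_le_normc; exact: A_spectral_tail.
have cn := nrm2_cvg mT If (in_L2B mT iA iQ) cf.
have key M m : \sum_(u < M) sqmod (\sum_(j < m) a j * filter_coef (j%:Z - u%:Z)) <=
    nrm2 F (torus R) (f m).
  rewrite trigonometric_isometry.
  have ix : in_L2 mu D (fun x => \sum_(p <- s m) p.1 * X p.2 x).
    by apply: in_L2_sum => // p; exact: in_L2Z.
  apply: le_trans (bessel mD M (fun i : nat => he i) (fun i j : nat => oe i j) ix).
  apply: ler_sum => u _; rewrite ip_suml //.
  rewrite [X in _ <= sqmod X](eq_bigr (fun p => p.1 * filter_coef (p.2 - u%:Z))); last first.
    by move=> p _; rewrite ip_ma_noise.
  rewrite (sE (fun n => filter_coef (n - u%:Z))) [X in _ - X]big1 ?subr0 // => k _.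
  (* [X] at time -(k + 1) involves noise up to that time only, so its coefficient at u >= 0 is
     zero. *)
  by rewrite (_ : _ - _ = Negz (k + u)) ?mulr0 //; lia.
have step M : \sum_(u < M) sqmod (hankel a phi u) <=
    nrm2 F (torus R) (fun x => A_spectral a x - past_poly Q x).
  have cs : (fun m => \sum_(u < M) sqmod (\sum_(j < m) a j * filter_coef (j%:Z - u%:Z)))
      @ \oo --> \sum_(u < M) sqmod (hankel a phi u).
    apply: cvg_sumr => u; apply: cvg_sqmod; exact: hankel_partial.
  by apply: ler_cvg_to cs cn _; near=> m; exact: key.
have := cvg_series_ord (hankel_l2 ha l2phi) => c.
rewrite /l2_sqnorm -(cvg_lim _ c) //; apply: limr_le; first exact: cvgP c.
by near=> M; exact: step.
Unshelve. all: by end_near. Qed.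

End LowerBound.

End MovingAverage.

(** * Moving average processes and their spectral measure *)

Section MovingAverageProcess.
Context {R : realType}.

Let mT : measurable (torus R) := @measurable_torus R.

(** Phi, the sum of the phi(k) e^{-ikx}, is the moving average at time 0 over the exponentials.
    Multiplying it by [cexpi j] gives time j, so the measure with density |Phi|^2 has the
    covariances as its moments. *)
Lemma ma_spectral_density (phi : nat -> R[i]) : l2 phi ->
  exists F : {measure set (measurableTypeR R) -> \bar R},
    [/\ (F setT < +oo)%E, F (~` torus R) = 0%E &
    forall n, cvgC (fun N => autocov phi N n) (cintegral F (torus R) (cexpi n))].
Proof.
move=> hphi.
have ie i : in_L2 (@unif R) setT (cexpi i) by apply: in_L2_cexpi => //; exact: unif_fin.
have [Phi [iPhi cPhi]] := ma_exists measurableT ie (@ip_unif_cexpi R) hphi 0.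
(* The cut-off makes the measure vanish off the torus and changes [Phi] on a null set of the uniform
   law only. *)
pose G x := (\1_(torus R) x)%:C * Phi x.
have mG : cmeasurable setT G by apply: cmeasurable_patch => //; exact: iPhi.1.
pose X j x := cexpi j x * G x.
have iX j : in_L2 (@unif R) setT (X j).
  apply: (in_L2_le measurableT _ iPhi.2).
    by apply: cmeasurableM => //; exact: cmeasurable_cexpi.
  move=> x _; rewrite !sqmodM sqmod_cexpi mul1r sqmodr indicE.
  by case: (_ \in _); rewrite ?expr1n ?mul1r // expr0n mul0r sqmod_ge0.
have cX j : (fun N => nrm2 (@unif R) setT
    (fun x => ma_partial cexpi phi N j x - X j x)) @ \oo --> 0.
  suff E N : nrm2 (@unif R) setT (fun x => ma_partial cexpi phi N j x - X j x) =
      nrm2 (@unif R) setT (fun x => ma_partial cexpi phi N 0 x - Phi x).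
    by under eq_fun do rewrite E.
  have m0 : measurable (set0 : set (measurableTypeR R)) by [].
  have z0 : lebesgue_measure (set0 : set (measurableTypeR R)) = 0%E :> \bar R.
    exact: measure0.
  rewrite !(nrm2_unif_torus m0 z0); last 2 first.
  - by apply: cmeasurableB; [exact: (in_L2_ma_partial measurableT phi ie N 0).1|exact: iPhi.1].
  - by apply: cmeasurableB; [exact: (in_L2_ma_partial measurableT phi ie N j).1|exact: (iX j).1].
  apply: eq_Rintegral => x; rewrite inE => -[Tx _].
  rewrite /X /G indicE mem_set // mul1r.
  have -> : ma_partial cexpi phi N j x = cexpi j x * ma_partial cexpi phi N 0 x.
    rewrite /ma_partial mulr_sumr; apply: eq_bigr => k _.
    by rewrite mulrCA -cexpiD add0r.
  by rewrite -mulrBr sqmodM sqmod_cexpi mul1r.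
pose rho (x : measurableTypeR R) := sqmod (G x).
have mrho : measurable_fun setT rho by exact: measurable_sqmod.
have rho0 x : 0 <= rho x by exact: sqmod_ge0.
have off x : ~ torus R x -> rho x = 0.
  by move=> Tx; rewrite /rho /G indicE memNset // mul0r sqmod0.
exists (density_measure (@unif R) mrho rho0); split.
- have := (iX 0).1; have /(in_L2P _ _ _).1 [_] := iX 0.
  rewrite (_ : X 0 = G) //.
  by apply/funext => x; rewrite /X cexpi0 mul1r.
- by apply: integral0_eq => x Tx; rewrite off.
move=> n.
have c := ip_ma measurableT ie (@ip_unif_cexpi R) iX cX n 0.
rewrite subr0 in c.
suff -> : cintegral (density_measure (@unif R) mrho rho0) (torus R) (cexpi n) =
  ip (@unif R) setT (X n) (X 0) by [].
have dens (f : measurableTypeR R -> R) : measurable_fun setT f ->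
    Rintegral (density_measure (@unif R) mrho rho0) (torus R) f =
    Rintegral (@unif R) setT (fun x => f x * rho x).
  move=> mf; rewrite Rintegral_mkcond Rintegral_density; last first.
    by apply/(measurable_restrictT f mT); exact: measurable_funTS.
  congr Rintegral; apply/funext => x; rewrite patchE.
  by case: ifPn => // xT; rewrite off ?mulr0 //; move: xT; rewrite notin_setE.
have [m1 m2] := @cmeasurable_cexpi R n setT.
have E x : X n x * (X 0 x)^* = cexpi n x * (rho x)%:C.
  by rewrite /X cexpi0 mul1r -mulrA mulcJ.
apply: complex_eqP; rewrite /= dens //; congr Rintegral; apply/funext => x.
  by rewrite E ReM /= mulr0 subr0.
by rewrite E ImM /= mulr0 add0r.
Qed.

Variables (phi : nat -> R[i]) (xi : process R) (eps : int -> pr_space xi -> R[i]).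
Hypotheses (hphi : l2 phi) (wn : white_noise (pr_prob xi) eps)
  (ma : moving_average phi eps).

Local Notation Pr := (pr_prob xi).

Lemma noise_in_L2 u : in_L2 Pr setT (eps u).
Proof. by case: wn => h _ _; apply/in_L2P; exact: h. Qed.

Lemma noise_orthonormal i j : ip Pr setT (eps i) (eps j) = (i == j)%:R.
Proof. by case: wn => _ _; apply. Qed.

Lemma ma_in_L2_cvg j : in_L2 Pr setT (xi j) /\
  (fun N => nrm2 Pr setT (fun x => ma_partial eps phi N j x - xi j x)) @ \oo --> 0.
Proof.
have [mx /fine_cvgP[fin c]] := ma j; split; last first.
  by under eq_fun do rewrite nrm2BC; exact: c.
(* Convergence to 0 in the extended reals makes some error finite, and adding back that partial sum
   shows that [xi j] is square integrable. *)
have [N _ /(_ N (leqnn N)) hN] := fin.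
have iN := in_L2_ma_partial measurableT phi noise_in_L2 N j.
have iB : in_L2 Pr setT (fun w => xi j w - ma_partial eps phi N j w).
  apply/in_L2P; split; first by apply: cmeasurableB => //; exact: iN.1.
  by move: hN; rewrite fin_numE => /andP[_]; rewrite ltey.
have := in_L2D measurableT iB iN.
by under [X in in_L2 _ _ X -> _]eq_fun do rewrite subrK.
Qed.

Let iX j : in_L2 Pr setT (xi j) := (ma_in_L2_cvg j).1.
Let cX j := (ma_in_L2_cvg j).2.

Lemma ma_process_Xi : Xi (l2_sqnorm phi) xi.
Proof.
have i1 : in_L2 Pr setT (fun=> 1).
  apply: (@in_L2_le _ _ _ Pr setT measurableT _ (fun=> 1)).
  - exact: cmeasurable_cst.
  - exact: finite_measure_integrable_cst.
  - by move=> x _; rewrite -(expr1n R 2) sqmodr.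
have E (f : pr_space xi -> R[i]) : expect Pr f = ip Pr setT f (fun=> 1).
  by congr cintegral; apply/funext => x; rewrite rmorph1 mulr1.
have mean0 j : expect Pr (xi j) = 0.
  rewrite E; apply: (ip_ma_mean measurableT noise_in_L2 iX cX i1) => u.
  by rewrite -E; case: wn => _ h _; exact: h.
split; first split.
- by move=> n; apply/in_L2P; exact: iX.
- by move=> n; rewrite !mean0.
- exact: (ip_ma_shift measurableT noise_in_L2 noise_orthonormal iX cX).
- exact: mean0.
move=> j; rewrite /second_moment (nrm2E measurableT (iX j)).
by rewrite (nrm2_ma measurableT noise_in_L2 noise_orthonormal hphi iX cX).
Qed.

(** The measure with density |Phi|^2 witnesses existence, which excludes the default zero
    measure. *)
Lemma ma_is_spectral_measure : is_spectral_measure xi (spectral_measure xi).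
Proof.
rewrite /spectral_measure; case: pselect => [ex|nex]; first exact: svalP (cid ex).
exfalso; apply: nex; have [F [Ff F0 Fm]] := ma_spectral_density hphi.
exists F; split => // n; apply: cvgC_unique _ (Fm n).
have := ip_ma measurableT noise_in_L2 noise_orthonormal iX cX n 0.
by rewrite subr0.
Qed.

Lemma ma_Delta_lower_bound (a : nat -> R[i]) h :
  cvgn (series (fun j => normc (a j))) ->
  cvgn (series (fun j => j.+1%:R * normc (a j) ^+ 2)) ->
  ((l2_sqnorm (hankel a phi))%:E <= Delta a xi h)%E.
Proof.
move=> ha1 ha; have [ph|nph] := pselect (past (spectral_measure xi) h); last first.
  by rewrite (Delta_not_past a nph) leey.
rewrite (Delta_past ha1 ph) lee_fin.
have [Ff _ Fm] := ma_is_spectral_measure.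
apply: (past_nrm2_lower ha1 Ff _ ph) => Q.
exact: (error_lower_bound measurableT noise_in_L2 noise_orthonormal hphi iX cX Ff Fm ha1 ha).
Qed.

End MovingAverageProcess.

(** The circle with its uniform law is the probability space, and exponentials are the white
    noise. *)
Lemma ma_process_exists (R : realType) (phi : nat -> R[i]) : l2 phi ->
  exists (xi : process R) (eps : int -> pr_space xi -> R[i]),
    white_noise (pr_prob xi) eps /\ moving_average phi eps.
Proof.
move=> hphi.
(* The odd frequencies give mean zero. *)
pose e (u : int) : measurableTypeR R -> R[i] := cexpi (u * 2 + 1).
have ie u : in_L2 (@unif R) setT (e u) by apply: in_L2_cexpi => //; exact: unif_fin.
have oe i j : ip (@unif R) setT (e i) (e j) = (i == j)%:R.
  rewrite ip_unif_cexpi; congr (nat_of_bool _)%:R.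
  by apply/eqP/eqP => [|->//]; lia.
have [X hX] := choice (ma_exists measurableT ie oe hphi).
exists (Process (@unif R) X), e; split.
  split => [u|u|i j]; last exact: oe.
    by have /in_L2P := ie u.
  rewrite /expect /= cintegral_unif_cexpi (_ : _ == 0 = false) //.
  by apply/negbTE/eqP; lia.
move=> j; have [iX cX] := hX j; split; first exact: iX.1.
have E N : second_moment (@unif R) (fun w => X j w - \sum_(k < N) phi k * e (j - k%:Z) w) =
    (nrm2 (@unif R) setT (fun w => ma_partial e phi N j w - X j w))%:E.
  rewrite nrm2BC -nrm2E //; apply: in_L2B => //; exact: in_L2_ma_partial.
apply: cvg_EFin; first by near=> N; rewrite /= E.
apply: cvg_trans cX; apply: near_eq_cvg; near=> N.
by rewrite /= E.
Unshelve. all: by end_near.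
Qed.

Lemma eigenvector_normalized (R : realType) (M : nat -> nat -> R[i])
    (mu : R[i]) (P : R) : matrix_op_on_l2 M ->
  is_eigenvalue (matrix_op M) mu -> 0 < P ->
  exists phi, is_eigenvector (matrix_op M) mu phi /\ l2_sqnorm phi = P.
Proof.
move=> hM [x [hx [n nx] ex]] P0.
have x0 : 0 < l2_sqnorm x.
  rewrite lt_neqAle l2_sqnorm_ge0 // andbT eq_sym; apply/eqP => e0.
  exact/nx/(l2_sqnorm0 hx e0).
pose c : R := Num.sqrt (P / l2_sqnorm x).
have c0 : 0 < c by rewrite sqrtr_gt0 divr_gt0.
have [h1 h2] := l2Z c%:C hx.
exists (fun k => c%:C * x k); split; last first.
  by rewrite h2 sqmodr sqr_sqrtr ?divr_ge0 ?ltW // divfK // gt_eqF.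
split => //.
  exists n; apply/eqP; rewrite mulf_neq0 //; last exact/eqP.
  by rewrite fmorph_eq0 gt_eqF.
move=> q; rewrite mulrCA -ex /matrix_op.
have [_ <-] := csumZ c%:C ((hM x hx).1 q).
by apply: csum_ext => p; rewrite mulrA.
Qed.

Theorem theorem9 (R : realType) (a : nat -> R[i]) (P : R)
    (ha1 : cvgn (series (fun j => ComplexField.Normc.normc (a j))))
    (ha2 : cvgn (series (fun j => j.+1%:R * ComplexField.Normc.normc (a j) ^+ 2)))
    (hP : 0 < P) :
  let Q := matrix_op (Qmx a) in
  [/\ matrix_op_on_l2 (Qmx a), selfadjoint_op Q, compact_op Q &
  exists nu : R,
    [/\ 0 <= nu /\ greatest_eigenvalue Q (nu ^+ 2),
        exists xi0 h0, saddle_point a P xi0 h0,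
        is_minimum [set max_error a P h | h in Lambda R] (P * nu ^+ 2)%:E,
        (forall xi, Xi P xi ->
           is_minimum [set Delta a xi h | h in Lambda R] (min_error a xi)) /\
        is_maximum (values_on_Xi P (min_error a)) (P * nu ^+ 2)%:E &
        forall phi : nat -> R[i],
          is_eigenvector Q (nu ^+ 2)%:C phi -> l2_sqnorm phi = P ->
          (exists (xi : process R) (eps : int -> pr_space xi -> R[i]),
             white_noise (pr_prob xi) eps /\ moving_average phi eps) /\
          (forall (xi : process R) (eps : int -> pr_space xi -> R[i]),
             white_noise (pr_prob xi) eps -> moving_average phi eps ->
             least_favourable a P xi)]].
Proof.
move=> Q.
have [nu [nu0 hnu hge]] := hankel_greatest_eigenvalue ha1 ha2.
have l2a : l2 a := @l2_shift R a ha2 0%N.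
have hle : hankel_le nu a.
  split; first exact l2a.
  by move=> w hw; split; [exact: hankel_l2|exact: hnu].
have [h0 [h0b h0p]] := optimal_characteristic ha1 nu0 hle.
(* Admissibility for one finite measure already contains measurability; Lebesgue measure on the
   torus is used. *)
have Lh0 : Lambda R h0.
  by have [[]] := h0p _ (@lebesgue_torus_fin R).
pose V := (P * nu ^+ 2)%:E.
have upper xi : Xi P xi -> (Delta a xi h0 <= V)%E.
  exact: (Delta_upper_bound ha1 (ltW hP) h0b h0p).
have lower phi (xi : process R) (eps : int -> pr_space xi -> R[i]) :
    is_eigenvector Q (nu ^+ 2)%:C phi -> l2_sqnorm phi = P ->
    white_noise (pr_prob xi) eps -> moving_average phi eps ->
    Xi P xi /\ forall h, (V <= Delta a xi h)%E.
  move=> ephi nphi wn ma; have [l2phi _ _] := ephi; split.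
    by rewrite -nphi; exact: ma_process_Xi l2phi wn ma.
  move=> h; have := ma_Delta_lower_bound l2phi wn ma h ha1 ha2.
  suff -> : l2_sqnorm (hankel a phi) = P * nu ^+ 2 by [].
  have := eigenvector_hankel ha2 ephi; rewrite nphi -rmorphM /= => -[->].
  exact: mulrC.
have minE xi : Xi P xi -> (forall h, (V <= Delta a xi h)%E) -> min_error a xi = V.
  move=> hxi hV; apply: minimum_ereal_inf; split.
    by exists h0 => //; apply/eqP; rewrite eq_le upper //= hV.
  by move=> _ [h _ <-]; exact: hV.
have [phi0 [ephi0 nphi0]] :=
  eigenvector_normalized (Q_on_l2 ha2) hge.1 hP.
have [xi0 [eps0 [wn0 ma0]]] : exists (xi : process R) (eps : int -> pr_space xi -> R[i]),
    white_noise (pr_prob xi) eps /\ moving_average phi0 eps.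
  by have [l2phi0 _ _] := ephi0; exact: ma_process_exists.
have [X0 low0] := lower _ _ _ ephi0 nphi0 wn0 ma0.
(* Both bounds meet at this pair, so it is a saddle point with value [V], and both minimax
   equalities follow. *)
have D0 : Delta a xi0 h0 = V by apply/eqP; rewrite eq_le upper //= low0.
have ub : ubound (values_on_Xi P (min_error a)) V.
  move=> _ [xi hxi <-]; apply: le_trans (upper _ hxi).
  by apply: ereal_inf_lbound; exists h0.
split.
- exact: (Q_on_l2 ha2).
- exact: (Q_selfadjoint ha2).
- exact: (Q_compact ha2).
exists nu; split.
- by split.
- exists xi0, h0; split => //.
  + by move=> xi hxi; rewrite D0; exact: upper.
  + by move=> h _; rewrite D0.
- split.
    exists h0 => //; apply/eqP; rewrite eq_le; apply/andP; split.
      by apply: ub_ereal_sup => _ [xi hxi <-]; exact: upper.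
    by rewrite -/V -D0; apply: ereal_sup_ubound; exists xi0.
  move=> _ [h _ <-]; apply: le_trans (low0 h) _.
  by apply: ereal_sup_ubound; exists xi0.
- split; first by move=> xi _; exact: min_error_attained.
  by split => //; exists xi0 => //; exact: minE.
move=> phi ephi nphi; split.
  by have [l2phi _ _] := ephi; exact: ma_process_exists.
move=> xi eps wn ma; have [hxi low] := lower _ _ _ ephi nphi wn ma.
split => //; rewrite (minE xi) //; split => //.
by exists xi => //; exact: minE.
Qed.
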